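(* Let $V,H$ be Hilbert spaces over $\mathbb K=\mathbb R$ or $\mathbb C$ such that $V$ is continuously and densely embedded in $H$, let $\tau>0$, and let $\mathfrak a\colon[0,\tau]\times V\times V\to\mathbb K$ be a quasi-coercive non-autonomous form. Let $\Phi\colon H\to H$ be linear. The following statements are equivalent. (i) The problem $\mathcal P_\Phi$ is well-posed. (ii) $I-\Phi T(\tau)\colon H\to H$ is bijective.
   Context: $H$ is identified with a dense subspace of $V'$ via $x\mapsto(v\mapsto (x\mid v)_H)$. A quasi-coercive non-autonomous form is a map $\mathfrak a\colon[0,\tau]\times V\times V\to\mathbb K$ such that: (a) $\mathfrak a(t,\cdot,\cdot)$ is sesquilinear for all $t\in[0,\tau]$; (b) $\mathfrak a(\cdot,v,w)$ is measurable for all $v,w\in V$; (c) there is $M\ge0$ with $|\mathfrak a(t,v,w)|\le M\|v\|_V\|w\|_V$ for all $v,w\in V$, $t\in[0,\tau]$; (d) there are $\omega\in\mathbb R$, $\alpha>0$ with $\operatorname{Re}\mathfrak a(t,v,v)+\omega\|v\|_H^2\ge\alpha\|v\|_V^2$ for all $v\in V$, $t\in[0,\tau]$. $\mathcal A(t)\in\mathscr L(V,V')$ is given by $\langle\mathcal A(t)v,w\rangle_{V',V}=\mathfrak a(t,v,w)$. $\mathrm{MR}(V,V'):=H^1(0,\tau;V')\cap L^2(0,\tau;V)$, which is contained in $C([0,\tau];H)$. By Lions' theorem, for every $f\in L^2(0,\tau;V')$ and $x\in H$ there is a unique $u\in\mathrm{MR}(V,V')$ with $\dot u(t)+\mathcal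 A(t)u(t)=f(t)$ a.e. and $u(0)=x$. The linear operator $T(\tau)\colon H\to H$ is defined by $T(\tau)x=v(\tau)$, where $v\in\mathrm{MR}(V,V')$ is the unique solution of $\dot v+\mathcal A(\cdot)v=0$, $v(0)=x$. $\mathcal P_\Phi$ is called well-posed if for all $f\in L^2(0,\tau;V')$ there exists a unique $u\in\mathrm{MR}(V,V')$ such that $\dot u(t)+\mathcal A(t)u(t)=f(t)$ a.e. and $u(0)=\Phi u(\tau)$.
   Formalization: The equation u'+A(t)u=f a.e. is read as tested on each w in V (null set may depend on w); this is the stated meaning when V is separable, while for non-separable V the stated reading makes Lions' theorem, T(τ) and the equivalence fail. *)

(* Defs.v *)
From HB Require Import structures.
From mathcomp Require Import all_boot all_order all_algebra.
From mathcomp Require Import sesquilinear complex.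
From mathcomp Require Import all_classical all_reals all_analysis.
From mathcomp Require Import measurable_realfun.

Set Implicit Arguments.
Unset Strict Implicit.
Unset Printing Implicit Defensive.

Import Order.TTheory GRing.Theory Num.Theory.
Import numFieldTopology.Exports numFieldNormedType.Exports.

Local Open Scope classical_set_scope.
Local Open Scope ring_scope.

Inductive scalar_kind := RealScalars | ComplexScalars.

Definition scalar_field (R : realType) (k : scalar_kind) : numFieldType :=
  match k with
  | RealScalars => R : numFieldType
  | ComplexScalars => R[i] : numFieldType
  end.

Section scalar_operations.
Context {R : realType} {k : scalar_kind}.

Definition sRe : scalar_field R k -> R :=
  match k return scalar_field R k -> R with
  | RealScalars => fun x => x
  | ComplexScalars => fun z => complex.Re z
  end.

Definition sIm : scalar_field R k -> R :=
  match k return scalar_field R k -> R with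
  | RealScalars => fun=> 0
  | ComplexScalars => fun z => complex.Im z
  end.

Definition sconj : {rmorphism scalar_field R k -> scalar_field R k} :=
  match k return {rmorphism scalar_field R k -> scalar_field R k} with
  | RealScalars => idfun
  | ComplexScalars => @conjc R
  end.

Definition of_real : {rmorphism R -> scalar_field R k} :=
  match k return {rmorphism R -> scalar_field R k} with
  | RealScalars => idfun
  | ComplexScalars => real_complex R
  end.

Definition of_parts : R -> R -> scalar_field R k :=
  match k return R -> R -> scalar_field R k with
  | RealScalars => fun x _ => x
  | ComplexScalars => fun x y => Complex x y
  end.

End scalar_operations.

Section real_norm.
Context {R : realType} {k : scalar_kind}.
Local Notation K := (scalar_field R k).

Lemma of_real_le (x y : R) : (of_real x <= of_real y :> K) = (x <= y).
Proof. by case: k => //=; rewrite lecR. Qed.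

Lemma sRe_of_real (x : R) : sRe (of_real x : K) = x.
Proof. by case: k. Qed.

Lemma norm_of_real (x : R) : `|of_real x : K| = of_real `|x|.
Proof.
case: k => //=; rewrite normc_def /=; congr (_%:C)%C.
by rewrite expr0n addr0 sqrtr_sqr.
Qed.

Lemma norm_sconj (z : K) : `|sconj z| = `|z|.
Proof. by case: k z => //= z; rewrite normcJ. Qed.

Lemma of_real_sRe (z : K) : 0 <= z -> of_real (sRe z) = z.
Proof. by case: k z => //= z z0; rewrite RRe_real// realE z0. Qed.

(* the library norm of a normed module over K is K-valued *)
Definition rnorm (W : normedZmodType K) (x : W) : R := sRe `|x|.

Lemma of_real_rnorm (W : normedZmodType K) (x : W) : of_real (rnorm x) = `|x|.
Proof. exact: of_real_sRe. Qed.

Lemma rnorm_ge0 (W : normedZmodType K) (x : W) : 0 <= rnorm x.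
Proof. by rewrite -of_real_le of_real_rnorm rmorph0. Qed.

Lemma rnorm_le (W W' : normedZmodType K) (x : W) (y : W') :
  (rnorm x <= rnorm y) = (`|x| <= `|y|).
Proof. by rewrite -of_real_le !of_real_rnorm. Qed.

Lemma rnorm_eq0 (W : normedZmodType K) (x : W) : rnorm x = 0 -> x = 0.
Proof.
by move=> x0; apply/normr0_eq0; rewrite -of_real_rnorm x0 rmorph0.
Qed.

Lemma rnormD (W : normedZmodType K) (x y : W) :
  rnorm (x + y) <= rnorm x + rnorm y.
Proof. by rewrite -of_real_le rmorphD/= !of_real_rnorm ler_normD. Qed.

Lemma rnormM (x y : K) : rnorm (x * y) = rnorm x * rnorm y.
Proof.
have := of_real_rnorm (x * y); rewrite normrM -!of_real_rnorm -rmorphM/=.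
by move=> /(congr1 sRe); rewrite !sRe_of_real.
Qed.

Lemma rnormZ (W : normedModType K) (c : K) (x : W) :
  rnorm (c *: x) = rnorm c * rnorm x.
Proof.
have := of_real_rnorm (c *: x); rewrite normrZ -!of_real_rnorm -rmorphM/=.
by move=> /(congr1 sRe); rewrite !sRe_of_real.
Qed.

Lemma rnorm0 (W : normedZmodType K) : rnorm (0 : W) = 0.
Proof.
have := of_real_rnorm (0 : W); rewrite normr0 => /(congr1 sRe).
by rewrite sRe_of_real => ->; rewrite -(rmorph0 of_real) sRe_of_real.
Qed.

Lemma rnorm_of_real (x : R) : rnorm (of_real x : K) = `|x|.
Proof. by rewrite /rnorm norm_of_real sRe_of_real. Qed.

Lemma sqr_norm_sconj (z : K) : `|z| ^+ 2 = z * sconj z.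
Proof.
case: k z => /= z; last by rewrite sqr_normc.
by rewrite real_normK ?num_real// expr2.
Qed.

Lemma rnorm_sconj (z : K) : rnorm (sconj z) = rnorm z.
Proof. by rewrite /rnorm norm_sconj. Qed.

End real_norm.

Section antidual.
Context {R : realType} {k : scalar_kind} (V : normedModType (scalar_field R k)).
Local Notation K := (scalar_field R k).

Definition antilinear (f : V -> K) :=
  forall c v w, f (c *: v + w) = sconj c * f v + f w.

Definition bounded_functional (f : V -> K) :=
  exists M : R, forall v, rnorm (f v) <= M * rnorm v.

Definition antidual_pred : {pred V -> K^o} :=
  mem [set f : V -> K^o | antilinear f /\ bounded_functional f].

Record antidual := Antidual {
  antidual_fun :> V -> K^o;
  antidual_funP : antidual_fun \in antidual_pred }.

HB.instance Definition _ := [isSub for antidual_fun].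
HB.instance Definition _ := [Choice of antidual by <:].

Lemma antidual_submod_closed : submod_closed antidual_pred.
Proof.
split.
  rewrite inE; split; first by move=> c v w; rewrite mulr0 addr0.
  by exists 0 => v; rewrite mul0r rnorm0.
move=> c f g; rewrite !inE => -[fl [Mf fM]] [gl [Mg gM]]; split.
  move=> d v w.
  change (c * f (d *: v + w) + g (d *: v + w) =
    sconj d * (c * f v + g v) + (c * f w + g w) :> K).
  by rewrite fl gl !mulrDr [c * (_ * _)]mulrCA addrACA.
exists (rnorm c * Mf + Mg) => v.
apply: (le_trans (rnormD _ _)); rewrite mulrDl lerD//.
by rewrite /GRing.scale/= rnormM -mulrA ler_wpM2l ?rnorm_ge0.
Qed.

Lemma antidualP (f : antidual) : antilinear f /\ bounded_functional f.
Proof. by have := antidual_funP f; rewrite inE. Qed.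

Lemma antidual_eqP (f g : antidual) : f = g <-> f =1 g :> (V -> K^o).
Proof. by split=> [->//|fg]; apply/val_inj/funext. Qed.

HB.instance Definition _ :=
  GRing.isSubmodClosed.Build _ _ antidual_pred antidual_submod_closed.
HB.instance Definition _ := [SubChoice_isSubLmodule of antidual by <:].

Definition antidual_norm (f : antidual) : R :=
  sup [set rnorm (f v) | v in [set v | rnorm v <= 1]].

Lemma antidual0E v : (0 : antidual) v = 0.
Proof. by []. Qed.

Lemma antidualDE (f g : antidual) v : (f + g) v = f v + g v.
Proof. by []. Qed.

Lemma antidualZE c (f : antidual) v : (c *: f) v = c * f v.
Proof. by []. Qed.

Lemma antidual_of0 (f : antidual) : f 0 = 0.
Proof.
have [fl _] := antidualP f; have := fl 1 0 0.
rewrite scaler0 addr0 rmorph1 mul1r => /eqP.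
by rewrite -subr_eq0 opprD addNKr oppr_eq0 => /eqP.
Qed.

Lemma antidual_ofZ (f : antidual) c v : f (c *: v) = sconj c * f v.
Proof.
by have [fl _] := antidualP f; have := fl c v 0; rewrite addr0 antidual_of0 addr0.
Qed.

Let ball_image (f : antidual) := [set rnorm (f v) | v in [set v | rnorm v <= 1]].

Let ball_image_has_sup (f : antidual) : has_sup (ball_image f).
Proof.
split; first by exists 0; exists 0; rewrite ?antidual_of0 /= rnorm0.
have [_ [M fM]] := antidualP f; exists `|M| => _ [v /= v1 <-].
apply: (le_trans (fM v)); apply: (le_trans (ler_norm _)).
by rewrite normrM (ger0_norm (rnorm_ge0 v)) ler_piMr.
Qed.

Lemma antidual_norm_ge0 f : 0 <= antidual_norm f.
Proof.
apply: (ub_le_sup (ball_image_has_sup f).2).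
by exists 0; rewrite ?antidual_of0 /= rnorm0.
Qed.

Lemma antidual_norm_le (f : antidual) (M : R) : 0 <= M ->
  (forall v, rnorm (f v) <= M * rnorm v) -> antidual_norm f <= M.
Proof.
move=> M0 fM; apply: ge_sup; first exact: (ball_image_has_sup f).1.
by move=> _ [v /= v1 <-]; rewrite (le_trans (fM v))// ler_piMr.
Qed.

Lemma le_antidual_norm (f : antidual) v : rnorm (f v) <= antidual_norm f * rnorm v.
Proof.
have [/rnorm_eq0 ->|v0] := eqVneq (rnorm v) 0.
  by rewrite antidual_of0 !rnorm0 mulr0.
have vgt0 : 0 < rnorm v by rewrite lt_neqAle eq_sym v0 rnorm_ge0.
rewrite -ler_pdivrMr// mulrC; apply: (ub_le_sup (ball_image_has_sup f).2).
have nV : rnorm (of_real (rnorm v)^-1 : K) = (rnorm v)^-1.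
  by rewrite rnorm_of_real ger0_norm// invr_ge0 rnorm_ge0.
exists (of_real (rnorm v)^-1 *: v); first by rewrite /= rnormZ nV mulVf.
by rewrite antidual_ofZ rnormM rnorm_sconj nV.
Qed.

Lemma antidual_normD f g :
  of_real (antidual_norm (f + g)) <=
  of_real (antidual_norm f) + of_real (antidual_norm g) :> K.
Proof.
rewrite -rmorphD/= of_real_le antidual_norm_le ?addr_ge0 ?antidual_norm_ge0//.
move=> v; apply: (le_trans (rnormD _ _)).
by rewrite mulrDl lerD// le_antidual_norm.
Qed.

Lemma antidual_normZ c f :
  of_real (antidual_norm (c *: f)) = `|c| * of_real (antidual_norm f) :> K.
Proof.
have leZ d g : antidual_norm (d *: g) <= rnorm d * antidual_norm g.
  apply: antidual_norm_le => [|v]; first by rewrite mulr_ge0 ?rnorm_ge0 ?antidual_norm_ge0.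
  by rewrite rnormM -mulrA ler_wpM2l ?rnorm_ge0 ?le_antidual_norm.
rewrite -of_real_rnorm -rmorphM/=; congr (_ _); apply/le_anti.
rewrite leZ/=; have [->|c0] := eqVneq c 0; first by rewrite rnorm0 mul0r antidual_norm_ge0.
have cgt0 : 0 < rnorm c.
  by rewrite lt_neqAle rnorm_ge0 andbT eq_sym; apply: contra_neq c0 => /rnorm_eq0.
rewrite mulrC -ler_pdivlMr// mulrC.
have -> : (rnorm c)^-1 = rnorm c^-1.
  apply: (mulfI (lt0r_neq0 cgt0)); rewrite -rnormM !mulfV ?(gt_eqF cgt0)//.
  by rewrite /rnorm normr1 -(rmorph1 of_real) sRe_of_real.
by have := leZ c^-1 (c *: f); rewrite scalerA mulVf// scale1r.
Qed.

Lemma antidual_norm_eq0 f : of_real (antidual_norm f) = 0 :> K -> f = 0.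
Proof.
move=> /(congr1 sRe); rewrite -(rmorph0 of_real) !sRe_of_real => f0.
apply/antidual_eqP => v; apply/rnorm_eq0/le_anti.
by rewrite rnorm_ge0 (le_trans (le_antidual_norm f v))// f0 mul0r.
Qed.

HB.instance Definition _ := @Lmodule_isNormed.Build K antidual
  (of_real \o antidual_norm) antidual_normD antidual_normZ antidual_norm_eq0.

Lemma rnorm_antidual f : rnorm f = antidual_norm f.
Proof. exact: sRe_of_real. Qed.

End antidual.

(* measurability for the Lebesgue sigma-algebra, which completes the Borel one *)
Definition lebesgue_measurable_fun {R : realType} (D : set R) (g : R -> R) :=
  measurable_fun
    (D : set (g_sigma_algebraType (completed_algebra_gen (@lebesgue_measure R))))
    (g : _ -> measurableTypeR R).

Section bochner.
Context {R : realType} {k : scalar_kind}.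
Local Notation K := (scalar_field R k).
Local Notation mu := (@lebesgue_measure R).
Variable tau : R.

Definition scalar_integral (g : R -> K) : K :=
  of_parts (\int[mu]_(t in `[0, tau]) sRe (g t))
           (\int[mu]_(t in `[0, tau]) sIm (g t)).

Definition is_simple (W : normedModType K) (s : R -> W) :=
  finite_set (range s) /\
  forall x, measurable (s @^-1` [set x] : set (measurableTypeR R)).

(* Every class modulo a.e. equality of functions that are a.e. limits of simple
   functions has a representative that is an everywhere limit of Borel ones. *)
Definition strongly_measurable (W : normedModType K) (u : R -> W) :=
  exists2 s : nat -> R -> W, (forall n, is_simple (s n)) &
    forall t, t \in `[0, tau] -> s n t @[n --> \oo] --> u t.

Definition square_integrable (W : normedModType K) (u : R -> W) :=
  strongly_measurable u /\
  (\int[mu]_(t in `[0%R, tau]) (rnorm (u t) ^+ 2)%:E < +oo)%E.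

Definition ae_on (P : R -> Prop) := {ae mu, forall t, t \in `[0, tau] -> P t}.

Lemma ae_onS (P Q : R -> Prop) :
  (forall t, t \in `[0, tau] -> P t -> Q t) -> ae_on P -> ae_on Q.
Proof.
rewrite /ae_on => PQ.
apply: (@filterS _ (almost_everywhere mu) (ae_filter_ringOfSetsType _)).
by move=> t Pt t0; exact: PQ (Pt t0).
Qed.

Lemma ae_on_foralln (P : nat -> R -> Prop) :
  (forall n, ae_on (P n)) -> ae_on (fun t => forall n, P n t).
Proof.
rewrite /ae_on => PQ; have := ae_foralln PQ.
apply: (@filterS _ (almost_everywhere mu) (ae_filter_ringOfSetsType _)).
by move=> t Pt t0 n; exact: Pt.
Qed.

Definition test_function (phi : R -> R) :=
  [/\ forall t, derivable phi t 1, continuous (derive1 phi) &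
      exists a b, [/\ 0 < a, b < tau & forall t, t \notin `[a, b] -> phi t = 0]].

(* The Bochner integral of g in V' is the functional sending w to the integral
   of t |-> g t w, so the identity int phi' u = - int phi du in V' is written
   with both sides applied to w. *)
Definition weak_derivative (V : normedModType K) (u du : R -> antidual V) :=
  forall phi, test_function phi -> forall w : V,
    scalar_integral (fun t => of_real (derive1 phi t) * u t w) =
    - scalar_integral (fun t => of_real (phi t) * du t w).

Definition H1 (V : normedModType K) (u : R -> antidual V) :=
  square_integrable u /\
  exists2 du, square_integrable du & weak_derivative u du.

End bochner.

Section hilbert.
Context {R : realType} {k : scalar_kind}.
Local Notation K := (scalar_field R k).

(* The norm of H is the one of the inner product ip, so that the complete
   normed module H is a Hilbert space. *)
Definition hilbert_norm (H : completeNormedModType K) (ip : {dot H for @sconj R k}) :=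
  forall x, `|x| ^+ 2 = ip x x.

Definition continuous_dense_embedding (V H : completeNormedModType K)
    (j : {linear V -> H}) :=
  [/\ injective j, continuous j & dense (range j)].

End hilbert.

Section problem.
Context {R : realType} {k : scalar_kind}.
Local Notation K := (scalar_field R k).
Local Notation mu := (@lebesgue_measure R).
Context {V H : completeNormedModType K}.
Variables (ip : {dot H for @sconj R k}) (j : {linear V -> H}).
Variables (tau : R) (a : R -> V -> V -> K).

Record quasi_coercive_form : Prop := {
  form_sesquilinear : forall t, t \in `[0, tau] ->
    (forall w, linear_for *%R (a t ^~ w)) /\ (forall v, antilinear (a t v));
  form_measurable : forall v w,
    lebesgue_measurable_fun `[0, tau] (fun t => sRe (a t v w)) /\
    lebesgue_measurable_fun `[0, tau] (fun t => sIm (a t v w));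
  form_bounded : exists2 M : R, 0 <= M & forall t v w, t \in `[0, tau] ->
    rnorm (a t v w) <= M * rnorm v * rnorm w;
  form_quasi_coercive : exists omega alpha : R, 0 < alpha /\
    forall t v, t \in `[0, tau] ->
      alpha * rnorm v ^+ 2 <= sRe (a t v v) + omega * rnorm (j v) ^+ 2 }.

(* insubd 0 f is f when f is bounded and antilinear, see embE and opAE *)
Definition emb (x : H) : antidual V := insubd 0 (fun w : V => ip x (j w) : K^o).

Definition opA (t : R) (v : V) : antidual V := insubd 0 (a t v : V -> K^o).

Definition MR (u : R -> V) :=
  square_integrable tau u /\ H1 tau (fun t => emb (j (u t))).

(* u' + A(.)u = f a.e., tested on each w in V. For separable V the null set can
   be chosen independently of w (evolution_equation_ae). For general V the form
   only makes t |-> A(t)u(t) weakly measurable; A(.)u is then the element of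
   L^2(0, tau; V') whose value at each w is a.e. a(t, u(t), w). *)
Definition evolution_equation (f : R -> antidual V) (u : R -> V) :=
  exists du, [/\ square_integrable tau du,
    weak_derivative tau (fun t => emb (j (u t))) du &
    forall w : V, ae_on tau (fun t => (du t + opA t (u t)) w = f t w)].

Definition continuous_representative (u : R -> V) (U : R -> H) :=
  {within `[0, tau], continuous U} /\ ae_on tau (fun t => U t = j (u t)).

(* T(tau); by Lions' theorem the set below is a singleton for every x *)
Definition propagator (x : H) : H :=
  xget 0 [set y | exists v U,
    [/\ MR v, evolution_equation (fun=> 0) v, continuous_representative v U,
        U 0 = x & y = U tau]].

Definition solves_problem (Phi : H -> H) (f : R -> antidual V) (u : R -> V) :=
  [/\ MR u, evolution_equation f u &
      exists2 U, continuous_representative u U & U 0 = Phi (U tau)].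

Definition well_posed (Phi : H -> H) :=
  forall f : R -> antidual V, square_integrable tau f ->
    (exists u, solves_problem Phi f u) /\
    (forall u1 u2, solves_problem Phi f u1 -> solves_problem Phi f u2 ->
       ae_on tau (fun t => u1 t = u2 t)).

Lemma dot_cauchy_schwarz (x y : H) : hilbert_norm ip ->
  rnorm (ip x y) <= rnorm x * rnorm y.
Proof.
move=> ipE; have ipC z w : ip z w = sconj (ip w z).
  by rewrite hermC expr0 mul1r.
have [->|y0] := eqVneq y 0; first by rewrite linear0r !rnorm0 mulr0.
have yy : ip y y != 0 by rewrite -ipE expf_neq0// normr_eq0.
set c := ip x y / ip y y.
have cy : ip (x - c *: y) y = 0.
  by rewrite linearBl linearZl_LR /c/= divfK// subrr.
have xx : `|x| ^+ 2 = `|x - c *: y| ^+ 2 + `|c| ^+ 2 * `|y| ^+ 2.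
  have -> : `|x| ^+ 2 = `|(x - c *: y) + c *: y| ^+ 2 by rewrite subrK.
  rewrite !ipE; move: (x - c *: y) cy => z zy; clearbody c.
  rewrite linearDl !linearDr !linearZr_LR !linearZl_LR /= (ipC y z) zy.
  rewrite rmorph0 !mulr0 addr0 linearZr_LR/= add0r; congr (_ + _).
  change (c * (sconj c * ip y y) = `|c| * (`|c| * ip y y)).
  by rewrite !mulrA -sqr_norm_sconj expr2.
have : `|ip x y| ^+ 2 <= (`|x| * `|y|) ^+ 2.
  have -> : ip x y = c * ip y y by rewrite /c divfK.
  rewrite -ipE normrM normrX normr_id !exprMn xx mulrDl.
  rewrite [X in _ <= _ + X](_ : _ = `|c| ^+ 2 * (`|y| ^+ 2) ^+ 2); last first.
    by rewrite -(mulrA (`|c| ^+ 2)).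
  by rewrite lerDr mulr_ge0 ?exprn_ge0.
rewrite ler_sqr ?nnegrE ?mulr_ge0// -!of_real_rnorm -rmorphM/=.
by rewrite of_real_le.
Qed.

Lemma opAE t v w : quasi_coercive_form -> t \in `[0, tau] ->
  opA t v w = a t v w.
Proof.
move=> qa t0; rewrite /opA; set g := a t v.
suff gP : (g : V -> K^o) \in @antidual_pred R k V.
  by have := val_insubd (0 : antidual V) g; rewrite gP => /(congr1 (@^~ w)).
rewrite inE; split; first exact: (form_sesquilinear qa t0).2.
have [M _ aM] := form_bounded qa.
by exists (M * rnorm v) => z; exact: aM.
Qed.

Lemma embE x w : hilbert_norm ip -> continuous_dense_embedding j ->
  emb x w = ip x (j w).
Proof.
move=> ipE [_ j_cont _]; pose g := fun w : V => ip x (j w) : K^o.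
rewrite /emb -/g.
suff gP : (g : V -> K^o) \in @antidual_pred R k V.
  by have := val_insubd (0 : antidual V) g; rewrite gP => /(congr1 (@^~ w)).
rewrite inE; split.
  by move=> c v z; rewrite /g linearP linearDr linearZr_LR.
have /linear_boundedP/pinfty_ex_gt0[M M0 jM] := continuous_linear_bounded 0 (j_cont 0).
exists (rnorm x * sRe M) => v; rewrite -mulrA.
apply: (le_trans (dot_cauchy_schwarz _ _ ipE)); rewrite ler_wpM2l ?rnorm_ge0//.
by rewrite -(@of_real_le R k) rmorphM/= !of_real_rnorm (of_real_sRe (ltW M0)).
Qed.

Lemma evolution_equation_ae (D : set V) f u :
  countable D -> dense D ->
  evolution_equation f u <->
  exists du, [/\ square_integrable tau du,
    weak_derivative tau (fun t => emb (j (u t))) du &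
    ae_on tau (fun t => du t + opA t (u t) = f t)].
Proof.
move=> cD dD; split=> -[du [L2du wd eqn]]; exists du; split=> //; last first.
  by move=> w; apply: ae_onS eqn => t _ ->.
have [D0|[g]] := pfcard_geP cD.
  by have [||v [_]] := dD setT; [exists 0|exact: openT|rewrite D0].
have : ae_on tau (fun t => forall n, (du t + opA t (u t)) (g n) = f t (g n)).
  by apply: ae_on_foralln => n; exact: eqn.
apply: ae_onS => t t0 tD; apply/eqP; rewrite -subr_eq0; apply/eqP.
set h := _ - _; have hD d : D d -> h d = 0.
  move=> Dd; have [n _ <-] := surj (f := g) Dd.
  by apply/eqP; rewrite subr_eq0; apply/eqP; exact: tD.
apply/antidual_eqP => w; apply: contrapT => hw.
have hw0 : 0 < rnorm (h w).
  by rewrite lt_neqAle rnorm_ge0 andbT eq_sym; apply/eqP => /rnorm_eq0.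
have M0 : 0 < rnorm h + 1 by rewrite ltr_wpDl ?rnorm_ge0.
pose e : R := rnorm (h w) / (rnorm h + 1).
have e0 : 0 < e by rewrite divr_gt0.
have oe0 : 0 < of_real e :> K.
  by rewrite lt_neqAle -(rmorph0 of_real) of_real_le ltW// andbT fmorph_eq eq_sym gt_eqF.
have [||d [wd' /hD hd0]] := dD (ball w (of_real e)) _ _.
- by exists w; exact: ballxx.
- exact: ball_open.
have hwd : h w = h (w - d).
  have := (antidualP h).1 1 (w - d) d.
  by rewrite scale1r subrK hd0 addr0 rmorph1 mul1r.
have wde : rnorm (w - d) < e.
  move: wd'; rewrite -ball_normE /= -of_real_rnorm.
  by rewrite !lt_neqAle fmorph_eq of_real_le.
suff : rnorm (h w) < rnorm (h w) by rewrite ltxx.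
rewrite {1}hwd; apply: (le_lt_trans (le_antidual_norm h _)).
rewrite -rnorm_antidual; apply: (@le_lt_trans _ _ ((rnorm h + 1) * rnorm (w - d))).
  by rewrite ler_wpM2r ?rnorm_ge0// lerDl.
by rewrite mulrC -ltr_pdivlMr.
Qed.

End problem.

(* Main.v *)
Require Import Defs.
From HB Require Import structures.
From mathcomp Require Import all_boot all_order all_algebra.
From mathcomp Require Import sesquilinear complex.
From mathcomp Require Import all_classical all_reals all_analysis.
From mathcomp Require Import measurable_realfun.
From mathcomp Require Import ring lra.

(* Restricting the scalars to R and keeping real parts of inner products, forms
   and functionals, and identifying V' with V by the Riesz isomorphism, reduces
   everything to real Hilbert spaces, as an antilinear functional is determined
   by its real part.

   Let A act on L^2(0, tau; V) by a coercive form and K y = (y' + A y, y(0)) for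
   finite sums y of products of a C^1 function and a vector of V.  By the energy
   identity the norm of K y in L^2(0, tau; V') x H controls y in L^2(0, tau; V)
   and, testing with y cut off at time s, each y(s) in H.  The range of K is dense:
   if p is orthogonal to it, test with the solution g of g + eta g' = p,
   g(0) = 0, and let eta tend to 0.  Hence solutions are limits of such y, which gives
   Lions' theorem together with the continuous representative in H.  The same
   regularization, backwards in time, yields uniqueness.  Multiplication by
   e^(omega t) reduces the quasi-coercive case to the coercive one.

   If I - Phi T is bijective, the solution of P_Phi is v + w where v is the
   solution for f with v(0) = 0 and w the one for 0 with w(0) = x, where
   (I - Phi T) x = Phi (v(tau)).  Conversely, a kernel element of I - Phi T gives a
   nonzero solution of P_Phi for f = 0; and for y in H let w be the solution for 0
   with w(0) = y.  Then v(t) = (1 - t / tau) w(t) solves the equation for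
   f = - w / tau, with v(0) = y and v(tau) = 0; if u solves P_Phi for this f, then
   x = v(0) - u(0) satisfies T x = - u(tau), hence x - Phi (T x) = y. *)

Set Implicit Arguments.
Unset Strict Implicit.
Unset Printing Implicit Defensive.

Import Order.TTheory GRing.Theory Num.Theory.
Import numFieldTopology.Exports numFieldNormedType.Exports.

Local Open Scope classical_set_scope.
Local Open Scope ring_scope.

(** * Hilbert spaces *)

(* The inner product is only required to be semi-definite, so that the space of
   square integrable functions needs no quotient. *)
Record prehilbert (R : realType) := PreHilbert {
  hsort :> lmodType R;
  dot : hsort -> hsort -> R;
  dotC : forall x y, dot x y = dot y x;
  dotPl : forall a x y z, dot (a *: x + y) z = a * dot x z + dot y z;
  dot_ge0 : forall x, 0 <= dot x x }.

Section prehilbert_theory.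
Context {R : realType} (X : prehilbert R).
Implicit Types (x y z : X) (a : R).

Definition vnorm x : R := Num.sqrt (dot x x).

Definition vcvg (u : nat -> X) x := vnorm (u n - x) @[n --> \oo] --> (0 : R).

Lemma dot0l x : dot 0 x = 0.
Proof. have := dotPl 1 0 0 x; rewrite scaler0 addr0; lra. Qed.

Lemma dotDl x y z : dot (x + y) z = dot x z + dot y z.
Proof. by have := dotPl 1 x y z; rewrite scale1r mul1r. Qed.

Lemma dotZl a x z : dot (a *: x) z = a * dot x z.
Proof. by have := dotPl a x 0 z; rewrite addr0 dot0l addr0. Qed.

Lemma dotNl x z : dot (- x) z = - dot x z.
Proof. by rewrite -scaleN1r dotZl mulN1r. Qed.

Lemma dotBl x y z : dot (x - y) z = dot x z - dot y z.
Proof. by rewrite dotDl dotNl. Qed.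

Lemma dot0r x : dot x 0 = 0. Proof. by rewrite dotC dot0l. Qed.

Lemma dotDr x y z : dot z (x + y) = dot z x + dot z y.
Proof. by rewrite dotC dotDl !(dotC z). Qed.

Lemma dotZr a x z : dot z (a *: x) = a * dot z x.
Proof. by rewrite dotC dotZl (dotC z). Qed.

Lemma dotNr x z : dot z (- x) = - dot z x.
Proof. by rewrite dotC dotNl (dotC z). Qed.

Lemma dotBr x y z : dot z (x - y) = dot z x - dot z y.
Proof. by rewrite dotDr dotNr. Qed.

Definition dotE := (dotDl, dotDr, dotBl, dotBr, dotZl, dotZr, dotNl, dotNr).

Lemma vnorm_ge0 x : 0 <= vnorm x. Proof. exact: sqrtr_ge0. Qed.

Lemma sqr_vnorm x : vnorm x ^+ 2 = dot x x.
Proof. by rewrite sqr_sqrtr// dot_ge0. Qed.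

Lemma dot_norm_le x y : `|dot x y| <= vnorm x * vnorm y.
Proof.
have h s : 0 <= dot x x + 2 * s * dot x y + s ^+ 2 * dot y y.
  have := dot_ge0 (x + s *: y); rewrite !dotE (dotC y x).
  by rewrite expr2; lra.
rewrite -[leLHS]sqrtr_sqr -sqrtrM ?dot_ge0// ler_wsqrtr//.
have [y0|y0] := eqVneq (dot y y) 0.
  have [->|xy0] := eqVneq (dot x y) 0; first by rewrite y0 mulr0 expr0n.
  have := h (- (dot x x + 1) / (2 * dot x y)); rewrite y0 mulr0 addr0.
  suff -> : 2 * (- (dot x x + 1) / (2 * dot x y)) * dot x y = - (dot x x + 1) by lra.
  by field.
have yy : 0 < dot y y by rewrite lt_neqAle eq_sym y0 dot_ge0.
have := h (- dot x y / dot y y).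
rewrite -(pmulr_rge0 _ yy).
suff -> : dot y y * (dot x x + 2 * (- dot x y / dot y y) * dot x y +
  (- dot x y / dot y y) ^+ 2 * dot y y) = dot x x * dot y y - dot x y ^+ 2 by lra.
by field.
Qed.

Lemma dot_le x y : dot x y <= vnorm x * vnorm y.
Proof. exact: le_trans (ler_norm _) (dot_norm_le _ _). Qed.

Lemma vnormD x y : vnorm (x + y) <= vnorm x + vnorm y.
Proof.
rewrite -ler_sqr ?nnegrE ?addr_ge0 ?vnorm_ge0// sqr_vnorm !dotE (dotC y).
by have := dot_le x y; have := sqr_vnorm x; have := sqr_vnorm y; rewrite !expr2; nra.
Qed.

Lemma vnormZ a x : vnorm (a *: x) = `|a| * vnorm x.
Proof. by rewrite /vnorm !dotE mulrA -expr2 sqrtrM ?sqr_ge0// sqrtr_sqr. Qed.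

Lemma vnormN x : vnorm (- x) = vnorm x.
Proof. by rewrite -scaleN1r vnormZ normrN1 mul1r. Qed.

Lemma vnorm0 : vnorm 0 = 0.
Proof. by rewrite /vnorm dot0l sqrtr0. Qed.

Lemma vnormBC x y : vnorm (x - y) = vnorm (y - x).
Proof. by rewrite -vnormN opprB. Qed.

Lemma ler_vnormB x y : `|vnorm x - vnorm y| <= vnorm (x - y).
Proof.
rewrite ler_norml; apply/andP; split.
  have := vnormD (y - x) x; rewrite subrK vnormBC; lra.
have := vnormD (x - y) y; rewrite subrK; lra.
Qed.

Lemma vnorm_distD z x y : vnorm (x - y) <= vnorm (x - z) + vnorm (z - y).
Proof. by apply: le_trans (vnormD _ _); rewrite addrA subrK. Qed.

Lemma dot_null x y : vnorm x = 0 -> dot x y = 0.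
Proof.
move=> x0; apply/eqP; rewrite -normr_eq0; apply/eqP/le_anti.
by rewrite normr_ge0 andbT (le_trans (dot_norm_le _ _))// x0 mul0r.
Qed.

Lemma vcvgP u x : vcvg u x <->
  forall e : R, 0 < e -> exists N, forall n, (N <= n)%N -> vnorm (u n - x) <= e.
Proof.
split=> [ux e e0|h].
  move/cvgrPdist_le : ux => /(_ e e0)[N _ h]; exists N => n Nn.
  by have := h n Nn; rewrite /= sub0r normrN ger0_norm ?vnorm_ge0.
apply/cvgrPdist_le => e e0; have [N h'] := h e e0; exists N => // n Nn.
by rewrite sub0r normrN ger0_norm ?vnorm_ge0//; exact: h'.
Qed.

Lemma vcvg_cauchy u x : vcvg u x -> forall e : R, 0 < e ->
  exists N, forall n m, (N <= n)%N -> (N <= m)%N -> vnorm (u n - u m) <= e.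
Proof.
move=> /vcvgP ux e e0; have [N h] := ux (e / 2) ltac:(lra).
exists N => n m Nn Nm; apply: (le_trans (vnorm_distD x _ _)).
by rewrite (vnormBC x); have := h n Nn; have := h m Nm; lra.
Qed.

Lemma cvg_dot u x v y : vcvg u x -> vcvg v y ->
  dot (u n) (v n) @[n --> \oo] --> dot x y.
Proof.
move=> ux vy; apply/subr_cvg0.
apply: (@squeeze_cvgr _ _ _ _
  (fun n => - (vnorm (u n - x) * vnorm (v n - y) + vnorm (u n - x) * vnorm y +
     vnorm x * vnorm (v n - y)))
  (fun n => vnorm (u n - x) * vnorm (v n - y) + vnorm (u n - x) * vnorm y +
     vnorm x * vnorm (v n - y))).
- apply: nearW => n; rewrite -ler_norml.
  have -> : dot (u n) (v n) - dot x y =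
     dot (u n - x) (v n - y) + dot (u n - x) y + dot x (v n - y).
    by rewrite !dotE; lra.
  apply: (le_trans (ler_normD _ _)); rewrite lerD ?dot_norm_le//.
  by apply: (le_trans (ler_normD _ _)); rewrite lerD ?dot_norm_le.
- rewrite -[X in _ --> X]oppr0; apply: cvgN.
  rewrite (_ : 0 = 0 * 0 + 0 * vnorm y + vnorm x * 0); last by lra.
  by apply: cvgD; [apply: cvgD|]; apply: cvgM => //; exact: cvg_cst.
- rewrite [X in _ --> X](_ : 0 = 0 * 0 + 0 * vnorm y + vnorm x * 0); last by lra.
  by apply: cvgD; [apply: cvgD|]; apply: cvgM => //; exact: cvg_cst.
Qed.

Lemma vcvg_cst x : vcvg (fun=> x) x.
Proof. by rewrite /vcvg subrr vnorm0; exact: cvg_cst. Qed.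

Lemma vcvg_le u x (r : nat -> R) : r n @[n --> \oo] --> 0 ->
  (forall n, vnorm (u n - x) <= r n) -> vcvg u x.
Proof.
move=> r0 ur; apply: (@squeeze_cvgr _ _ _ _ (fun=> 0) r) => //.
  by apply: nearW => n; rewrite vnorm_ge0 ur.
exact: cvg_cst.
Qed.

Lemma vcvgD u x v y : vcvg u x -> vcvg v y -> vcvg (fun n => u n + v n) (x + y).
Proof.
move=> ux vy; apply: (@vcvg_le _ _ (fun n => vnorm (u n - x) + vnorm (v n - y))).
  by rewrite -[X in _ --> X]addr0; exact: cvgD.
by move=> n; rewrite opprD addrACA vnormD.
Qed.

Lemma vcvgZ a u x : vcvg u x -> vcvg (fun n => a *: u n) (a *: x).
Proof.
move=> ux; apply: (@vcvg_le _ _ (fun n => `|a| * vnorm (u n - x))).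
  by rewrite -[X in _ --> X](mulr0 `|a|); apply: cvgM => //; exact: cvg_cst.
by move=> n; rewrite -scalerBr vnormZ.
Qed.

Lemma vcvgN u x : vcvg u x -> vcvg (fun n => - u n) (- x).
Proof.
by move=> /(vcvgZ (-1)); under eq_fun do rewrite scaleN1r; rewrite scaleN1r.
Qed.

Lemma vcvgB u x v y : vcvg u x -> vcvg v y -> vcvg (fun n => u n - v n) (x - y).
Proof. by move=> ux vy; apply: vcvgD => //; exact: vcvgN. Qed.

Lemma cvg_vnorm u x : vcvg u x -> vnorm (u n) @[n --> \oo] --> vnorm x.
Proof.
move=> ux; apply/subr_cvg0.
apply: (@squeeze_cvgr _ _ _ _ (fun n => - vnorm (u n - x)) (fun n => vnorm (u n - x))) => //.
  by apply: nearW => n; rewrite -ler_norml ler_vnormB.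
by rewrite -[X in _ --> X]oppr0; exact: cvgN.
Qed.

Lemma vcvg_unique u x y : vcvg u x -> vcvg u y -> vnorm (x - y) = 0.
Proof.
move=> ux uy; have /cvg_vnorm := vcvgB ux uy; under eq_fun do rewrite subrr vnorm0.
by move=> /(cvg_unique (@Rhausdorff R) (cvg_cst _)).
Qed.

End prehilbert_theory.

Record hilbert (R : realType) := Hilbert {
  hpre :> prehilbert R;
  hcomplete : forall u : nat -> hpre,
    (forall e : R, 0 < e -> exists N, forall n m, (N <= n)%N -> (N <= m)%N ->
      vnorm (u n - u m) <= e) -> exists x, vcvg u x }.

Section hilbert_theory.
Context {R : realType} (X : hilbert R).

Lemma dot_linear_ge0 (c d : R) : (forall s, 0 <= s * c + s ^+ 2 * d) -> c = 0.
Proof.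
move=> h; apply/eqP; case: (eqVneq c 0) => // c0; exfalso.
have h1 := h (- c / (2 * (1 + `|d|))).
have d0 : 0 < 2 * (1 + `|d|) by have := normr_ge0 d; lra.
have : 0 <= (- c / (2 * (1 + `|d|)) * c +
  (- c / (2 * (1 + `|d|))) ^+ 2 * d) * (2 * (1 + `|d|)) ^+ 2.
  by rewrite mulr_ge0// sqr_ge0.
have -> : (- c / (2 * (1 + `|d|)) * c +
  (- c / (2 * (1 + `|d|))) ^+ 2 * d) * (2 * (1 + `|d|)) ^+ 2 =
  c ^+ 2 * (d - 2 * (1 + `|d|)).
  by field; rewrite gt_eqF//; have := normr_ge0 d; lra.
rewrite pmulr_rge0; first by have := ler_norm d; have := normr_ge0 d; lra.
by rewrite exprn_even_gt0.
Qed.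

(* Lions' form of the Riesz theorem: a functional dominated by |K y| is
   represented by an element of the closure of the range of K. *)
Lemma riesz_range (Y : lmodType R) (K : Y -> X) (l : Y -> R) (C : R) :
  (forall a (y z : Y) x, dot (K (a *: y + z)) x = a * dot (K y) x + dot (K z) x) ->
  (forall a (y z : Y), l (a *: y + z) = a * l y + l z) ->
  (forall y : Y, l y <= C * vnorm (K y)) ->
  exists u g, vcvg (K \o g) u /\ forall y : Y, dot u (K y) = l y.
Proof.
move=> KL lL lC.
pose J (y : Y) := dot (K y) (K y) - 2 * l y.
have Jge (y : Y) : - C ^+ 2 <= J y.
  rewrite /J -sqr_vnorm; have := lC y; have := sqr_ge0 (vnorm (K y) - C).
  rewrite !expr2; nra.
have JhasI : has_inf (range J).
  by split; [exists (J 0); exists 0|exists (- C ^+ 2) => _ [y _ <-]].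
pose m := inf (range J).
have mJ (y : Y) : m <= J y by apply: ge_inf; [exact: JhasI.2|exists y].
have [g gm] : {g : nat -> Y & forall n, J (g n) < m + n.+1%:R^-1}.
  apply: (@choice _ _ (fun n (y : Y) => J y < m + n.+1%:R^-1)) => n.
  have := @inf_adherent _ (range J) n.+1%:R^-1 ltac:(by rewrite invr_gt0) JhasI.
  by move=> [_ [y _ <-]] h; exists y.
have l0 : l 0 = 0 by have := lL 1 0 0; rewrite scaler0 addr0; lra.
have KD (y z : Y) x : dot (K (y + z)) x = dot (K y) x + dot (K z) x.
  by rewrite -[y]scale1r KL scale1r mul1r.
have K0 x : dot (K 0) x = 0 by have := KD 0 0 x; rewrite addr0; lra.
have KZ a (y : Y) x : dot (K (a *: y)) x = a * dot (K y) x.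
  by rewrite -[a *: y]addr0 KL K0 addr0.
have KDr (y z : Y) x : dot x (K (y + z)) = dot x (K y) + dot x (K z).
  by rewrite dotC KD !(dotC x).
have KZr a (y : Y) x : dot x (K (a *: y)) = a * dot x (K y).
  by rewrite dotC KZ (dotC x).
have lZ a (y : Y) : l (a *: y) = a * l y by rewrite -[a *: y]addr0 lL l0 addr0.
have lD (y z : Y) : l (y + z) = l y + l z by rewrite -[y]scale1r lL scale1r mul1r.
have [u gu] : exists u, vcvg (K \o g) u.
  apply: hcomplete => e e0.
  pose N := Num.truncn (4 / e ^+ 2).
  have ltN n : (N <= n)%N -> n.+1%:R^-1 <= e ^+ 2 / 4.
    move=> Nn; rewrite -[e ^+ 2 / 4]invrK lef_pV2 ?posrE ?invr_gt0 ?divr_gt0 ?exprn_gt0//.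
    rewrite invf_div; apply/ltW; apply: (lt_le_trans (truncnS_gt _)).
    by rewrite ler_nat ltnS.
  exists N => p q Np Nq; rewrite -ler_sqr ?nnegrE ?vnorm_ge0 ?(ltW e0)// sqr_vnorm /=.
  have : m <= J (2^-1 *: (g p + g q)) by exact: mJ.
  have := gm p; have := gm q; have := ltN p Np; have := ltN q Nq.
  rewrite /J !(KZ, KD, KZr, KDr, lZ, lD) ?dotE (dotC (K (g q)) (K (g p))).
  move: (p.+1%:R^-1) (q.+1%:R^-1) => p' q'; lra.
exists u, g; split=> // y; apply/eqP; rewrite -subr_eq0; apply/eqP.
suff : 2 * (dot u (K y) - l y) = 0 by lra.
apply: (@dot_linear_ge0 _ (dot (K y) (K y))) => s.
have lim : 2 * s * (dot (K (g n)) (K y) - l y) + s ^+ 2 * dot (K y) (K y)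
    + n.+1%:R^-1 @[n --> \oo] -->
    2 * s * (dot u (K y) - l y) + s ^+ 2 * dot (K y) (K y) + 0.
  apply: cvgD; last exact: cvg_harmonic.
  apply: cvgD; last exact: cvg_cst.
  apply: cvgM; first exact: cvg_cst.
  by apply: cvgB; [exact: (cvg_dot gu (vcvg_cst _))|exact: cvg_cst].
suff : 0 <= 2 * s * (dot u (K y) - l y) + s ^+ 2 * dot (K y) (K y) + 0 by lra.
apply: (cvgr_to_ge lim); apply: nearW => n.
have := mJ (g n + s *: y); have := gm n.
rewrite /J !(KZ, KD, KZr, KDr, lZ, lD) ?dotE (dotC (K y) (K (g n))) expr2.
by move: (n.+1%:R^-1) => n'; lra.
Qed.

Lemma riesz (l : X -> R) (C : R) :
  (forall a y z, l (a *: y + z) = a * l y + l z) ->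
  (forall y, l y <= C * vnorm y) -> exists u, forall y, dot u y = l y.
Proof. by move=> lL lC; have [u [g [_ h]]] := @riesz_range X id l C (@dotPl _ X) lL lC; exists u. Qed.

Lemma dense_range (Y : lmodType R) (K : Y -> X) :
  (forall a (y z : Y) x, dot (K (a *: y + z)) x = a * dot (K y) x + dot (K z) x) ->
  (forall p, (forall y : Y, dot p (K y) = 0) -> vnorm p = 0) ->
  forall x, exists g, vcvg (K \o g) x.
Proof.
move=> KL orth x.
have [|y|u [g [gu h]]] := @riesz_range Y K (fun y : Y => dot x (K y)) (vnorm x) KL.
- by move=> a y z; rewrite !(dotC x) KL.
- exact: dot_le.
have ux : vnorm (u - x) = 0 by apply: orth => y; rewrite dotBl h subrr.
exists g; apply: (vcvg_le gu) => n.
by apply: (le_trans (vnorm_distD u _ _)); rewrite ux addr0.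
Qed.

End hilbert_theory.

(** * Integration on [0, tau] *)

Lemma ae_onS2 (R : realType) (tau : R) (P Q S : R -> Prop) :
  (forall t, t \in `[0, tau] -> P t -> Q t -> S t) ->
  ae_on tau P -> ae_on tau Q -> ae_on tau S.
Proof.
rewrite /ae_on => PQS.
apply: (@filterS2 _ (almost_everywhere lebesgue_measure)
  (ae_filter_ringOfSetsType _)) => t Pt Qt tD.
by apply: PQS => //; [exact: Pt|exact: Qt].
Qed.

Lemma ae_onW (R : realType) (tau : R) (P : R -> Prop) :
  (forall t, t \in `[0, tau] -> P t) -> ae_on tau P.
Proof. by move=> h; apply: aeW => t /h. Qed.

Section interval_integral.
Context {R : realType} (tau : R).
Local Notation mu := (@lebesgue_measure R).
Local Notation D := ([set` `[0, tau]] : set (measurableTypeR R)).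
Implicit Types (f g h : R -> R).

Definition integ f := mu.-integrable D (EFin \o f).

Definition intg f : R := \int[mu]_(t in D) f t.

Lemma measurable_dom : measurable D.
Proof. exact: measurable_itv. Qed.

Hint Resolve measurable_dom : core.

Lemma integ_measurable f : integ f -> measurable_fun D f.
Proof. by move/integrableP => [/measurable_EFinP]. Qed.

Lemma eq_integ f g : (forall t, t \in `[0, tau] -> f t = g t) -> integ f -> integ g.
Proof. by move=> fg; apply: eq_integrable => // t; rewrite inE => tD /=; rewrite fg. Qed.

Lemma integD f g : integ f -> integ g -> integ (fun t => f t + g t).
Proof. by move=> fi gi; exact: (integrableD measurable_dom fi gi). Qed.

Lemma integZ c f : integ f -> integ (fun t => c * f t).
Proof. by move=> fi; exact: (integrableZl measurable_dom c fi). Qed.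

Lemma integN f : integ f -> integ (fun t => - f t).
Proof. by move=> /(integZ (-1)); apply: eq_integ => t _; rewrite mulN1r. Qed.

Lemma integB f g : integ f -> integ g -> integ (fun t => f t - g t).
Proof. by move=> fi gi; apply: integD => //; exact: integN. Qed.

Lemma le_integ f g : measurable_fun D f ->
  (forall t, t \in `[0, tau] -> `|f t| <= g t) -> integ g -> integ f.
Proof.
move=> mf fg; apply: le_integrable => //; first exact/measurable_EFinP.
by move=> t tD /=; rewrite lee_fin (le_trans (fg t tD))// ler_norm.
Qed.

Lemma integ_norm f : integ f -> integ (fun t => `|f t|).
Proof. by move=> fi; exact: (integrable_norm fi). Qed.

Lemma integ_cst c : integ (fun=> c).
Proof.
apply: (measurable_bounded_integrable (mu := mu)) => //.
  by rewrite /= lebesgue_measure_itv/=; case: ifP => //; rewrite -EFinB ltry.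
by exists `|c|; split=> // x xc t _; exact: ltW.
Qed.

Lemma integM_bounded f g (M : R) : measurable_fun D g ->
  (forall t, t \in `[0, tau] -> `|g t| <= M) -> integ f -> integ (fun t => g t * f t).
Proof.
move=> mg gM fi; apply: (@le_integ _ (fun t => M * `|f t|)).
- by apply: measurable_funM => //; exact: integ_measurable.
- by move=> t tD; rewrite normrM ler_wpM2r// gM.
- by apply: integZ; exact: integ_norm.
Qed.

Lemma intgD f g : integ f -> integ g ->
  intg (fun t => f t + g t) = intg f + intg g.
Proof. by move=> fi gi; exact: RintegralD. Qed.

Lemma intgZ c f : integ f -> intg (fun t => c * f t) = c * intg f.
Proof. by move=> fi; exact: RintegralZl. Qed.

Lemma eq_intg f g : (forall t, t \in `[0, tau] -> f t = g t) -> intg f = intg g.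
Proof. by move=> fg; apply: eq_Rintegral => t; rewrite inE => /fg. Qed.

Lemma intgN f : integ f -> intg (fun t => - f t) = - intg f.
Proof. by move=> /(intgZ (-1)); rewrite mulN1r => <-; apply: eq_intg => t _; rewrite mulN1r. Qed.

Lemma intgB f g : integ f -> integ g ->
  intg (fun t => f t - g t) = intg f - intg g.
Proof. by move=> fi gi; rewrite intgD ?intgN//; exact: integN. Qed.

Lemma intg0 : intg (fun=> 0) = 0.
Proof. by rewrite /intg Rintegral_cst// mul0r. Qed.

Lemma le_intg f g : integ f -> integ g ->
  (forall t, t \in `[0, tau] -> f t <= g t) -> intg f <= intg g.
Proof. by move=> fi gi fg; exact: le_Rintegral. Qed.

Lemma intg_ge0 f : (forall t, t \in `[0, tau] -> 0 <= f t) -> 0 <= intg f.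
Proof. by move=> f0; exact: Rintegral_ge0. Qed.

Lemma intg_norm_le f g : integ f -> integ g ->
  (forall t, t \in `[0, tau] -> `|f t| <= g t) -> `|intg f| <= intg g.
Proof.
move=> fi gi fg; rewrite ler_norml -intgN//; apply/andP; split; apply: le_intg => //.
- exact: integN.
- by move=> t /fg; rewrite ler_norml => /andP[].
- by move=> t /fg; rewrite ler_norml => /andP[].
Qed.

Lemma intg_ae f g : measurable_fun D f -> measurable_fun D g ->
  ae_on tau (fun t => f t = g t) -> intg f = intg g.
Proof.
move=> mf mg fg; rewrite /intg /Rintegral; congr fine.
apply: ae_eq_integral => //; [exact/measurable_EFinP..|].
apply: (@filterS _ (almost_everywhere mu) (ae_filter_ringOfSetsType _)) fg.
by move=> t h tD; rewrite /= h.
Qed.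

Lemma le_intg_ae f g : integ f -> integ g ->
  ae_on tau (fun t => f t <= g t) -> intg f <= intg g.
Proof.
move=> fi gi fg; pose h t := Num.max (f t) (g t).
have mh : measurable_fun D h by apply: measurable_maxr; exact: integ_measurable.
have hi : integ h.
  apply: (@le_integ _ (fun t => `|f t| + `|g t|)) => // [t _|].
    have [->|->] : h t = f t \/ h t = g t by rewrite /h; case: leP; [right|left].
      by rewrite lerDl.
    by rewrite lerDr.
  by apply: integD; exact: integ_norm.
rewrite (_ : intg g = intg h).
  by apply: le_intg => // t _; rewrite /h le_max lexx.
apply: intg_ae => //; first exact: integ_measurable.
by apply: ae_onS fg => t _ ht; rewrite /h max_r.
Qed.

Lemma intg_eq0 f : integ f -> (forall t, t \in `[0, tau] -> 0 <= f t) ->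
  intg f = 0 -> ae_on tau (fun t => f t = 0).
Proof.
move=> fi f0 If0; have mf := integ_measurable fi.
have : (\int[mu]_(t in D) `|(EFin \o f) t|)%E = 0%E.
  transitivity (\int[mu]_(t in D) (f t)%:E)%E.
    by apply: eq_integral => t; rewrite inE => tD /=; rewrite ger0_norm// f0.
  rewrite -[LHS]fineK ?(integrable_fin_num _ fi)//.
  by rewrite -[X in X = _]/((intg f)%:E) If0.
move=> /(ae_eq_integral_abs mu measurable_dom (measurable_int _ fi)).
apply: (@filterS _ (almost_everywhere mu) (ae_filter_ringOfSetsType _)).
by move=> t h tD; have [] := h tD.
Qed.

Lemma EFin_intg f : integ f -> (intg f)%:E = (\int[mu]_(t in D) (f t)%:E)%E.
Proof. by move=> fi; rewrite /intg /Rintegral fineK// (integrable_fin_num _ fi). Qed.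

Lemma intg_dominated (f_ : nat -> R -> R) f g :
  (forall n, measurable_fun D (f_ n)) -> integ g ->
  (forall n t, t \in `[0, tau] -> `|f_ n t| <= g t) ->
  (forall t, t \in `[0, tau] -> f_ n t @[n --> \oo] --> f t) ->
  integ f /\ intg (f_ n) @[n --> \oo] --> intg f.
Proof.
move=> mf gi fg f_f.
have mf' : measurable_fun D f by apply: (measurable_fun_cvg mf) => t tD; exact: f_f.
have [] := @dominated_convergence _ _ R mu D measurable_dom (fun n => EFin \o f_ n) (EFin \o f) (EFin \o g).
- by move=> n; exact/measurable_EFinP.
- exact/measurable_EFinP.
- by apply: aeW => t tD /=; apply: cvg_EFin; [exact: nearW|exact: f_f].
- exact: gi.
- by apply: aeW => t n tD /=; rewrite lee_fin; exact: fg.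
move=> fi _ lim; split=> //.
have E : (\int[mu]_(t in D) (EFin \o f) t)%E = (intg f)%:E.
  by rewrite /intg /Rintegral fineK// (integrable_fin_num _ fi).
by move: lim; rewrite E => /fine_cvg.
Qed.

Lemma continuous_within_integ f : {within D, continuous f} -> integ f.
Proof. by move=> fc; apply: continuous_compact_integrable => //; exact: segment_compact. Qed.

Lemma intg_fatou (f_ : nat -> R -> R) f (M : R) :
  (forall n, integ (f_ n)) -> (forall n t, t \in `[0, tau] -> 0 <= f_ n t) ->
  (forall t, t \in `[0, tau] -> f_ n t @[n --> \oo] --> f t) ->
  (exists N, forall n, (N <= n)%N -> intg (f_ n) <= M) -> integ f /\ intg f <= M.
Proof.
move=> fi f0 f_f [N fM].
have mf : measurable_fun D f.
  by apply: (measurable_fun_cvg (fun n => integ_measurable (fi n))) => t tD; exact: f_f.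
have fge0 t : t \in `[0, tau] -> 0 <= f t.
  by move=> tD; apply: (cvgr_to_ge (f_f t tD)); apply: nearW => n; exact: f0.
have le : (\int[mu]_(t in D) (f t)%:E <= M%:E)%E.
  have := @fatou _ _ R mu D measurable_dom (fun n => EFin \o f_ n)
    (fun n => measurable_int _ (fi n)) _.
  move=> /(_ ltac:(by move=> n t tD; rewrite /= lee_fin f0)).
  rewrite [X in (X <= _)%E -> _](_ : _ = \int[mu]_(t in D) (f t)%:E)%E; last first.
    apply: eq_integral => t; rewrite inE => tD; apply: (cvg_limn_einf_sup _).1.
    by apply: cvg_EFin; [exact: nearW|exact: f_f].
  move=> /le_trans; apply.
  rewrite limn_einf_lim; apply: lime_le; first exact: is_cvg_einfs.
  exists N => // n Nn; rewrite /einfs; apply: ge_ereal_inf.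
  exists (\int[mu]_(t in D) (f_ n t)%:E)%E; first by exists n => /=.
  by have := fM n Nn; rewrite -lee_fin /intg /Rintegral fineK// (integrable_fin_num _ (fi n)).
have ifi : integ f.
  apply/integrableP; split; first exact/measurable_EFinP.
  rewrite (_ : (\int[mu]_(t in D) _)%E = \int[mu]_(t in D) (f t)%:E)%E; last first.
    by apply: eq_integral => t; rewrite inE => tD /=; rewrite ger0_norm// fge0.
  by apply: le_lt_trans le _; rewrite ltry.
split=> //; rewrite -lee_fin /intg /Rintegral fineK// (integrable_fin_num _ ifi)//.
Qed.

End interval_integral.

(** * Strong measurability and square integrability *)

Import HBSimple.

Section simple_maps.
Context {R : realType}.
Local Notation mR := (measurableTypeR R).

Definition simple_map (T : Type) (s : R -> T) :=
  finite_set (range s) /\ forall x, measurable (s @^-1` [set x] : set mR).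

Lemma simple_map_preimage T (s : R -> T) (Y : set T) : simple_map s ->
  measurable (s @^-1` Y : set mR).
Proof.
move=> [fs ms].
have -> : s @^-1` Y = \bigcup_(x in range s `&` Y) (s @^-1` [set x]).
  apply/seteqP; split=> [t Yt|t [x [_ Yx] /= ->]] //=.
  by exists (s t) => //; split => //; exists t.
apply: fin_bigcup_measurable => [|x _]; last exact: ms.
by apply: sub_finite_set fs; exact: subIsetl.
Qed.

Lemma simple_map_cst T (x : T) : simple_map (fun=> x).
Proof.
split; first exact: finite_image_cst.
move=> y; have [->|xy] := pselect (x = y).
  rewrite (_ : _ @^-1` _ = setT); first exact: measurableT.
  by apply/seteqP; split.
rewrite (_ : _ @^-1` _ = set0); first exact: measurable0.
by apply/seteqP; split => // t /= /esym.
Qed.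

Lemma simple_map2 T U W (F : T -> U -> W) s r :
  simple_map s -> simple_map r -> simple_map (fun t => F (s t) (r t)).
Proof.
move=> ss sr; have [fs ms] := ss; have [fr mr] := sr; split.
  apply: sub_finite_set (finite_image2 F fs fr) => _ [t _ <-].
  by exists (s t); [exists t|exists (r t) => //; exists t].
move=> z.
have -> : (fun t => F (s t) (r t)) @^-1` [set z] =
    \bigcup_(x in range s) (s @^-1` [set x] `&` r @^-1` [set y | F x y = z]).
  apply/seteqP; split=> [t /= Fz|t [x _ [/= -> //]]].
  by exists (s t) => //; exists t.
apply: fin_bigcup_measurable => // x _; apply: measurableI; first exact: ms.
exact: simple_map_preimage.
Qed.

Lemma simple_map1 T W (F : T -> W) s : simple_map s -> simple_map (fun t => F (s t)).
Proof. by move=> ss; apply: (simple_map2 (fun x (_ : unit) => F x)) ss (simple_map_cst tt). Qed.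

Lemma simple_map_indic (A : set mR) : measurable A -> simple_map (fun t => t \in A).
Proof.
move=> mA; split.
  by apply: (@sub_finite_set _ _ setT) => //; exact: finite_finset.
case.
  rewrite (_ : _ @^-1` _ = A) //; apply/seteqP; split => t /=; first by move/set_mem.
  by move/mem_set.
rewrite (_ : _ @^-1` _ = ~` A); first exact: measurableC.
apply/seteqP; split => t /=; first by move=> + At; rewrite mem_set.
by move=> At; apply/negbTE/negP => /set_mem.
Qed.

Lemma simple_map_measurable (E : set mR) (h : R -> R) : simple_map h -> measurable_fun E h.
Proof.
move=> sh; apply: (@measurable_funS _ _ _ _ setT) => // _ Y mY; rewrite setTI.
exact: simple_map_preimage.
Qed.

Lemma simple_map_approx (E : set mR) (h : R -> R) : measurable E -> measurable_fun E h ->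
  exists2 s : nat -> R -> R, forall n, simple_map (s n) &
    forall t, E t -> s n t @[n --> \oo] --> h t.
Proof.
move=> mE mh; have [|g gh] := @approximation_sfun _ mR R (EFin \o h) E mE.
  exact/measurable_EFinP.
exists (fun n => (g n : mR -> R)) => [n|t Et]; last by have /fine_cvg := gh t Et.
split; first by have := @fimfunP _ _ (g n).
move=> x; have /(_ setT measurableT _ (measurable_set1 x)) := measurable_funP (g n).
by rewrite setTI.
Qed.

End simple_maps.

Section strong_measurability.
Context {R : realType} (tau : R).
Local Notation mR := (measurableTypeR R).
Local Notation D := ([set` `[0, tau]] : set mR).

Definition smeas (X : prehilbert R) (u : R -> X) :=
  exists2 s : nat -> R -> X, forall n, simple_map (s n) &
    forall t, t \in `[0, tau] -> vcvg (s ^~ t) (u t).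

Lemma smeas_simple (X : prehilbert R) (u : R -> X) : simple_map u -> smeas u.
Proof. by move=> su; exists (fun=> u) => // t _; exact: vcvg_cst. Qed.

Lemma smeas2 (X Y Z : prehilbert R) (F : X -> Y -> Z) u v :
  (forall x_ x y_ y, vcvg x_ x -> vcvg y_ y ->
     vcvg (fun n => F (x_ n) (y_ n)) (F x y)) ->
  smeas u -> smeas v -> smeas (fun t => F (u t) (v t)).
Proof.
move=> Fc [s ss su] [r sr rv]; exists (fun n t => F (s n t) (r n t)) => [n|t tD].
  exact: simple_map2.
exact: Fc (su t tD) (rv t tD).
Qed.

Lemma smeas1 (X Y : prehilbert R) (F : X -> Y) u :
  (forall x_ x, vcvg x_ x -> vcvg (fun n => F (x_ n)) (F x)) ->
  smeas u -> smeas (fun t => F (u t)).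
Proof.
move=> Fc [s ss su]; exists (fun n t => F (s n t)) => [n|t tD].
  exact: simple_map1.
exact: Fc (su t tD).
Qed.

Lemma smeasD (X : prehilbert R) (u v : R -> X) :
  smeas u -> smeas v -> smeas (fun t => u t + v t).
Proof. by apply: smeas2 => x_ x y_ y; exact: vcvgD. Qed.

Lemma smeas_scale (X : prehilbert R) (h : R -> R) (u : R -> X) :
  measurable_fun D h -> smeas u -> smeas (fun t => h t *: u t).
Proof.
move=> mh [s ss su]; have [r sr rh] := simple_map_approx (measurable_dom tau) mh.
exists (fun n t => r n t *: s n t) => [n|t tD]; first exact: simple_map2.
have rt := rh t tD; have st := su t tD.
apply: (@vcvg_le _ _ _ _ (fun n => `|r n t| * vnorm (s n t - u t) +
    `|r n t - h t| * vnorm (u t))).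
  rewrite [X in _ --> X](_ : 0 = `|h t| * 0 + 0 * vnorm (u t)); last by rewrite mulr0 mul0r addr0.
  apply: cvgD; apply: cvgM; [exact: cvg_norm|exact: st| |exact: cvg_cst].
  by rewrite -(normr0 R) -(subrr (h t)); apply: cvg_norm; apply: cvgB => //; exact: cvg_cst.
move=> n; rewrite -!vnormZ (_ : r n t *: s n t - h t *: u t =
  r n t *: (s n t - u t) + (r n t - h t) *: u t).
exact: vnormD.
by rewrite scalerBr scalerBl addrA subrK.
Qed.

Lemma measurable_dot (X : prehilbert R) (u v : R -> X) : smeas u -> smeas v ->
  measurable_fun D (fun t => dot (u t) (v t)).
Proof.
move=> [s ss su] [r sr rv].
apply: (@measurable_fun_cvg _ _ _ _ (fun n t => dot (s n t) (r n t))).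
  by move=> n; apply: simple_map_measurable; exact: simple_map2.
by move=> t tD; apply: cvg_dot; [exact: su|exact: rv].
Qed.

Lemma measurable_vnorm (X : prehilbert R) (u : R -> X) : smeas u ->
  measurable_fun D (fun t => vnorm (u t)).
Proof.
move=> [s ss su].
apply: (@measurable_fun_cvg _ _ _ _ (fun n t => vnorm (s n t))).
  by move=> n; apply: simple_map_measurable; exact: simple_map1.
by move=> t tD; apply: cvg_vnorm; exact: su.
Qed.

Lemma simple_maps_enum (T : Type) (s : nat -> R -> T) : (forall n, simple_map (s n)) ->
  exists w : nat -> T, forall n t, exists k, w k = s n t.
Proof.
move=> ss.
have cS : countable (\bigcup_n range (s n)).
  by apply: bigcup_countable => // n _; apply: finite_set_countable; exact: (ss n).1.
have [S0|[w]] := pfcard_geP cS.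
  have : (\bigcup_n range (s n)) (s 0%N 0) by exists 0%N => //; exists 0.
  by rewrite S0.
exists w => n t; have [k _ <-] : (w @` setT) (s n t).
  by apply: (@surj _ _ _ _ w); exists n => //; exists t.
by exists k.
Qed.

Lemma smeas_countable (X : prehilbert R) (u : R -> X) : smeas u ->
  exists w : nat -> X, forall t, t \in `[0, tau] ->
    (forall n, dot (u t) (w n) = 0) -> vnorm (u t) = 0.
Proof.
move=> [s ss su]; have [w ws] := simple_maps_enum ss.
exists w => t tD h; apply/eqP; rewrite -sqrf_eq0 sqr_vnorm; apply/eqP.
have := cvg_dot (vcvg_cst (u t)) (su t tD).
under eq_fun => n do (have [k <-] := ws n t; rewrite h).
by move=> /(cvg_unique (@Rhausdorff R) (cvg_cst _)).
Qed.

End strong_measurability.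

Section square_integrable_functions.
Context {R : realType} (tau : R) (X : prehilbert R).
Local Notation mR := (measurableTypeR R).
Local Notation D := ([set` `[0, tau]] : set mR).

Definition sqi (u : R -> X) := smeas tau u /\ integ tau (fun t => dot (u t) (u t)).

Lemma integ_dot (u v : R -> X) : sqi u -> sqi v -> integ tau (fun t => dot (u t) (v t)).
Proof.
move=> [mu iu] [mv iv].
apply: (@le_integ _ _ _ (fun t => dot (u t) (u t) + dot (v t) (v t))).
- exact: measurable_dot.
- move=> t _; apply: (le_trans (dot_norm_le _ _)); rewrite -!sqr_vnorm.
  have := sqr_ge0 (vnorm (u t) - vnorm (v t)).
  by have := sqr_ge0 (vnorm (u t) + vnorm (v t)); rewrite !expr2; nra.
- exact: integD.
Qed.

Lemma sqi_dom (u : R -> X) (g : R -> R) : smeas tau u -> integ tau g ->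
  (forall t, t \in `[0, tau] -> dot (u t) (u t) <= g t) -> sqi u.
Proof.
move=> mu ig ug; split=> //; apply: le_integ ig; first exact: measurable_dot.
by move=> t tD; rewrite ger0_norm ?dot_ge0// ug.
Qed.

Lemma sqiD (u v : R -> X) : sqi u -> sqi v -> sqi (fun t => u t + v t).
Proof.
move=> su sv; split; first exact: smeasD su.1 sv.1.
have := integD (integD su.2 (integ_dot su sv)) (integD (integ_dot sv su) sv.2).
by apply: eq_integ => t _; rewrite !dotE.
Qed.

Lemma sqi_scale (h : R -> R) (u : R -> X) (M : R) : measurable_fun D h ->
  (forall t, t \in `[0, tau] -> `|h t| <= M) -> sqi u -> sqi (fun t => h t *: u t).
Proof.
move=> mh hM su; apply: (@sqi_dom _ (fun t => M ^+ 2 * dot (u t) (u t))).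
- exact: smeas_scale su.1.
- exact: integZ su.2.
move=> t tD; rewrite !dotE mulrA -expr2 ler_wpM2r ?dot_ge0//.
by rewrite -[h t ^+ 2]real_normK ?num_real// ler_sqr ?nnegrE// ?hM// (le_trans _ (hM t tD)).
Qed.

Lemma sqiZ c (u : R -> X) : sqi u -> sqi (fun t => c *: u t).
Proof. by apply: (@sqi_scale (fun=> c) u `|c|). Qed.

Lemma sqi0 : sqi (fun=> 0).
Proof.
split; first by apply: smeas_simple; exact: simple_map_cst.
by under eq_fun do rewrite dot0l; exact: integ_cst.
Qed.

Lemma sqi_cst x : sqi (fun=> x).
Proof.
split; first by apply: smeas_simple; exact: simple_map_cst.
exact: integ_cst.
Qed.

Lemma sqi_eq (u v : R -> X) : (forall t, t \in `[0, tau] -> u t = v t) -> sqi u -> sqi v.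
Proof.
move=> uv [[s ss su] iu]; split; first by exists s => // t tD; rewrite -uv//; exact: su.
by apply: eq_integ iu => t tD; rewrite uv.
Qed.

Definition L2_pred : {pred R -> X} := mem [set u | sqi u].

Record L2 := MkL2 { L2fun :> R -> X; L2funP : L2fun \in L2_pred }.

HB.instance Definition _ := [isSub for L2fun].
HB.instance Definition _ := [Choice of L2 by <:].

Lemma L2_submod_closed : submod_closed L2_pred.
Proof.
split; first by rewrite inE; exact: sqi0.
by move=> c u v; rewrite !inE => su sv; apply: sqiD => //; exact: sqiZ.
Qed.

HB.instance Definition _ :=
  GRing.isSubmodClosed.Build _ _ L2_pred L2_submod_closed.
HB.instance Definition _ := [SubChoice_isSubLmodule of L2 by <:].

Lemma L2P (u : L2) : sqi u. Proof. by have := L2funP u; rewrite inE. Qed.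

Lemma L2_mk (u : R -> X) : sqi u -> {v : L2 | v = u :> (R -> X)}.
Proof. by move=> su; have /mem_set su' := su; exists (MkL2 su'). Qed.

Lemma L2DE (u v : L2) t : (u + v) t = u t + v t. Proof. by []. Qed.
Lemma L2ZE c (u : L2) t : (c *: u) t = c *: u t. Proof. by []. Qed.
Lemma L2BE (u v : L2) t : (u - v) t = u t - v t. Proof. by []. Qed.

Definition L2dot (u v : L2) := intg tau (fun t => dot (u t) (v t)).

Lemma L2dotC u v : L2dot u v = L2dot v u.
Proof. by apply: eq_intg => t _; rewrite dotC. Qed.

Lemma L2dotPl a u v w : L2dot (a *: u + v) w = a * L2dot u w + L2dot v w.
Proof.
rewrite -intgZ ?integ_dot//; try exact: L2P.
rewrite -intgD; [|by apply: integZ; apply: integ_dot; exact: L2P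
                 |by apply: integ_dot; exact: L2P].
by apply: eq_intg => t _; rewrite dotPl.
Qed.

Lemma L2dot_ge0 u : 0 <= L2dot u u.
Proof. by apply: intg_ge0 => t _; exact: dot_ge0. Qed.

Definition L2pre := PreHilbert L2dotC L2dotPl L2dot_ge0.

Lemma L2dotE (u v : L2pre) : dot u v = intg tau (fun t => dot (u t) (v t)).
Proof. by []. Qed.

Lemma L2norm_eq0 (u : L2pre) : vnorm u = 0 -> ae_on tau (fun t => vnorm (u t) = 0).
Proof.
move=> u0; have : dot u u = 0 by rewrite -sqr_vnorm u0 expr0n.
rewrite L2dotE => /intg_eq0 h.
apply: ae_onS (h (L2P u).2 (fun t _ => dot_ge0 _)) => t _ ut.
by apply/eqP; rewrite -sqrf_eq0 sqr_vnorm ut.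
Qed.

Lemma L2_simple_dense (v : L2pre) (e : R) : 0 < e ->
  exists2 s : L2pre, simple_map s & vnorm (v - s) <= e.
Proof.
move=> e0; have [[s ss sv] iv] := L2P v.
have mv : measurable_fun D (fun t => vnorm (v t)) by apply: measurable_vnorm; exact: (L2P v).1.
pose A n := D `&` [set t | vnorm (s n t) <= 2 * vnorm (v t)].
have mA n : measurable (A n : set mR).
  rewrite /A (_ : D `&` _ = D `&` (fun t => vnorm (s n t) <= 2 * vnorm (v t)) @^-1` [set true]) //.
  have h : measurable_fun D (fun t => vnorm (s n t) <= 2 * vnorm (v t)).
    apply: measurable_fun_ler; last exact: measurable_funM.
    by apply: simple_map_measurable; exact: simple_map1.
  by apply: h => //; exact: measurable_dom.
pose s' n t := if t \in A n then s n t else 0.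
have ss' n : simple_map (s' n).
  by apply: (simple_map2 (fun (b : bool) (x : X) => if b then x else 0)) => //; exact: simple_map_indic.
have ms' n : smeas tau (s' n) by exact: smeas_simple.
have s'v n t : t \in `[0, tau] -> dot (v t - s' n t) (v t - s' n t) <= 9 * dot (v t) (v t).
  move=> tD; rewrite -!sqr_vnorm /s'.
  case: ifP => [/set_mem[_ /= h]|_]; last by rewrite subr0; have := sqr_ge0 (vnorm (v t)); lra.
  have := vnormD (v t) (- s n t); rewrite vnormN => h2.
  rewrite [leRHS](_ : _ = (3 * vnorm (v t)) ^+ 2); last by rewrite exprMn; lra.
  by rewrite ler_sqr ?nnegrE ?mulr_ge0 ?vnorm_ge0//; lra.
have s's n t : t \in `[0, tau] -> vnorm (v t - s' n t) <= vnorm (s n t - v t).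
  move=> tD; rewrite /s'; case: ifP => [_|/negP h]; first by rewrite vnormBC.
  have := ler_vnormB (s n t) (v t); rewrite subr0.
  have : 2 * vnorm (v t) < vnorm (s n t).
    by rewrite ltNge; apply/negP => h'; apply: h; rewrite mem_set.
  have := ler_norm (vnorm (s n t) - vnorm (v t)); lra.
have sq' n : sqi (s' n).
  apply: (@sqi_dom _ (fun t => 4 * dot (v t) (v t))) => //; first exact: integZ.
  move=> t tD; rewrite -!sqr_vnorm /s'.
  case: ifP => [/set_mem[_ /= h]|_]; last by rewrite vnorm0 expr0n mulr_ge0// sqr_ge0.
  rewrite [leRHS](_ : _ = (2 * vnorm (v t)) ^+ 2); last by rewrite exprMn; lra.
  by rewrite ler_sqr ?nnegrE ?mulr_ge0 ?vnorm_ge0.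
have [//|//|||_ lim] := @intg_dominated R tau (fun n t => dot (v t - s' n t) (v t - s' n t))
    (fun=> 0) (fun t => 9 * dot (v t) (v t)).
- move=> n; apply: measurable_dot; apply: smeasD (L2P v).1 _;
    by apply: (@smeas1 _ _ _ _ (fun x => - x)) => // ? ?; exact: vcvgN.
- exact: integZ.
- by move=> n t tD; rewrite ger0_norm ?dot_ge0// s'v.
- move=> t tD.
  have : vnorm (s n t - v t) ^+ 2 @[n --> \oo] --> (0 : R).
    by rewrite -(mul0r (0 : R)); apply: cvgM; exact: sv.
  apply: squeeze_cvgr (cvg_cst _); apply: nearW => n; rewrite dot_ge0 -sqr_vnorm /=.
  by rewrite ler_sqr ?nnegrE ?vnorm_ge0// s's.
move: lim; rewrite intg0 => /cvgrPdist_le/(_ (e ^+ 2) ltac:(by rewrite exprn_gt0))[N _ /(_ N (leqnn N))].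
have [w wE] := L2_mk (sq' N).
rewrite /= sub0r normrN => h; exists w; first by rewrite wE.
rewrite -ler_sqr ?nnegrE ?vnorm_ge0 ?(ltW e0)// sqr_vnorm L2dotE.
apply: le_trans h; apply: le_trans (ler_norm _).
by rewrite (_ : intg tau _ = intg tau (fun t => dot (v t - s' N t) (v t - s' N t)))//
  -wE.
Qed.

End square_integrable_functions.

Section norm_function.
Context {R : realType} (tau : R).

Definition real_dot (x y : R^o) : R := x * y.

Lemma real_dotC x y : real_dot x y = real_dot y x. Proof. exact: mulrC. Qed.

Lemma real_dotPl a x y z : real_dot (a *: x + y) z = a * real_dot x z + real_dot y z.
Proof. by rewrite /real_dot mulrDl mulrA. Qed.

Lemma real_dot_ge0 x : 0 <= real_dot x x. Proof. by rewrite /real_dot -expr2 sqr_ge0. Qed.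

Definition real_pre := PreHilbert real_dotC real_dotPl real_dot_ge0.

Lemma sqi_vnorm (X : prehilbert R) (u : R -> X) : sqi tau u ->
  sqi tau (fun t => vnorm (u t) : real_pre).
Proof.
move=> [mu iu]; apply: sqi_dom iu _ => [|t _]; last first.
  by rewrite -[leLHS]/(vnorm (u t) * vnorm (u t)) -expr2 sqr_vnorm.
apply: (smeas1 (F := fun x => vnorm x : real_pre)) mu => x_ x xx.
apply: (vcvg_le xx) => n; set a := vnorm (x_ n); set c := vnorm x.
have -> : vnorm ((a : real_pre) - c) = `|a - c|.
  by rewrite -[LHS]/(Num.sqrt ((a - c) * (a - c))) -expr2 sqrtr_sqr.
exact: ler_vnormB.
Qed.

Lemma intg_vnormM (X : prehilbert R) (u v : L2pre tau X) :
  integ tau (fun t => vnorm (u t) * vnorm (v t)) /\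
  intg tau (fun t => vnorm (u t) * vnorm (v t)) <= vnorm u * vnorm v.
Proof.
have [f fE] := L2_mk (sqi_vnorm (L2P u)); have [g gE] := L2_mk (sqi_vnorm (L2P v)).
have := integ_dot (L2P f) (L2P g); rewrite fE gE => h; split=> //.
have E (w : L2pre tau X) (k : L2pre tau real_pre) :
    (k = (fun t => vnorm (w t)) :> (R -> R^o)) -> vnorm k = vnorm w.
  move=> kE; congr Num.sqrt; apply: eq_intg => t _.
  by rewrite -[in RHS]sqr_vnorm kE -[LHS]/(vnorm (w t) * vnorm (w t)) -expr2.
by have := dot_le (f : L2pre tau real_pre) g; rewrite (E u)// (E v)// L2dotE fE gE.
Qed.

End norm_function.

Section L2_complete.
Context {R : realType} (tau : R) (X : hilbert R).
Local Notation mR := (measurableTypeR R).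
Local Notation D := ([set` `[0, tau]] : set mR).
Local Notation L2 := (L2pre tau X).

Let geo n : R := (2 ^ n.+1)%:R^-1.

Let geo_gt0 n : 0 < geo n.
Proof. by rewrite invr_gt0 ltr0n expn_gt0. Qed.

Let geo_le n m : (n <= m)%N -> geo m <= geo n.
Proof.
move=> nm; rewrite lef_pV2 ?posrE ?ltr0n ?expn_gt0// ler_nat leq_exp2l//.
Qed.

Let geo_cvg : geo n @[n --> \oo] --> (0 : R).
Proof.
apply: (@squeeze_cvgr _ _ _ _ (fun=> 0) (fun n => n.+1%:R^-1)); last 2 first.
- exact: cvg_cst.
- exact: cvg_harmonic.
apply: nearW => n; rewrite ltW ?geo_gt0//= lef_pV2 ?posrE ?ltr0n ?expn_gt0//.
by rewrite ler_nat ltnW// ltn_expl.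
Qed.

(* u is the a.e. limit of r: the series of vnorm (r n.+1 t - r n t) converges a.e. *)
Let simple_limit (r : nat -> L2) : (forall n, simple_map (r n)) ->
  (forall n m, vnorm (r n - r m) <= 2 * (geo n + geo m)) ->
  exists u : L2, forall n, vnorm (u - r n) <= 4 * geo n.
Proof.
move=> sr rr.
pose e n t := vnorm (r n.+1 t - r n t).
have sqe n : sqi tau (fun t => r n.+1 t - r n t) by exact: (L2P (r n.+1 - r n)).
have ie n : integ tau (e n).
  apply: (@le_integ _ _ _ (fun t => 1 + dot (r n.+1 t - r n t) (r n.+1 t - r n t))).
  - by apply: measurable_vnorm; exact: (sqe n).1.
  - move=> t _; rewrite ger0_norm ?vnorm_ge0// -sqr_vnorm -/(e n t).
    by have := sqr_ge0 (e n t - 1); have := sqr_ge0 (e n t); rewrite !expr2; nra.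
  - by apply: integD; [exact: integ_cst|exact: (sqe n).2].
pose C := (intg tau (fun=> 1) + 16) / 2.
have C0 : 0 <= C by rewrite divr_ge0// addr_ge0// intg_ge0.
have Ie n : intg tau (e n) <= C * geo n.
  have le1 : intg tau (e n) <= intg tau (fun t => 2^-1 * geo n * 1 +
      (2 * geo n)^-1 * dot (r n.+1 t - r n t) (r n.+1 t - r n t)).
    apply: le_intg => //.
      by apply: integD; apply: integZ; [exact: integ_cst|exact: (sqe n).2].
    move=> t _; rewrite -sqr_vnorm -/(e n t) mulr1.
    have g0 := geo_gt0 n.
    rewrite -subr_ge0 (_ : _ - _ = (e n t - geo n) ^+ 2 * (2 * geo n)^-1).
      by rewrite mulr_ge0 ?sqr_ge0// invr_ge0 mulr_ge0// ltW.
    by field; rewrite gt_eqF.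
  apply: (le_trans le1); rewrite intgD; last 2 first.
  - by apply: integZ; exact: integ_cst.
  - by apply: integZ; exact: (sqe n).2.
  rewrite !intgZ; [|exact: (sqe n).2|exact: integ_cst].
  have : dot (r n.+1 - r n) (r n.+1 - r n) <= (4 * geo n) ^+ 2.
    rewrite -sqr_vnorm ler_sqr ?nnegrE ?vnorm_ge0//; last by have := geo_gt0 n; lra.
    by apply: (le_trans (rr _ _)); have := geo_le (leqnSn n); lra.
  rewrite L2dotE => h.
  have h2 : (2 * geo n)^-1 * intg tau (fun t => dot (r n.+1 t - r n t) (r n.+1 t - r n t))
     <= (2 * geo n)^-1 * (4 * geo n) ^+ 2.
    by rewrite ler_wpM2l// invr_ge0 mulr_ge0// ltW// geo_gt0.
  apply: (le_trans (lerD (lexx _) h2)).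
  rewrite /C le_eqVlt; apply/orP; left; apply/eqP; field; exact/lt0r_neq0/geo_gt0.
pose S t := (\sum_(0 <= n <oo) (e n t)%:E)%E.
have mS : measurable_fun D S.
  apply: (@ge0_emeasurable_sum _ _ _ _ (fun n t => (e n t)%:E) xpredT) => [n t _ _|n _].
    by rewrite lee_fin vnorm_ge0.
  by apply/measurable_EFinP; exact: integ_measurable (ie n).
have iS : (\int[lebesgue_measure]_(t in D) `|S t| < +oo)%E.
  rewrite (_ : (\int[_]_(t in D) _)%E = \int[lebesgue_measure]_(t in D) S t)%E; last first.
    apply: eq_integral => t _; rewrite gee0_abs//; apply: nneseries_ge0 => n _ _.
    by rewrite lee_fin vnorm_ge0.
  rewrite (integral_nneseries _ (measurable_dom tau)); last 2 first.
  - by move=> n; apply/measurable_EFinP; exact: integ_measurable (ie n).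
  - by move=> n t _; rewrite lee_fin vnorm_ge0.
  apply: (@le_lt_trans _ _ (\sum_(0 <= n <oo) (C / (2 ^ n.+1)%:R)%:E)%E).
    apply: lee_nneseries => [n _ _|n _].
      by apply: integral_ge0 => t _; rewrite lee_fin vnorm_ge0.
    by rewrite -EFin_intg// lee_fin Ie.
  by apply: le_lt_trans (epsilon_trick0 xpredT C0) _; rewrite ltry.
have intS : lebesgue_measure.-integrable D S by apply/integrableP.
pose G := D `&` [set t | S t \is a fin_num].
have mG : measurable (G : set mR).
  exact: (emeasurable_fin_num (measurable_dom tau) mS).
pose r' n t := if t \in G then r n t else 0.
have sr' n : simple_map (r' n).
  by apply: (simple_map2 (fun (b : bool) (x : X) => if b then x else 0)) => //; exact: simple_map_indic.
have lim t : exists x, vcvg (r' ^~ t) x.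
  apply: hcomplete => d d0.
  have [/set_mem[tD /= tS]|tG] := boolP (t \in G); last first.
    by exists 0%N => n m _ _; rewrite /r' (negbTE tG) subrr vnorm0 ltW.
  have /(_ xpredT) := @nneseries_tail_cvg R (fun n => (e n t)%:E).
  move=> /(_ ltac:(by rewrite -ge0_fin_numE// nneseries_ge0// => n _ _; rewrite lee_fin vnorm_ge0)).
  move=> /(_ ltac:(by move=> n _; rewrite lee_fin vnorm_ge0)).
  move=> /fine_cvgP[[N1 _ fin]] /cvgrPdist_le/(_ (d / 2) ltac:(lra))[N2 _ tail].
  pose N := maxn N1 N2.
  have leN n : (N <= n)%N -> vnorm (r n t - r N t) <= d / 2.
    move=> Nn; have := tail N (leq_maxr _ _); rewrite /= sub0r normrN.
    move=> /(le_trans (ler_norm _)); apply: le_trans.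
    rewrite -lee_fin fineK; last by apply: fin; exact: leq_maxl.
    apply: (@le_trans _ _ (\sum_(N <= k < n) (e k t)%:E)%E); last first.
      by apply: nneseries_lim_ge => k _ _; rewrite lee_fin vnorm_ge0.
    rewrite sumEFin lee_fin -(subnKC Nn).
    elim: (n - N)%N => [|k ih]; first by rewrite addn0 subrr vnorm0 big_geq.
    rewrite addnS big_nat_recr ?leq_addr//=.
    apply: (le_trans (vnorm_distD (r (N + k)%N t) _ _)).
    by rewrite addrC lerD.
  exists N => n m Nn Nm; rewrite /r' mem_set//.
  apply: (le_trans (vnorm_distD (r N t) _ _)); rewrite (vnormBC (r N t)).
  by have := leN n Nn; have := leN m Nm; lra.
have [u ru] := choice lim.
have mu : smeas tau u by exists r'.
have r'r n : ae_on tau (fun t => r' n t = r n t).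
  have := integrable_ae (measurable_dom tau) intS.
  apply: (@filterS _ (almost_everywhere lebesgue_measure) (ae_filter_ringOfSetsType _)).
  by move=> t h tD; rewrite /r' mem_set//; split => //; exact: h.
have sq' n : sqi tau (r' n).
  split; first exact: smeas_simple.
  apply: (@le_integ _ _ _ (fun t => dot (r n t) (r n t))).
  - by apply: measurable_dot; exact: smeas_simple.
  - move=> t _; rewrite /r'; case: ifP => _; first by rewrite ger0_norm ?dot_ge0.
    by rewrite dot0l normr0 dot_ge0.
  - exact: (L2P (r n)).2.
have fat n : integ tau (fun t => dot (u t - r' n t) (u t - r' n t)) /\
   intg tau (fun t => dot (u t - r' n t) (u t - r' n t)) <= (4 * geo n) ^+ 2.
  have sqB m : sqi tau (fun t => r' m t - r' n t).
    apply: (@sqi_eq _ _ _ (fun t => r' m t + (-1) *: r' n t)).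
      by move=> t _; rewrite scaleN1r.
    by apply: sqiD => //; exact: sqiZ.
  apply: (@intg_fatou _ _ (fun m t => dot (r' m t - r' n t) (r' m t - r' n t))).
  - by move=> m; exact: (sqB m).2.
  - by move=> m t _; exact: dot_ge0.
  - by move=> t _; apply: cvg_dot; apply: vcvgB; [exact: ru|exact: vcvg_cst|exact: ru|exact: vcvg_cst].
  - exists n => m nm; rewrite (_ : intg _ _ = dot (r m - r n) (r m - r n)).
      rewrite -sqr_vnorm ler_sqr ?nnegrE ?vnorm_ge0//; last by have := geo_gt0 n; lra.
      by apply: (le_trans (rr _ _)); have := geo_le nm; lra.
    apply: intg_ae; first exact: integ_measurable (sqB m).2.
      exact: integ_measurable (L2P (r m - r n)).2.
    by apply: ae_onS2 (r'r m) (r'r n) => t _ -> ->.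
have sqB n : sqi tau (fun t => u t - r' n t).
  split; last exact: (fat n).1.
  by apply: smeasD => //; apply: (@smeas1 _ _ _ _ (fun x => - x)); [move=> ? ?; exact: vcvgN|exact: smeas_simple].
have squ : sqi tau u.
  apply: (@sqi_eq _ _ _ (fun t => (u t - r' 0%N t) + r' 0%N t)); first by move=> t _; rewrite subrK.
  exact: sqiD.
have [w wE] := L2_mk squ; exists w => n.
rewrite -ler_sqr ?nnegrE ?vnorm_ge0//; last by have := geo_gt0 n; lra.
rewrite sqr_vnorm L2dotE; apply: le_trans (fat n).2; rewrite le_eqVlt; apply/orP; left; apply/eqP.
apply: intg_ae; [exact: integ_measurable (L2P (w - r n)).2|exact: integ_measurable (sqB n).2|].
by apply: ae_onS (r'r n) => t _ ->; rewrite -wE.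
Qed.

Lemma L2_complete (u : nat -> L2) :
  (forall e : R, 0 < e -> exists N, forall n m, (N <= n)%N -> (N <= m)%N ->
      vnorm (u n - u m) <= e) -> exists x, vcvg u x.
Proof.
move=> cu.
have [k ku] := choice (fun n => cu (geo n) (geo_gt0 n)).
have [r] := choice (fun n => let: ex_intro2 s ss h := L2_simple_dense (u (k n)) (geo_gt0 n) in
   ex_intro (fun s : L2 => simple_map s /\ vnorm (u (k n) - s) <= geo n) s (conj ss h)).
move=> /all_and2[sr ur].
have [|w wr] := @simple_limit r sr.
  move=> n m; have h1 := ku n (k n) (maxn (k n) (k m)) (leqnn _) (leq_maxl _ _).
  have h2 := ku m (maxn (k n) (k m)) (k m) (leq_maxr _ _) (leqnn _).
  apply: (le_trans (vnorm_distD (u (k n)) _ _)); rewrite (vnormBC (r n)).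
  have := vnorm_distD (u (k m)) (u (k n)) (r m).
  have := vnorm_distD (u (maxn (k n) (k m))) (u (k n)) (u (k m)).
  have := ur n; have := ur m; move: h1 h2.
  set a := vnorm (u (k n) - r n); set b := vnorm (u (k m) - r m).
  set c := vnorm (u (k n) - r m); set f := vnorm (u (k n) - u (k m)).
  set g := vnorm (u (k n) - u _); set h := vnorm (u _ - u (k m)).
  move: (geo n) (geo m) a b c f g h => {}n {}m {}a b c f g h; lra.
exists w; apply/vcvgP => d d0.
move/cvgrPdist_le : geo_cvg => /(_ (d / 6) ltac:(lra))[N _ /(_ N (leqnn N))].
rewrite /= sub0r normrN ger0_norm ?(ltW (geo_gt0 _))// => hN.
exists (k N) => n Nn; have h1 := ku N n (k N) Nn (leqnn _).
apply: (le_trans (vnorm_distD (u (k N)) _ _)).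
have := vnorm_distD (r N) (u (k N)) w; rewrite (vnormBC (r N) w).
have := ur N; have := wr N; move: h1 hN.
set a := vnorm (u n - _); set b := vnorm (w - r N); set c := vnorm (u (k N) - r N).
set f := vnorm (u (k N) - w).
move: (geo N) a b c f => g a b c f; lra.
Qed.

Definition L2hilbert := Hilbert L2_complete.

End L2_complete.

(** * Test functions and C^1 functions *)

Lemma is_derive_quadratic (R : realType) (f : R -> R) (x l M : R) :
  (forall h, `|f (h + x) - f x - l * h| <= M * h ^+ 2) -> is_derive x (1 : R) f l.
Proof.
move=> fM.
have lim : h^-1 *: (f (h *: 1 + x) - f x) @[h --> 0^'] --> l.
  apply/cvgrPdist_le => e e0; near=> h.
  have h0 : h != 0 by near: h; exact: nbhs_dnbhs_neq.
  have he : `|h| <= e / (`|M| + 1) by near: h; apply: dnbhs0_le; rewrite divr_gt0// ltr_wpDl.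
  rewrite distrC -(ler_pM2r (_ : 0 < `|h|)) ?normr_gt0// -normrM [_ *: 1]mulr1.
  rewrite mulrBl [_ *: _]mulrC mulfVK//; apply: (le_trans (fM h)).
  rewrite -real_normK ?num_real// expr2 mulrA ler_wpM2r//.
  move: he; rewrite ler_pdivlMr ?ltr_wpDl//; apply: le_trans.
  by rewrite mulrC ler_wpM2l// (le_trans (ler_norm _))// lerDl.
by split; [apply/cvg_ex; exists l|exact: cvg_lim].
Unshelve. all: by end_near. Qed.

Section bump.
Context {R : realType}.

Definition ramp2 (x : R) : R := Num.max x 0 ^+ 2.

Lemma is_derive_ramp2 (x : R) : is_derive x (1 : R) ramp2 (2 * Num.max x 0).
Proof.
apply: (@is_derive_quadratic _ _ _ _ 1) => h; rewrite /ramp2 mul1r !expr2.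
rewrite ler_norml; case: (leP x 0) => x0; case: (leP (h + x) 0) => hx0; apply/andP; split; nra.
Qed.

Lemma continuous_max0 : continuous (fun x : R => Num.max x 0).
Proof. by move=> x; apply: continuous_max; [exact: cvg_id|exact: cvg_cst]. Qed.

Definition sstep (x : R) : R := 1 - ramp2 (1 - ramp2 x).

Definition dsstep (x : R) : R := 2 * Num.max (1 - ramp2 x) 0 * (2 * Num.max x 0).

Lemma is_derive_sstep (x : R) : is_derive x (1 : R) sstep (dsstep x).
Proof.
have h1 : is_derive x (1 : R) (fun y => 1 - ramp2 y) (0 - 2 * Num.max x 0).
  by apply: is_deriveB; exact: is_derive_ramp2.
have h2 := @is_derive1_comp _ ramp2 (fun y => 1 - ramp2 y) x _ _ (is_derive_ramp2 _) h1.
have h3 : is_derive x (1 : R) sstep (0 - (2 * Num.max (1 - ramp2 x) 0) * (0 - 2 * Num.max x 0)).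
  by apply: is_deriveB; exact: h2.
by apply: is_derive_eq h3 _; rewrite /dsstep !sub0r mulrN opprK.
Qed.

Lemma continuous_ramp2 : continuous ramp2.
Proof.
by move=> x; apply: differentiable_continuous; apply/derivable1_diffP; have [] := is_derive_ramp2 x.
Qed.

Lemma continuous_dsstep : continuous dsstep.
Proof.
move=> x; apply: cvgM.
  apply: cvgM; first exact: cvg_cst.
  apply: (continuous_comp (f := fun y => 1 - ramp2 y) (g := fun y => Num.max y 0)).
    by apply: cvgB; [exact: cvg_cst|exact: continuous_ramp2].
  exact: continuous_max0.
by apply: cvgM; [exact: cvg_cst|exact: continuous_max0].
Qed.

Lemma sstep0 x : x <= 0 -> sstep x = 0.
Proof. by move=> x0; rewrite /sstep /ramp2 (max_r x0) expr0n subr0 (max_l ler01) expr1n subrr. Qed.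

Lemma sstep1 x : 1 <= x -> sstep x = 1.
Proof.
move=> x1; rewrite /sstep /ramp2 (max_l (le_trans ler01 x1)) max_r ?expr0n ?subr0//.
by rewrite subr_le0 expr_ge1// (le_trans ler01).
Qed.

Lemma sstep_bound x : 0 <= sstep x <= 1.
Proof.
rewrite /sstep /ramp2; have h0 : 0 <= Num.max x 0 ^+ 2 by exact: sqr_ge0.
set y := _ ^+ 2 in h0 *; case: (leP (1 - y) 0) => y1; first by rewrite expr0n subr0 ler01 lexx.
by rewrite subr_ge0 gerBl sqr_ge0 andbT expr_le1//; lra.
Qed.

End bump.

Section test_functions.
Context {R : realType} (tau : R).
Local Notation mR := (measurableTypeR R).
Local Notation mu := (@lebesgue_measure R).
Local Notation D := ([set` `[0, tau]] : set mR).

Definition bump (n : nat) (x t : R) : R :=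
  sstep (n.+1%:R * t - 1) * sstep (n.+1%:R * (x - t)).

Lemma is_derive_affine (a b t : R) : is_derive t (1 : R) (fun t => a * t + b) a.
Proof.
by apply: (@is_derive_quadratic _ _ _ _ 0) => h; rewrite mul0r (_ : _ - _ = 0) ?normr0//; lra.
Qed.

Lemma test_function_bump n x : x < tau -> test_function tau (bump n x).
Proof.
move=> xt; set k : R := n.+1%:R; have k0 : 0 < k by rewrite ltr0n.
pose db t := sstep (k * t - 1) * (dsstep (- k * t + k * x) * - k) +
   sstep (- k * t + k * x) * (dsstep (k * t - 1) * k).
have bE : bump n x = (sstep \o (fun t => k * t - 1)) * (sstep \o (fun t => - k * t + k * x)).
  by apply/funext => t; rewrite /bump fctE /=; congr (_ * sstep _); rewrite -/k; lra.
have d t : is_derive t (1 : R) (bump n x) (db t).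
  rewrite bE; apply: is_deriveM; apply: is_derive1_comp;
    by [exact: is_derive_sstep|exact: is_derive_affine].
have caff a b : continuous (fun t : R => a * t + b).
  by move=> t; apply: cvgD; [apply: cvgM; [exact: cvg_cst|exact: cvg_id]|exact: cvg_cst].
have cs : continuous (@sstep R).
  by move=> y; apply: differentiable_continuous; apply/derivable1_diffP; have [] := is_derive_sstep y.
split.
- by move=> t; have [] := d t.
- have -> : derive1 (bump n x) = db.
    by apply/funext => t; rewrite derive1E; have [_ <-] := d t.
  move=> t; apply: cvgD; apply: cvgM.
  + by apply: (@continuous_comp _ _ _ (fun t => k * t - 1) (@sstep R)); [exact: caff|exact: cs].
  + apply: cvgM; last exact: cvg_cst.
    apply: (@continuous_comp _ _ _ (fun t => - k * t + k * x) (@dsstep R)); first exact: caff.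
    exact: continuous_dsstep.
  + by apply: (@continuous_comp _ _ _ (fun t => - k * t + k * x) (@sstep R)); [exact: caff|exact: cs].
  + apply: cvgM; last exact: cvg_cst.
    apply: (@continuous_comp _ _ _ (fun t => k * t - 1) (@dsstep R)); first exact: caff.
    exact: continuous_dsstep.
- exists k^-1, x; split => //; first by rewrite invr_gt0.
  move=> t; rewrite in_itv/= negb_and -!ltNge /bump -/k => /orP[tk|tx].
    by rewrite sstep0 ?mul0r// subr_le0 -ler_pdivlMl// mulr1 ltW.
  by rewrite [X in _ * X]sstep0 ?mulr0// pmulr_rle0// subr_le0 ltW.
Qed.

Lemma bump_cvg (x t : R) : 0 <= t -> bump n x t @[n --> \oo] --> ((0 < t < x)%R%:R : R).
Proof.
move=> t0; rewrite /bump; have [t_gt0|t_le0] /= := ltrP 0 t; last first.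
  have -> : t = 0 by apply/le_anti/andP.
  apply: cvg_near_cst; apply: nearW => n.
  by rewrite mulr0 sstep0 ?mul0r// sub0r oppr_le0.
have [tx|xt] := ltrP t x; last first.
  apply: cvg_near_cst; apply: nearW => n.
  by rewrite [X in _ * X]sstep0 ?mulr0// pmulr_rle0// subr_le0.
have big (c d : R) : 0 < c -> \forall n \near \oo, d <= n.+1%:R * c.
  move=> c0; exists (Num.bound `|d / c|) => // n nb.
  rewrite -ler_pdivrMr//; apply: (le_trans (ler_norm _)).
  by apply: (le_trans (ltW (archi_boundP (normr_ge0 _)))); rewrite ler_nat (leq_trans nb)// leqnSn.
apply: cvg_near_cst; near=> n.
rewrite !sstep1 ?mul1r//.
- by near: n; apply: big; rewrite subr_gt0.
- by rewrite lerBrDr; near: n; exact: big.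
Unshelve. all: by end_near. Qed.

Lemma bump_bound n x t : `|bump n x t| <= 1.
Proof.
have /andP[a0 a1] := sstep_bound (n.+1%:R * t - 1).
have /andP[b0 b1] := sstep_bound (n.+1%:R * (x - t)).
by rewrite /bump ger0_norm ?mulr_ge0// mulr_ile1.
Qed.

Lemma test_function_continuous phi : test_function tau phi -> continuous phi.
Proof.
by move=> [dphi _ _] t; apply: differentiable_continuous; apply/derivable1_diffP.
Qed.

Lemma continuous_measurable_dom (f : R -> R) : continuous f -> measurable_fun D f.
Proof.
by move=> cf; apply: measurable_funS (continuous_measurable_fun cf) => //.
Qed.

Lemma test_function_orth (rho : R -> R) : integ tau rho ->
  (forall phi, test_function tau phi -> intg tau (fun t => phi t * rho t) = 0) ->
  ae_on tau (fun t => rho t = 0).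
Proof.
move=> irho orth.
have zero x : x < tau -> intg tau (fun t => (0 < t < x)%R%:R * rho t) = 0.
  move=> xt; have tf n := test_function_bump n xt.
  have [||n t tD|t tD|_ lim] := @intg_dominated _ tau (fun n t => bump n x t * rho t)
    (fun t => (0 < t < x)%R%:R * rho t) (fun t => `|rho t|).
  - move=> n; apply: measurable_funM; last exact: integ_measurable.
    by apply: continuous_measurable_dom; exact: test_function_continuous (tf n).
  - exact: integ_norm irho.
  - by rewrite normrM ler_piMl// bump_bound.
  - apply: cvgM; last exact: cvg_cst.
    by apply: bump_cvg; move: tD; rewrite in_itv/= => /andP[].
  move: lim; under eq_fun do rewrite orth//.
  by move=> /(cvg_unique (@Rhausdorff R) (cvg_cst _)).
pose f := (rho : R -> R) \_ `]0, tau[.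
have fi : mu.-integrable setT (EFin \o f).
  rewrite /f -restrict_EFin; apply/integrable_restrict => //; rewrite setTI.
  apply: integrableS irho => //.
  exact: subset_itv_oo_cc.
have fiy y : mu.-integrable `]-oo, y] (EFin \o f) by apply: integrableS fi.
have lf : locally_integrable [set: R] f.
  apply: integrable_locally => //; apply: integrableS irho => //.
  exact: subset_itv_oo_cc.
have F0 x : x < tau -> \int[mu]_(t in `]-oo, x]) f t = 0.
  move=> xt; rewrite -Rintegral_itv_bndo_bndc; last by apply: integrableS fi.
  rewrite -[RHS](zero x xt) /intg [LHS]Rintegral_mkcond [RHS]Rintegral_mkcond.
  apply: eq_Rintegral => t _; rewrite /f !patchE.
  have [/set_mem/= tx|/negP tx] := boolP (t \in (`]-oo, x[ : set R)%classic).
    rewrite in_itv/= in tx; rewrite tx andbT.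
    have [t_gt0|t_le0] := ltrP 0 t.
      have tt := lt_trans tx xt.
      by rewrite mul1r (mem_set (A := `]0, tau[%classic))/= ?mem_set//= ?in_itv/= ?t_gt0 ?tx ?tt// !ltW.
    rewrite mul0r if_same memNset//= in_itv/= => /andP[].
    by rewrite ltNge t_le0.
  have -> : (t < x) = false by apply/negP => h; apply: tx; rewrite mem_set//= in_itv.
  by rewrite andbF mul0r if_same.
have ae_neq (c : R) : {ae mu, forall t, t <> c}.
  exists [set c]; split; [exact: measurable_set1|exact: lebesgue_measure_set1|].
  by move=> t /= /contrapT.
apply: (@filterS3 _ (almost_everywhere mu) (ae_filter_ringOfSetsType _) _ _ _ _ _
  (FTC1Ny fiy lf) (ae_neq 0) (ae_neq tau)) => t [_ dF] t0 tt tD.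
have tD' : t \in `]0, tau[.
  move: tD; rewrite !in_itv/= !lt_neqAle => /andP[-> ->]; rewrite !andbT eq_sym.
  by apply/andP; split; apply/eqP.
have : f t = 0.
  rewrite -dF derive1E (@near_eq_derive _ _ _ _ (cst 0)) ?derive_cst//.
  near=> s; apply: F0; near: s; apply: lt_nbhsl.
  by move: tD'; rewrite in_itv/= => /andP[].
by rewrite /f patchE mem_set.
Unshelve. all: by end_near. Qed.

End test_functions.

Section C1_functions.
Context {R : realType} (tau : R).
Local Notation mR := (measurableTypeR R).
Local Notation mu := (@lebesgue_measure R).
Local Notation D := ([set` `[0, tau]] : set mR).

Definition C1 (f df : R -> R) := exists2 e : R, 0 < e &
  forall t, t \in `]- e, tau + e[ -> is_derive t (1 : R) f (df t) /\ {for t, continuous df}.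

Lemma is_derive_continuous (f : R -> R) (t df : R) : is_derive t (1 : R) f df ->
  {for t, continuous f}.
Proof. by move=> [d _]; apply: differentiable_continuous; apply/derivable1_diffP. Qed.

Lemma C1_cst c : C1 (fun=> c) (fun=> 0).
Proof.
by exists 1 => // t _; split; [exact: is_derive_cst|exact: cst_continuous].
Qed.

Lemma C1_2 (f df g dg : R -> R) (P : R -> Prop) : C1 f df -> C1 g dg ->
  (forall t, is_derive t (1 : R) f (df t) -> {for t, continuous df} ->
    is_derive t (1 : R) g (dg t) -> {for t, continuous dg} -> P t) ->
  exists2 e : R, 0 < e & forall t, t \in `]- e, tau + e[ -> P t.
Proof.
move=> [e e0 he] [d d0 hd] h; exists (Num.min e d); first by rewrite lt_min e0 d0.
move=> t; rewrite in_itv/= => /andP[t1 t2].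
have [|fd cf] := he t.
  rewrite in_itv/= (lt_le_trans t2) ?lerD ?ge_min ?lexx// andbT.
  by rewrite (le_lt_trans _ t1)// lerN2 ge_min lexx.
have [|gd cg] := hd t.
  rewrite in_itv/= (lt_le_trans t2) ?lerD ?ge_min ?lexx ?orbT// andbT.
  by rewrite (le_lt_trans _ t1)// lerN2 ge_min lexx orbT.
exact: h.
Qed.

Lemma C1D f df g dg : C1 f df -> C1 g dg ->
  C1 (fun t => f t + g t) (fun t => df t + dg t).
Proof.
move=> cf cg; apply: (C1_2 cf cg) => t fd cdf gd cdg; split; first exact: is_deriveD.
exact: cvgD.
Qed.

Lemma C1M f df g dg : C1 f df -> C1 g dg ->
  C1 (fun t => f t * g t) (fun t => df t * g t + f t * dg t).
Proof.
move=> cf cg; apply: (C1_2 cf cg) => t fd cdf gd cdg; split.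
  apply: is_derive_eq (is_deriveM fd gd) _.
  by rewrite [LHS]addrC; congr (_ + _); rewrite mulrC.
have cf0 := is_derive_continuous fd; have cg0 := is_derive_continuous gd.
by apply: cvgD; apply: cvgM; [exact: cdf|exact: cg0|exact: cf0|exact: cdg].
Qed.

Lemma C1_eq f df g dg : (forall t, f t = g t) -> (forall t, df t = dg t) -> C1 f df -> C1 g dg.
Proof. by move=> /funext <- /funext <-. Qed.

Lemma C1Z c f df : C1 f df -> C1 (fun t => c * f t) (fun t => c * df t).
Proof.
by move=> cf; apply: C1_eq (C1M (C1_cst c) cf) => // t; rewrite mul0r add0r.
Qed.

Lemma C1_affine a b : C1 (fun t => a * t + b) (fun=> a).
Proof.
by exists 1 => // t _; split; [exact: is_derive_affine|exact: cst_continuous].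
Qed.

Lemma C1_exp a : C1 (fun t => expR (a * t)) (fun t => a * expR (a * t)).
Proof.
exists 1 => // t _.
have ca : {for t, continuous (fun t => a * t)}.
  by apply: cvgM; [exact: cvg_cst|exact: cvg_id].
split; last first.
  apply: cvgM; first exact: cvg_cst.
  by apply: (@continuous_comp _ _ _ (fun t => a * t) expR) => //; exact: continuous_expR.
have d : is_derive t (1 : R) (fun t => a * t) a.
  by apply: (@is_derive_quadratic _ _ _ _ 0) => h; rewrite mul0r (_ : _ - _ = 0) ?normr0//; lra.
apply: is_derive_eq (@is_derive1_comp _ expR (fun t => a * t) t _ _ (is_derive_expR _) d) _.
exact: mulrC.
Qed.

Lemma C1_test phi : test_function tau phi -> C1 phi (derive1 phi).
Proof.
move=> [dphi cphi _]; exists 1 => // t _; split; last exact: cphi.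
by rewrite derive1E; split.
Qed.

Lemma test_functionM phi l dl : test_function tau phi -> C1 l dl ->
  test_function tau (fun t => phi t * l t) /\
  forall t, derive1 (fun t => phi t * l t) t = derive1 phi t * l t + phi t * dl t.
Proof.
move=> tphi cl; have [e e0 he] := C1M (C1_test tphi) cl.
have [dphi cphi [a [b [a0 bt phi0]]]] := tphi.
have out t : t \notin `]- e, tau + e[ -> \forall s \near t, phi s = 0.
  rewrite in_itv/= negb_and -!leNgt => /orP[te|te].
    near=> s; apply: phi0; rewrite in_itv/= negb_and -ltNge; apply/orP; left.
    by near: s; apply: lt_nbhsl; rewrite (le_lt_trans te)// (lt_trans _ a0)// oppr_lt0.
  near=> s; apply: phi0; rewrite in_itv/= negb_and -!ltNge; apply/orP; right.
  near: s; apply: lt_nbhsr; rewrite (lt_le_trans bt)// (le_trans _ te)// lerDl ltW//.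
have out' t : t \notin `]- e, tau + e[ -> \forall s \near t, phi s = 0 /\ derive1 phi s = 0.
  move=> /out/nbhs_interior; apply: filterS => s hs; split; first exact: nbhs_singleton hs.
  rewrite derive1E (@near_eq_derive _ _ _ _ (cst 0)) ?derive_cst//.
have d t : is_derive t (1 : R) (fun t => phi t * l t) (derive1 phi t * l t + phi t * dl t).
  have [/he[]//|/out' h] := boolP (t \in `]- e, tau + e[).
  have [-> ->] := nbhs_singleton h; rewrite !mul0r addr0.
  apply: near_eq_is_derive (is_derive_cst (0 : R) t 1).
  by apply: filterS h => s [-> _]; rewrite mul0r.
have dE : derive1 (fun t => phi t * l t) = fun t => derive1 phi t * l t + phi t * dl t.
  by apply/funext => t; rewrite derive1E; have [_ ->] := d t.
split; last by move=> t; rewrite dE.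
split.
- by move=> t; have [] := d t.
- rewrite dE => t; have [/he[]//|/out' h] := boolP (t \in `]- e, tau + e[).
  have [c0 dc0] := nbhs_singleton h; rewrite /continuous_at c0 dc0 !mul0r addr0.
  apply: cvg_near_cst.
  by apply: filterS h => s [-> ->]; rewrite !mul0r addr0.
- by exists a, b; split=> // t /phi0 ->; rewrite mul0r.
Unshelve. all: by end_near. Qed.

Lemma C1_dom f df t : C1 f df -> t \in `[0, tau] ->
  is_derive t (1 : R) f (df t) /\ {for t, continuous df}.
Proof.
move=> [e e0 h]; rewrite in_itv/= => /andP[t0 tt]; apply: h.
by rewrite in_itv/=; apply/andP; split; lra.
Qed.

Lemma C1_within f df : C1 f df -> {within D, continuous f}.
Proof.
move=> cf; apply: continuous_in_subspaceT => t; rewrite inE => tD.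
by have [/is_derive_continuous] := C1_dom cf tD.
Qed.

Lemma C1_within' f df : C1 f df -> {within D, continuous df}.
Proof.
move=> cf; apply: continuous_in_subspaceT => t; rewrite inE => tD.
by have [] := C1_dom cf tD.
Qed.

Lemma within_continuous_bounded (f : R -> R) : {within D, continuous f} ->
  exists M, forall t, t \in `[0, tau] -> `|f t| <= M.
Proof.
move=> cf; have cD : compact (f @` D).
  by apply: continuous_compact => //; exact: segment_compact.
have [M [_ hM]] := compact_bounded cD.
by exists (M + 1) => t tD; apply: (hM (M + 1)); [rewrite ltrDl|exists t].
Qed.

Lemma within_continuous_measurable (f : R -> R) : {within D, continuous f} -> measurable_fun D f.
Proof. by apply: subspace_continuous_measurable_fun; exact: measurable_dom. Qed.

Lemma C1_FTC f df s : C1 f df -> s \in `[0, tau] -> intg s df = f s - f 0.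
Proof.
move=> cf sD; have := sD; rewrite in_itv/= => /andP[+ st]; rewrite le_eqVlt.
case/predU1P => [<-|s0].
  by rewrite subrr /intg set_itv1 Rintegral_set1.
have sub t : t \in `[0, s] -> t \in `[0, tau].
  by rewrite !in_itv/= => /andP[-> /le_trans]; apply.
rewrite /intg /Rintegral (@continuous_FTC2 _ df f 0 s)// ?fineB//.
- apply: continuous_in_subspaceT => t; rewrite inE => /sub tD.
  by have [] := C1_dom cf tD.
- split.
  + by move=> t /subset_itv_oo_cc/sub tD; have [[d _] _] := C1_dom cf tD.
  + apply: cvg_at_right_filter; apply: is_derive_continuous (C1_dom cf _).1.
    by rewrite in_itv/= lexx (le_trans _ st)// ltW.
  + by apply: cvg_at_left_filter; apply: is_derive_continuous (C1_dom cf _).1.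
- by move=> t /subset_itv_oo_cc/sub tD; have [[_ d] _] := C1_dom cf tD; rewrite derive1E.
Qed.

Lemma C1_primitive (k dk : R -> R) (c : R) : C1 k dk -> c \in `[0, tau] ->
  exists2 P, C1 P k & P c = 0.
Proof.
move=> [e e0 ck] cD.
have sub t : t \in `[- (e / 2), tau + e / 2] -> t \in `]- e, tau + e[.
  by rewrite !in_itv/= => /andP[t1 t2]; apply/andP; split; lra.
have ik : mu.-integrable `[- (e / 2), tau + e / 2] (EFin \o k).
  apply: continuous_compact_integrable; first exact: segment_compact.
  apply: continuous_in_subspaceT => t; rewrite inE => /sub/ck[d _].
  exact: is_derive_continuous d.
pose P0 t := \int[mu]_(s in `[- (e / 2), t]) k s.
exists (fun t => P0 t - P0 c); last exact: subrr.
exists (e / 2); first lra.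
move=> t; rewrite in_itv/= => /andP[t1 t2].
have tsub : t \in `]- e, tau + e[ by apply: sub; rewrite in_itv/= !ltW.
have [d _] := ck t tsub.
have ckt := is_derive_continuous d; split=> //.
have [dP P'] := continuous_FTC1_closed t2 ik t1 ckt.
have dP0 : is_derive t (1 : R) P0 (k t).
  by apply: (@DeriveDef _ _ _ t 1 P0 (k t)) dP _; rewrite -derive1E; exact: P'.
apply: (is_derive_eq (is_deriveB dP0 (is_derive_cst (P0 c) t 1))).
by rewrite subr0.
Qed.

(* the solution is phi(t) = e^(-t/h) int_c^t e^(s/h) psi(s) / h ds *)
Lemma C1_relaxation (h c : R) (psi dpsi : R -> R) : h != 0 -> c \in `[0, tau] ->
  C1 psi dpsi -> exists2 phi, C1 phi (fun t => (psi t - phi t) / h) & phi c = 0.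
Proof.
move=> h0 cD cpsi.
have [P cP Pc] := C1_primitive (C1Z h^-1 (C1M (C1_exp h^-1) cpsi)) cD.
exists (fun t => expR (- h^-1 * t) * P t); last by rewrite Pc mulr0.
apply: C1_eq (C1M (C1_exp (- h^-1)) cP) => // t.
have E : expR (- h^-1 * t) * expR (h^-1 * t) = 1.
  by rewrite -expRD mulNr addNr expR0.
transitivity ((expR (- h^-1 * t) * expR (h^-1 * t) * psi t - expR (- h^-1 * t) * P t) / h).
  by field.
by rewrite E mul1r.
Qed.

End C1_functions.

(** * Density of elementary tensors *)

Section tensors.
Context {R : realType} (tau : R) (V : prehilbert R).
Local Notation mR := (measurableTypeR R).
Local Notation D := ([set` `[0, tau]] : set mR).
Implicit Types (g dg k dk : R -> V).

Inductive tensor : (R -> V) -> (R -> V) -> Prop :=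
| tensor0 : tensor (fun=> 0) (fun=> 0)
| tensor_cons l dl m g dg : C1 tau l dl -> tensor g dg ->
    tensor (fun t => l t *: m + g t) (fun t => dl t *: m + dg t).

Lemma tensor_eq g dg k dk : (forall t, g t = k t) -> (forall t, dg t = dk t) ->
  tensor g dg -> tensor k dk.
Proof. by move=> /funext <- /funext <-. Qed.

Lemma tensor1 l dl m : C1 tau l dl -> tensor (fun t => l t *: m) (fun t => dl t *: m).
Proof. by move=> cl; apply: tensor_eq (tensor_cons m cl tensor0) => t; rewrite addr0. Qed.

Lemma tensorD g dg k dk : tensor g dg -> tensor k dk ->
  tensor (fun t => g t + k t) (fun t => dg t + dk t).
Proof.
move=> ng nk; elim: ng => [|l dl m g0 dg0 cl _ ih].
  by apply: tensor_eq nk => t; rewrite add0r.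
by apply: tensor_eq (tensor_cons m cl ih) => t; rewrite addrA.
Qed.

Lemma tensorM th dth g dg : C1 tau th dth -> tensor g dg ->
  tensor (fun t => th t *: g t) (fun t => dth t *: g t + th t *: dg t).
Proof.
move=> cth; elim => [|l dl m g0 dg0 cl _ ih].
  by apply: tensor_eq tensor0 => t; rewrite !scaler0 ?addr0.
apply: tensor_eq (tensor_cons m (C1M cth cl) ih) => t; first by rewrite scalerDr scalerA.
by rewrite scalerDl !scalerDr !scalerA addrACA.
Qed.

Lemma tensorZ c g dg : tensor g dg -> tensor (fun t => c *: g t) (fun t => c *: dg t).
Proof.
by move=> /(tensorM (C1_cst tau c)); apply: tensor_eq => // t; rewrite scale0r add0r.
Qed.

Lemma tensor_linear (f : V -> R) g dg :
  (forall a x y, f (a *: x + y) = a * f x + f y) -> tensor g dg ->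
  C1 tau (fun t => f (g t)) (fun t => f (dg t)).
Proof.
move=> fL; have f0 : f 0 = 0 by have := fL 1 0 0; rewrite scaler0 addr0; lra.
elim => [|l dl m g0 dg0 cl _ ih]; first by rewrite f0; exact: C1_cst.
apply: C1_eq (C1D (C1Z (f m) cl) ih) => t; by rewrite fL mulrC.
Qed.

Lemma tensor_bilinear (f : V -> V -> R) g dg k dk :
  (forall a x y z, f (a *: x + y) z = a * f x z + f y z) ->
  (forall a x y z, f z (a *: x + y) = a * f z x + f z y) ->
  tensor g dg -> tensor k dk ->
  C1 tau (fun t => f (g t) (k t)) (fun t => f (dg t) (k t) + f (g t) (dk t)).
Proof.
move=> fl fr ng nk.
have f0 z : f 0 z = 0 by have := fl 1 0 0 z; rewrite scaler0 addr0; lra.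
elim: ng => [|l dl m g0 dg0 cl _ ih].
  by apply: C1_eq (C1_cst tau 0) => t; rewrite !f0 ?addr0.
have := C1D (C1M cl (tensor_linear (fun a x y => fr a x y m) nk)) ih.
by apply: C1_eq => t; rewrite !fl//; lra.
Qed.

Lemma tensor_sqi g dg : tensor g dg -> sqi tau g /\ sqi tau dg.
Proof.
elim => [|l dl m g0 dg0 cl _ [ih dih]]; first by split; exact: sqi0.
have [M hM] := within_continuous_bounded (C1_within cl).
have [M' hM'] := within_continuous_bounded (C1_within' cl).
split; apply: sqiD => //.
  apply: sqi_scale hM (sqi_cst _ _); exact: within_continuous_measurable (C1_within cl).
by apply: sqi_scale hM' (sqi_cst _ _); exact: within_continuous_measurable (C1_within' cl).
Qed.

Lemma tensor_relaxation (h c : R) p dp : h != 0 -> c \in `[0, tau] -> tensor p dp ->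
  exists2 g, tensor g (fun t => h^-1 *: (p t - g t)) & g c = 0.
Proof.
move=> h0 cD; elim => [|l dl m p0 dp0 cl _ [g0 ng0 g0c]].
  by exists (fun=> 0) => //; apply: tensor_eq tensor0 => // t; rewrite subrr scaler0.
have [phi cphi phic] := C1_relaxation h0 cD cl.
exists (fun t => phi t *: m + g0 t); last by rewrite phic scale0r g0c addr0.
apply: tensor_eq (tensor_cons m cphi ng0) => // t.
by rewrite opprD addrACA -scalerBl [RHS]scalerDr scalerA [h^-1 * _]mulrC.
Qed.

Definition tensor_pred : {pred (R -> V) * (R -> V)} := mem [set p | tensor p.1 p.2].

Record tensorT := MkTensor { tensor_val :> (R -> V) * (R -> V); tensor_valP : tensor_val \in tensor_pred }.

HB.instance Definition _ := [isSub for tensor_val].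
HB.instance Definition _ := [Choice of tensorT by <:].

Lemma tensor_submod_closed : submod_closed tensor_pred.
Proof.
split; first by rewrite inE; exact: tensor0.
move=> c p q; rewrite !inE => np nq.
exact: tensorD (tensorZ c np) nq.
Qed.

HB.instance Definition _ :=
  GRing.isSubmodClosed.Build _ _ tensor_pred tensor_submod_closed.
HB.instance Definition _ := [SubChoice_isSubLmodule of tensorT by <:].

Lemma tensorP (y : tensorT) : tensor y.1 y.2. Proof. by have := tensor_valP y; rewrite inE. Qed.

Lemma tensor_mk g dg : tensor g dg -> exists y : tensorT, (y : (R -> V) * (R -> V)) = (g, dg).
Proof. by move=> ng; have /mem_set h : [set p | tensor p.1 p.2] (g, dg) by []; exists (MkTensor h). Qed.

Definition tfun (y : tensorT) : L2pre tau V := MkL2 (mem_set (tensor_sqi (tensorP y)).1).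

Definition tdfun (y : tensorT) : L2pre tau V := MkL2 (mem_set (tensor_sqi (tensorP y)).2).

Lemma tfunP a (y z : tensorT) : tfun (a *: y + z) = a *: tfun y + tfun z.
Proof. exact: val_inj. Qed.

Lemma tdfunP a (y z : tensorT) : tdfun (a *: y + z) = a *: tdfun y + tdfun z.
Proof. exact: val_inj. Qed.

End tensors.

Section hilbert_product.
Context {R : realType} (X Y : hilbert R).

Definition prod_dot (p q : X * Y) : R := dot p.1 q.1 + dot p.2 q.2.

Lemma prod_dotC p q : prod_dot p q = prod_dot q p.
Proof. by rewrite /prod_dot !(dotC p.1) !(dotC p.2). Qed.

Lemma prod_dotPl a p q r : prod_dot (a *: p + q) r = a * prod_dot p r + prod_dot q r.
Proof. by rewrite /prod_dot /= !dotPl; lra. Qed.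

Lemma prod_dot_ge0 p : 0 <= prod_dot p p.
Proof. by rewrite addr_ge0 ?dot_ge0. Qed.

Definition prod_pre := @PreHilbert R (X * Y)%type _ prod_dotC prod_dotPl prod_dot_ge0.

Lemma vnorm_fst (p : prod_pre) : vnorm p.1 <= vnorm p.
Proof. by rewrite ler_wsqrtr// lerDl dot_ge0. Qed.

Lemma vnorm_snd (p : prod_pre) : vnorm p.2 <= vnorm p.
Proof. by rewrite ler_wsqrtr// lerDr dot_ge0. Qed.

Lemma vnorm_pair (p : prod_pre) : vnorm p <= vnorm p.1 + vnorm p.2.
Proof.
rewrite -ler_sqr ?nnegrE ?addr_ge0 ?vnorm_ge0// sqr_vnorm sqrrD !sqr_vnorm.
rewrite -[leLHS]/(dot p.1 p.1 + dot p.2 p.2) addrAC lerDl mulrn_wge0// mulr_ge0//; exact: vnorm_ge0.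
Qed.

Lemma prod_complete (u : nat -> prod_pre) :
  (forall e : R, 0 < e -> exists N, forall n m, (N <= n)%N -> (N <= m)%N ->
      vnorm (u n - u m) <= e) -> exists x, vcvg u x.
Proof.
move=> cu.
have [x ux] : exists x, vcvg (fun n => (u n).1) x.
  apply: hcomplete => e /cu[N h]; exists N => n m Nn Nm.
  exact: le_trans (vnorm_fst (u n - u m)) (h n m Nn Nm).
have [y uy] : exists y, vcvg (fun n => (u n).2) y.
  apply: hcomplete => e /cu[N h]; exists N => n m Nn Nm.
  exact: le_trans (vnorm_snd (u n - u m)) (h n m Nn Nm).
exists (x, y).
apply: (@vcvg_le _ prod_pre _ _ (fun n => vnorm ((u n).1 - x) + vnorm ((u n).2 - y))).
  by rewrite -[X in _ --> X]addr0; exact: cvgD ux uy.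
by move=> n; exact: vnorm_pair.
Qed.

Definition prod_hilbert := Hilbert prod_complete.

End hilbert_product.

Lemma riesz_operator (R : realType) (X : hilbert R) (T : Type) (f : T -> X -> R) :
  (forall y a x x', f y (a *: x + x') = a * f y x + f y x') ->
  (forall y, exists C, forall x, f y x <= C * vnorm x) ->
  exists A : T -> X, forall y x, dot (A y) x = f y x.
Proof.
move=> fL fC; have h y : exists u, forall x, dot u x = f y x.
  by have [C yC] := fC y; exact: riesz (fL y) yC.
by have [A AE] := choice h; exists A.
Qed.

Section density.
Context {R : realType} (tau : R) (V : hilbert R).
Local Notation mR := (measurableTypeR R).
Local Notation D := ([set` `[0, tau]] : set mR).
Local Notation L2 := (L2hilbert tau V).

Lemma L2_weak_null (p : L2) : (forall w, ae_on tau (fun t => dot (p t) w = 0)) ->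
  vnorm p = 0.
Proof.
move=> h; have [w hw] := smeas_countable (L2P p).1.
have p0 : ae_on tau (fun t => vnorm (p t) = 0).
  by apply: ae_onS (ae_on_foralln (fun n => h (w n))) => t tD; exact: hw.
apply/eqP; rewrite -sqrf_eq0 sqr_vnorm L2dotE -(intg0 tau); apply/eqP.
apply: intg_ae => //; first exact: integ_measurable (L2P p).2.
by apply: ae_onS p0 => t _ pt; rewrite -sqr_vnorm pt expr0n.
Qed.

Lemma ae_interior : ae_on tau (fun t => 0 < t < tau).
Proof.
have ae_neq (c : R) : {ae @lebesgue_measure R, forall t, t \in `[0, tau] -> t <> c}.
  exists [set c]; split; [exact: measurable_set1|exact: lebesgue_measure_set1|].
  by move=> t /= /not_implyP[_ /contrapT].
apply: ae_onS2 (ae_neq 0) (ae_neq tau) => t; rewrite in_itv/= !lt_neqAle => /andP[-> ->].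
by move=> /eqP t0 /eqP tt; rewrite eq_sym t0 tt.
Qed.

Lemma tensor_dense (p : L2) (e : R) : 0 < e -> exists y : tensorT tau V,
  [/\ y.1 0 = 0, y.1 tau = 0 & vnorm (p - tfun y) <= e].
Proof.
move=> e0; pose th (t : R) := t * (tau - t).
have [dth cth] : exists dth, C1 tau th dth.
  exists (fun t => 1 * (- 1 * t + tau) + (1 * t + 0) * - 1).
  by apply: C1_eq (C1M (C1_affine tau 1 0) (C1_affine tau (-1) tau)) => // t; rewrite /th; lra.
pose K (y : tensorT tau V) : L2 := MkL2 (mem_set (tensor_sqi (tensorM cth (tensorP y))).1).
have KL a (y z : tensorT tau V) x : dot (K (a *: y + z)) x = a * dot (K y) x + dot (K z) x.
  rewrite -dotPl; congr dot; apply: val_inj; apply/funext => t /=.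
  change (th t *: (a *: y.1 t + z.1 t) = a *: (th t *: y.1 t) + th t *: z.1 t).
  by rewrite scalerDr !scalerA [a * _]mulrC.
have [q orth|g gp] := dense_range KL _ p.
  apply: L2_weak_null => w.
  have sw : sqi tau (fun t => th t *: w).
    by have [] := tensor_sqi (tensor1 w cth).
  have iqw : integ tau (fun t => th t * dot (q t) w).
    by apply: eq_integ (integ_dot (L2P q) sw) => t _; rewrite dotZr.
  have h : ae_on tau (fun t => th t * dot (q t) w = 0).
    apply: test_function_orth => // phi tphi.
    have [y yE] := tensor_mk (tensor1 w (C1_test tphi)).
    have := orth y; rewrite L2dotE => <-; apply: eq_intg => t _ /=.
    by rewrite yE/= !dotZr mulrCA.
  apply: ae_onS2 h ae_interior => t _ /eqP + /andP[t0 tt].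
  by rewrite mulf_eq0 /th mulf_eq0 (gt_eqF t0) subr_eq0 (gt_eqF tt)/= => /eqP.
have /vcvgP/(_ e e0)[N /(_ N (leqnn N)) h] := gp.
have [y yE] := tensor_mk (tensorM cth (tensorP (g N))).
exists y; rewrite yE /= /th subrr mulr0 mul0r !scale0r; split=> //.
rewrite vnormBC; apply: le_trans h; rewrite le_eqVlt; apply/orP; left; apply/eqP.
by congr vnorm; congr (_ - _); apply: val_inj; rewrite /= yE.
Qed.

End density.

(** * Lions' theorem for coercive operators *)

Section gelfand.
Context {R : realType} (tau : R) (V H : hilbert R) (j : V -> H) (cj : R).
Hypothesis tau0 : 0 < tau.
Hypothesis jP : forall a x y, j (a *: x + y) = a *: j x + j y.
Hypothesis j_bounded : forall v, vnorm (j v) <= cj * vnorm v.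
Local Notation mR := (measurableTypeR R).
Local Notation D := ([set` `[0, tau]] : set mR).
Local Notation L2V := (L2hilbert tau V).
Local Notation L2H := (L2hilbert tau H).
Local Notation tensorV := (tensorT tau V).

Lemma emb0 : j 0 = 0.
Proof. by have := jP (-1) 0 0; rewrite scaler0 addr0 scaleN1r addNr. Qed.

Lemma embZ a x : j (a *: x) = a *: j x.
Proof. by rewrite -[a *: x]addr0 jP emb0 addr0. Qed.

Lemma embD x y : j (x + y) = j x + j y.
Proof. by rewrite -[x]scale1r jP !scale1r. Qed.

Lemma embB x y : j (x - y) = j x - j y.
Proof. by rewrite embD -scaleN1r embZ scaleN1r. Qed.

Lemma vcvg_emb (u : nat -> V) v : vcvg u v -> vcvg (fun n => j (u n)) (j v).
Proof.
move=> uv; apply: (@vcvg_le _ _ _ _ (fun n => cj * vnorm (u n - v))).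
  by rewrite -[X in _ --> X](mulr0 cj); apply: cvgM => //; exact: cvg_cst.
by move=> n; rewrite -embB.
Qed.

Lemma sqi_emb (u : R -> V) : sqi tau u -> sqi tau (fun t => j (u t)).
Proof.
move=> su; apply: (@sqi_dom _ _ _ _ (fun t => cj ^+ 2 * dot (u t) (u t))).
- by apply: smeas1 su.1 => x_ x; exact: vcvg_emb.
- exact: integZ su.2.
move=> t _; rewrite -!sqr_vnorm -exprMn ler_sqr ?nnegrE ?vnorm_ge0//.
exact: le_trans (vnorm_ge0 _) (j_bounded _).
Qed.

Definition J (u : L2V) : L2H := MkL2 (mem_set (sqi_emb (L2P u))).

Lemma JP a u v : J (a *: u + v) = a *: J u + J v.
Proof. by apply: val_inj; apply/funext => t; exact: jP. Qed.

Lemma JZ a x : J (a *: x) = a *: J x.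
Proof. by apply: val_inj; apply/funext => t; exact: embZ. Qed.

Lemma JD x y : J (x + y) = J x + J y.
Proof. by apply: val_inj; apply/funext => t; exact: embD. Qed.

Lemma JB x y : J (x - y) = J x - J y.
Proof. by apply: val_inj; apply/funext => t; exact: embB. Qed.

Lemma J_bounded u : vnorm (J u) <= `|cj| * vnorm u.
Proof.
rewrite -ler_sqr ?nnegrE ?mulr_ge0 ?vnorm_ge0// exprMn !sqr_vnorm !L2dotE.
rewrite real_normK ?num_real// -intgZ; last exact: (L2P u).2.
apply: le_intg; [exact: (L2P (J u)).2|by apply: integZ; exact: (L2P u).2|].
move=> t _; rewrite -[J u t]/(j (u t)) -!sqr_vnorm -exprMn.
rewrite ler_sqr ?nnegrE ?vnorm_ge0//; exact: le_trans (vnorm_ge0 _) (j_bounded _).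
Qed.

Lemma tensor_energy (f : V -> V -> R) (y : tensorV) (s : R) :
  (forall a x y z, f (a *: x + y) z = a * f x z + f y z) ->
  (forall x y, f x y = f y x) -> s \in `[0, tau] ->
  intg s (fun t => f (y.2 t) (y.1 t)) = (f (y.1 s) (y.1 s) - f (y.1 0) (y.1 0)) / 2.
Proof.
move=> fl fC sD; have fr a x y' z : f z (a *: x + y') = a * f z x + f z y'.
  by rewrite fC fl !(fC z).
have c := tensor_bilinear fl fr (tensorP y) (tensorP y).
rewrite -(C1_FTC c sD).
have cs : {within [set` `[0, s]], continuous (fun t => f (y.2 t) (y.1 t) + f (y.1 t) (y.2 t))}.
  apply: continuous_in_subspaceT => t; rewrite inE /= => ts.
  have [|_ //] := C1_dom c (_ : t \in `[0, tau]).
  move: ts sD; rewrite !in_itv/= => /andP[-> ts] /andP[_]; exact: le_trans.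
have i1 := continuous_within_integ cs.
rewrite [RHS]mulrC -intgZ//; apply: eq_intg => t _.
by rewrite (fC (y.1 t)); lra.
Qed.

Lemma tensor_dot_energy (y : tensorV) :
  dot (tdfun y : L2V) (tfun y) = (dot (y.1 tau) (y.1 tau) - dot (y.1 0) (y.1 0)) / 2.
Proof.
rewrite L2dotE; apply: (@tensor_energy (@dot _ V) y tau).
- by move=> *; rewrite dotPl.
- exact: dotC.
- by rewrite in_itv/= lexx ltW.
Qed.

Lemma tensor_emb_energy (y : tensorV) :
  dot (J (tdfun y)) (J (tfun y)) =
  (dot (j (y.1 tau)) (j (y.1 tau)) - dot (j (y.1 0)) (j (y.1 0))) / 2.
Proof.
rewrite L2dotE; apply: (@tensor_energy (fun v w => dot (j v) (j w)) y tau).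
- by move=> *; rewrite jP dotPl.
- by move=> *; exact: dotC.
- by rewrite in_itv/= lexx ltW.
Qed.

Lemma tensor_relax (h c : R) (k : tensorV) : h != 0 -> c \in `[0, tau] ->
  exists g : tensorV, g.1 c = 0 /\ tfun k = tfun g + h *: tdfun g.
Proof.
move=> h0 cD; have [g ng gc] := tensor_relaxation h0 cD (tensorP k).
have [y yE] := tensor_mk ng; exists y; rewrite yE; split=> //.
apply: val_inj; apply/funext => t; rewrite /= yE.
change (k.1 t = g t + h *: (h^-1 *: (k.1 t - g t))).
by rewrite scalerA mulfV// scale1r addrC subrK.
Qed.

(* Testing with the solution g of g + sg * eta * g' = p, g(c) = 0 regularizes p
   in time while keeping the sign of the pairing with the derivative. *)
Lemma one_sided (c sg : R) (p q : L2V) :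
  (c = 0 /\ sg = 1) \/ (c = tau /\ sg = -1) ->
  (forall y : tensorV, y.1 c = 0 -> - dot (J p) (J (tdfun y)) = dot q (tfun y)) ->
  sg * dot q p <= 0.
Proof.
move=> csg hq.
have cD : c \in `[0, tau].
  by rewrite in_itv/=; case: csg => -[-> _]; rewrite lexx ltW.
have sg2 : sg * sg = 1 by case: csg => -[_ ->]; lra.
have sg1 : `|sg| = 1 by case: csg => -[_ ->]; rewrite ?normrN normr1.
have posV (y : tensorV) : y.1 c = 0 -> 0 <= sg * dot (tdfun y : L2V) (tfun y).
  rewrite tensor_dot_energy; case: csg => -[-> ->] ->; rewrite dot0l.
    by have := dot_ge0 (y.1 tau); lra.
  by have := dot_ge0 (y.1 0); lra.
have posH (y : tensorV) : y.1 c = 0 -> 0 <= sg * dot (J (tdfun y)) (J (tfun y)).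
  rewrite tensor_emb_energy; case: csg => -[-> ->] ->; rewrite emb0 dot0l.
    by have := dot_ge0 (j (y.1 tau)); lra.
  by have := dot_ge0 (j (y.1 0)); lra.
pose M := cj ^+ 2 / 4 + 4 * vnorm q.
have M0 : 0 <= M by rewrite addr_ge0 ?divr_ge0 ?sqr_ge0 ?mulr_ge0 ?vnorm_ge0.
suff key dl : 0 < dl -> sg * dot q p <= M * dl.
  apply/ler_addgt0Pl => e e0; rewrite addr0.
  have M1 : 0 < M + 1 by lra.
  apply: (le_trans (key (e / (M + 1)) _)); first exact: divr_gt0.
  by rewrite mulrCA ler_piMr ?(ltW e0)// ler_pdivrMr// mul1r lerDl.
move=> dl0.
have [d [d0 dtau pd]] := tensor_dense p dl0.
have dc : d.1 c = 0 by case: csg => -[-> _].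
pose eta := dl / (vnorm (tdfun d : L2V) + 1).
have nd0 := vnorm_ge0 (tdfun d : L2V).
have eta0 : 0 < eta by rewrite divr_gt0// ltr_wpDl.
have etad : eta * vnorm (tdfun d : L2V) <= dl.
  by rewrite /eta -mulrA ler_piMr ?(ltW dl0)// mulrC ler_pdivrMr ?mul1r ?lerDl// ltr_wpDl.
pose ka := Num.min dl eta.
have ka0 : 0 < ka by rewrite lt_min dl0 eta0.
have [k [_ _ pk]] := tensor_dense p ka0.
have h0 : sg * eta != 0.
  by rewrite mulf_neq0 ?(gt_eqF eta0)// -normr_gt0 sg1.
have [g [gc gk]] := tensor_relax k h0 cD.
have kadl : ka <= dl by rewrite ge_min lexx.
have kaeta : ka <= eta by rewrite ge_min lexx orbT.
pose y := (-1) *: d + g.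
have yc : y.1 c = 0 by change (-1 *: d.1 c + g.1 c = 0); rewrite gc dc scaler0 addr0.
have gd : vnorm (tfun y : L2V) <= 3 * dl.
  set z := (tfun k : L2V) - tfun d - (sg * eta) *: tdfun d.
  have zle : vnorm z <= 3 * dl.
    have h1 := vnormD ((tfun k : L2V) - tfun d) (- ((sg * eta) *: tdfun d)).
    rewrite vnormN vnormZ normrM sg1 mul1r (gtr0_norm eta0) in h1.
    have h2 := vnorm_distD p (tfun k : L2V) (tfun d); rewrite (vnormBC _ p) in h2.
    move: h1 h2 etad pk pd kadl; rewrite -/z.
    set a1 := vnorm z; set a2 := vnorm (_ - _); set a3 := vnorm (_ - _).
    set a4 := vnorm (_ - _); set a5 := vnorm _.
    move: a1 a2 a3 a4 a5 => a1 a2 a3 a4 a5; lra.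
  apply: le_trans zle.
  have E (x : L2V) : dot (tfun y : L2V) x + sg * eta * dot (tdfun y : L2V) x = dot z x.
    rewrite /z /y gk tfunP tdfunP !dotBl !dotDl !dotZl.
    move: (dot (tfun d : L2V) x) (dot (tfun g : L2V) x) => a1 a2.
    move: (dot (tdfun d : L2V) x) (dot (tdfun g : L2V) x) => a3 a4; lra.
  have h1 := mulr_ge0 (ltW eta0) (posV y yc); have h2 := E (tfun y).
  have h3 := dot_le z (tfun y); have h4 := vnorm_ge0 (tfun y : L2V).
  rewrite -sqr_vnorm expr2 in h2; have h5 := vnorm_ge0 z; move: h1 h2 h3 h4 h5.
  move: (vnorm z) (vnorm (tfun y : L2V)) (dot z _) (dot (tdfun y : L2V) _) => a1 a2 a3 a4.
  move=> h1 h2 h3 h4 h5.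
  have h6 : a2 * a2 <= a1 * a2 by lra.
  by rewrite leNgt; apply/negP => h7; nra.
have E : J p = J (p - tfun k) + J (tfun g) + (sg * eta) *: J (tdfun g).
  by rewrite -JZ -!JD -addrA -gk subrK.
have hg : sg * dot q (tfun g) <= cj ^+ 2 / 4 * dl.
  rewrite -hq// E !dotDl dotZl -sqr_vnorm expr2.
  have h1 := dot_norm_le (J (p - tfun k)) (J (tdfun g)).
  have h2 := posH g gc; rewrite dotC in h2.
  have h3 := J_bounded (p - tfun k).
  have h4 := vnorm_ge0 (J (tdfun g)).
  have h5 : `|cj| * vnorm (p - tfun k) <= `|cj| * ka by rewrite ler_wpM2l.
  have h6 : `|cj| ^+ 2 = cj ^+ 2 by rewrite real_normK ?num_real.
  have h7 : - sg * dot (J (p - tfun k)) (J (tdfun g)) <=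
     vnorm (J (p - tfun k)) * vnorm (J (tdfun g)).
    by apply: le_trans h1; rewrite -[leRHS]mul1r -sg1 -normrN -normrM ler_norm.
  have h8 : vnorm (J (p - tfun k)) * vnorm (J (tdfun g)) <=
     `|cj| * ka * vnorm (J (tdfun g)).
    by rewrite ler_wpM2r// (le_trans h3).
  rewrite -h6; move: h2 h4 h6 h7 h8; clear h1 h3 h5.
  move: (dot (J (p - tfun k)) (J (tdfun g))) (dot (J (tfun g)) (J (tdfun g))) => a1 a2.
  move: (vnorm (J (p - tfun k))) (vnorm (J (tdfun g))) `|cj| => a3 x b h2 h4 h6 h7 h8.
  rewrite -(ler_pM2l eta0).
  have h9 : eta * (b * ka * x - eta * (x * x)) <= (b * ka) ^+ 2 / 4.
    by have := sqr_ge0 (b * ka - 2 * (eta * x)); rewrite !expr2; lra.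
  have h10 : (b * ka) ^+ 2 <= b ^+ 2 * (dl * eta).
    rewrite exprMn ler_wpM2l ?sqr_ge0// expr2 ler_pM ?(ltW ka0)//.
  have h11 : sg * - (a1 + a2 + sg * eta * (x * x)) <= b * ka * x - eta * (x * x).
    have -> : sg * - (a1 + a2 + sg * eta * (x * x)) = - sg * a1 - sg * a2 - (sg * sg) * eta * (x * x) by lra.
    by rewrite sg2; lra.
  apply: (le_trans (ler_wpM2l (ltW eta0) h11)); apply: (le_trans h9); lra.
have pg : vnorm (p - tfun g) <= 4 * dl.
  have h1 := vnorm_distD (tfun d : L2V) p (tfun g).
  have h2 : vnorm ((tfun d : L2V) - tfun g) = vnorm (tfun y : L2V).
    by rewrite vnormBC /y tfunP scaleN1r [in RHS]addrC.
  move: h1 h2 gd pd; set a1 := vnorm (_ - _); set a2 := vnorm (_ - _).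
  set a3 := vnorm (_ - _); set a4 := vnorm _; move: a1 a2 a3 a4 => a1 a2 a3 a4; lra.
have hpg : sg * dot q (p - tfun g) <= vnorm q * (4 * dl).
  apply: (@le_trans _ _ (vnorm q * vnorm (p - tfun g))).
    apply: le_trans (dot_norm_le _ _).
    by rewrite -[leRHS]mul1r -sg1 -normrM ler_norm.
  by rewrite ler_wpM2l ?vnorm_ge0.
have -> : dot q p = dot q (tfun g) + dot q (p - tfun g).
  by rewrite -dotDr addrC subrK.
rewrite mulrDr /M; move: hg hpg.
move: (sg * dot q (tfun g)) (sg * dot q (p - tfun g)) (vnorm q) => a1 a2 a3; lra.
Qed.

(* Elements of V' are represented by vectors of V: d stands for the function
   t |-> (w |-> dot (d t) w) with values in V', and u for t |-> (w |-> dot (j (u t)) (j w)). *)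
Definition wder (u d : R -> V) := forall phi, test_function tau phi -> forall w,
  intg tau (fun t => derive1 phi t * dot (j (u t)) (j w)) =
  - intg tau (fun t => phi t * dot (d t) w).

Definition hcont (U : R -> H) := forall t, t \in `[0, tau] -> forall e : R, 0 < e ->
  exists2 del : R, 0 < del &
    forall s, s \in `[0, tau] -> `|s - t| <= del -> vnorm (U s - U t) <= e.

Lemma intg_cut (f : R -> R) s : s \in `[0, tau] ->
  intg tau (fun t => (t <= s)%R%:R * f t) = intg s f.
Proof.
rewrite in_itv/= => /andP[s0 st].
rewrite /intg (_ : [set` `[0, s]] = [set` `[0, tau]] `&` [set t | t <= s]); last first.
  apply/seteqP; split=> t /=; rewrite !in_itv/=.
    by move=> /andP[-> ts]; rewrite ts (le_trans ts st).
  by move=> [/andP[-> _] ->].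
rewrite Rintegral_mkcondr; apply: eq_Rintegral => t _; rewrite patchE.
case: ifP => [|/negP h]; first by rewrite inE /= => ->; rewrite mul1r.
by rewrite (_ : (t <= s) = false) ?mul0r//; apply/negP => ts; apply: h; rewrite inE.
Qed.

Lemma sqi_cut (u : R -> V) s : sqi tau u -> sqi tau (fun t => (t <= s)%R%:R *: u t).
Proof.
apply: (@sqi_scale _ _ _ _ _ 1).
  have h := @simple_map_indic R [set` `]-oo, s]] (measurable_itv _).
  have := @simple_map_measurable _ D _ (simple_map1 (fun b : bool => b%:R : R) h).
  congr (measurable_fun _ _); apply/funext => t; congr (nat_of_bool _)%:R.
  by apply/idP/idP => [/set_mem/=|ts]; [rewrite in_itv|apply/mem_set; rewrite /= in_itv].
by move=> t _; case: (t <= s); rewrite ?normr1 ?normr0.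
Qed.

Definition time_cut s (u : L2V) : L2V := MkL2 (mem_set (sqi_cut s (L2P u))).

Lemma vnorm_cut s u : vnorm (time_cut s u) <= vnorm u.
Proof.
rewrite -ler_sqr ?nnegrE ?vnorm_ge0// !sqr_vnorm !L2dotE.
apply: le_intg; [exact: (L2P (time_cut s u)).2|exact: (L2P u).2|].
move=> t _; rewrite -[time_cut s u t]/((t <= s)%R%:R *: u t).
by case: (t <= s); rewrite ?scale1r// scale0r dot0l dot_ge0.
Qed.

Lemma tensor_emb_energy_cut (y : tensorV) s : s \in `[0, tau] ->
  dot (J (tdfun y)) (J (time_cut s (tfun y))) =
  (dot (j (y.1 s)) (j (y.1 s)) - dot (j (y.1 0)) (j (y.1 0))) / 2.
Proof.
move=> sD; rewrite -(@tensor_energy (fun v w => dot (j v) (j w)))//; last 2 first.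
- by move=> *; rewrite jP dotPl.
- by move=> *; exact: dotC.
rewrite -(intg_cut _ sD) L2dotE; apply: eq_intg => t _.
by rewrite -[J _ t]/(j (y.2 t)) -[J _ t]/(j ((t <= s)%R%:R *: y.1 t)) embZ dotZr.
Qed.

Lemma tensor_emb_continuous (y : tensorV) : hcont (fun t => j (y.1 t)).
Proof.
move=> t tD e e0.
pose f s := dot (j (y.1 s - y.1 t)) (j (y.1 s - y.1 t)).
have [df c] : exists df, C1 tau f df.
  have ny := tensorD (tensorP y) (tensor1 (- y.1 t) (C1_cst tau 1)).
  have := tensor_bilinear (f := fun v w => dot (j v) (j w)) _ _ ny ny.
  move=> /(_ ltac:(by move=> *; rewrite jP dotPl)).
  move=> /(_ ltac:(by move=> a v w z; rewrite jP !(dotC (j z)) dotPl)) c.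
  by eexists; apply: C1_eq c => // s; rewrite /f scale1r.
have [/is_derive_continuous cf _] := C1_dom c tD.
have /cvgrPdist_le/(_ (e ^+ 2) ltac:(by rewrite exprn_gt0)) := cf.
move=> /nbhs_ballP[del del0 h]; exists (del / 2); first by rewrite divr_gt0.
move=> s sD st; have := h s; rewrite -ball_normE /= distrC.
move=> /(_ ltac:(apply: (le_lt_trans st); rewrite ltr_pdivrMr// ltr_pMr// ltr1n//)).
rewrite {1}/f subrr emb0 dot0l sub0r normrN ger0_norm ?dot_ge0// /f embB -sqr_vnorm.
by rewrite ler_sqr ?nnegrE ?vnorm_ge0// ltW.
Qed.

Lemma tensor_by_parts (y z : tensorV) :
  dot (J (tdfun y)) (J (tfun z)) + dot (J (tfun y)) (J (tdfun z)) =
  dot (j (y.1 tau)) (j (z.1 tau)) - dot (j (y.1 0)) (j (z.1 0)).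
Proof.
have := tensor_bilinear (f := fun v w => dot (j v) (j w)) _ _ (tensorP y) (tensorP z).
move=> /(_ ltac:(by move=> *; rewrite jP dotPl)).
move=> /(_ ltac:(by move=> a v w x; rewrite jP !(dotC (j x)) dotPl)) c.
have tD : tau \in `[0, tau] by rewrite in_itv/= lexx ltW.
rewrite -(C1_FTC c tD) !L2dotE -intgD//.
- exact: (integ_dot (L2P (J (tdfun y))) (L2P (J (tfun z)))).
- exact: (integ_dot (L2P (J (tfun y))) (L2P (J (tdfun z)))).
Qed.

Lemma vcvg_J (u : nat -> L2V) v : vcvg u v -> vcvg (fun n => J (u n)) (J v).
Proof.
move=> uv; apply: (@vcvg_le _ _ _ _ (fun n => `|cj| * vnorm (u n - v))).
  by rewrite -[X in _ --> X](mulr0 `|cj|); apply: cvgM => //; exact: cvg_cst.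
by move=> n; rewrite -JB; exact: J_bounded.
Qed.

Lemma test_function_ends phi : test_function tau phi -> phi 0 = 0 /\ phi tau = 0.
Proof.
move=> [_ _ [a [b [a0 bt h]]]]; split; apply: h; rewrite in_itv/= negb_and -!ltNge.
  by rewrite a0.
by rewrite bt orbT.
Qed.

Lemma wder_tensorP (u d : L2V) (phi : R -> R) (w : V) (y : tensorV) :
  (y : (R -> V) * (R -> V)) = (fun t => phi t *: w, fun t => derive1 phi t *: w) ->
  (intg tau (fun t => derive1 phi t * dot (j (u t)) (j w)) =
   - intg tau (fun t => phi t * dot (d t) w)) <->
  dot (J u) (J (tdfun y)) + dot d (tfun y) = 0.
Proof.
move=> yE.
have -> : dot (J u) (J (tdfun y)) = intg tau (fun t => derive1 phi t * dot (j (u t)) (j w)).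
  rewrite L2dotE; apply: eq_intg => t _.
  by rewrite -[J (tdfun y) t]/(j (y.2 t)) yE /= embZ dotZr.
have -> : dot d (tfun y) = intg tau (fun t => phi t * dot (d t) w).
  rewrite L2dotE; apply: eq_intg => t _.
  by rewrite -[tfun y t]/(y.1 t) yE /= dotZr.
by split=> [->|/eqP]; [rewrite addNr|rewrite addr_eq0 => /eqP].
Qed.

Section lions.
Variables (B : L2V -> L2V -> R) (M al : R).
Hypothesis al0 : 0 < al.
Hypothesis BPl : forall a u v w, B (a *: u + v) w = a * B u w + B v w.
Hypothesis BPr : forall a u v w, B u (a *: v + w) = a * B u v + B u w.
Hypothesis B_bounded : forall u v, B u v <= M * vnorm u * vnorm v.
Hypothesis B_coercive : forall u, al * vnorm u ^+ 2 <= B u u.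
Hypothesis B_cut : forall s u, 0 <= B u (time_cut s u).
Hypothesis j_dense : forall y : H, (forall v, dot y (j v) = 0) -> vnorm y = 0.

Lemma lions_exists (F : L2V) (x : H) : exists (u d : L2V) (U : R -> H),
  [/\ forall w, dot d w + B u w = dot F w, wder u d, hcont U,
      ae_on tau (fun t => vnorm (U t - j (u t)) = 0) & vnorm (U 0 - x) = 0].
Proof.
have [A AE] : exists A : L2V -> L2V, forall u w, dot (A u) w = B u w.
  apply: riesz_operator => [u a v w|u]; first exact: BPr.
  by exists (M * vnorm u) => w; exact: B_bounded.
have [A' A'E] : exists A' : L2V -> L2V, forall u w, dot (A' u) w = B w u.
  apply: riesz_operator => [u a v w|u]; first exact: BPl.
  by exists (M * vnorm u) => w; rewrite mulrAC; exact: B_bounded.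
have [Cd CdE] : exists Cd : tensorV -> L2V, forall y w, dot (Cd y) w = dot (J (tdfun y)) (J w).
  apply: riesz_operator => [y a v w|y]; first by rewrite JP dotDr dotZr.
  exists (vnorm (J (tdfun y)) * `|cj|) => w; apply: (le_trans (dot_le _ _)).
  by rewrite -mulrA ler_wpM2l ?vnorm_ge0// J_bounded.
pose K (y : tensorV) : prod_hilbert L2V H := (Cd y + A (tfun y), j (y.1 0)).
have KE y p : dot (K y) p = dot (J (tdfun y)) (J p.1) + B (tfun y) p.1 + dot (j (y.1 0)) p.2.
  by rewrite -[LHS]/(dot (Cd y + A (tfun y)) p.1 + dot (j (y.1 0)) p.2) dotDl CdE AE.
have KL a y z p : dot (K (a *: y + z)) p = a * dot (K y) p + dot (K z) p.
  rewrite !KE tfunP tdfunP JP BPl dotDl dotZl.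
  have -> : (a *: y + z).1 0 = a *: y.1 0 + z.1 0 by [].
  by rewrite jP dotPl; lra.
have [p orth|g gFx] := dense_range KL _ (F, x).
  have orthE y : dot (J (tdfun y)) (J p.1) + B (tfun y) p.1 + dot (j (y.1 0)) p.2 = 0.
    by rewrite -KE dotC.
  have : 1 * dot (A' p.1) p.1 <= 0.
    apply: (@one_sided 0 1); first by left.
    move=> y y0; rewrite A'E; have := orthE y; rewrite y0 emb0 dot0l dotC; lra.
  rewrite mul1r A'E => Bp; have := B_coercive p.1 => Bp'.
  have p1 : vnorm p.1 = 0.
    apply/eqP; rewrite -sqrf_eq0; apply/eqP/le_anti; rewrite sqr_ge0 andbT.
    by rewrite -(pmulr_rle0 _ al0) (le_trans Bp').
  have Jp1 : vnorm (J p.1) = 0.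
    by apply/le_anti; rewrite vnorm_ge0 andbT (le_trans (J_bounded _))// p1 mulr0.
  have p2 : vnorm p.2 = 0.
    apply: j_dense => v; have [y yE] := tensor_mk (tensor1 v (C1_cst tau 1)).
    have h1 : dot (J (tdfun y)) (J p.1) = 0 by rewrite dotC; exact: dot_null.
    have h2 : B (tfun y) p.1 = 0 by rewrite -AE dotC; exact: dot_null.
    by have := orthE y; rewrite h1 h2 yE /= scale1r !add0r dotC.
  by apply/le_anti; rewrite vnorm_ge0 andbT (le_trans (vnorm_pair _))// p1 p2 addr0.
pose sub (y z : tensorV) : tensorV := (-1) *: z + y.
have Ksub (y z : tensorV) : vnorm (K (sub y z)) <= vnorm (K y - K z).
  have h : vnorm (K (sub y z)) ^+ 2 <= vnorm (K y - K z) * vnorm (K (sub y z)).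
    by rewrite sqr_vnorm {1}/sub KL mulN1r addrC -dotBl dot_le.
  have h0 := vnorm_ge0 (K (sub y z)); have h1 := vnorm_ge0 (K y - K z).
  move: h h0 h1; move: (vnorm _) (vnorm _) => a1 a2; rewrite expr2 => h h0 h1.
  by rewrite leNgt; apply/negP => h2; nra.
pose C := 2 / al + 1.
have C1' : 1 <= C by rewrite lerDr divr_ge0// ltW.
have Kfst (y : tensorV) : vnorm (Cd y + A (tfun y)) <= vnorm (K y) by exact: (vnorm_fst (K y)).
have Ksnd (y : tensorV) : vnorm (j (y.1 0)) <= vnorm (K y) by exact: (vnorm_snd (K y)).
have est1 (y : tensorV) : vnorm (tfun y : L2V) <= C * vnorm (K y).
  have h1 : al * vnorm (tfun y : L2V) ^+ 2 <=
      vnorm (K y) * vnorm (tfun y : L2V) + vnorm (K y) ^+ 2 / 2.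
    apply: (le_trans (B_coercive _)); rewrite -AE.
    have -> : dot (A (tfun y)) (tfun y) =
        dot (Cd y + A (tfun y)) (tfun y) - dot (Cd y) (tfun y) by rewrite dotDl; lra.
    rewrite CdE tensor_emb_energy.
    have h2 := dot_le (Cd y + A (tfun y)) (tfun y).
    have h3 : vnorm (Cd y + A (tfun y)) * vnorm (tfun y : L2V) <= vnorm (K y) * vnorm (tfun y : L2V).
      by rewrite ler_wpM2r ?vnorm_ge0.
    have h4 := dot_ge0 (j (y.1 tau)).
    have h5 : dot (j (y.1 0)) (j (y.1 0)) <= vnorm (K y) ^+ 2.
      by rewrite -sqr_vnorm ler_sqr ?nnegrE ?vnorm_ge0.
    move: h2 h3 h4 h5.
    move: (dot _ _) (vnorm _ * _) (vnorm _ * _) (dot _ _) (dot _ _) (vnorm _ ^+ 2).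
    by move=> a1 a2 a3 a4 a5 a6; lra.
  have h2 := vnorm_ge0 (tfun y : L2V); have h3 := vnorm_ge0 (K y).
  move: h1 h2 h3; move: (vnorm _) (vnorm (K y)) => a k h1 h2 h3.
  rewrite leNgt; apply/negP => h4.
  have h5 : k < a by apply: le_lt_trans h4; rewrite ler_peMl.
  have h6 : al * (C * k) < al * a by rewrite ltr_pM2l.
  have h7 : al * (C * k) = 2 * k + al * k by rewrite /C; field; exact: lt0r_neq0.
  rewrite h7 in h6; rewrite !expr2 in h1.
  have h8 : 0 <= al * k by rewrite mulr_ge0// ltW.
  have h9 : (2 * k + al * k) * a < al * a * a by rewrite ltr_pM2r//; lra.
  have h10 : k * k <= k * a by rewrite ler_wpM2l// ltW.
  have h11 : 0 <= al * k * a by rewrite mulr_ge0//.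
  nra.
pose C2 := 1 + 2 * C.
have est2 (y : tensorV) s : s \in `[0, tau] -> vnorm (j (y.1 s)) <= C2 * vnorm (K y).
  move=> sD; have C20 : 1 <= C2 by rewrite /C2; lra.
  have k0 := vnorm_ge0 (K y).
  rewrite -ler_sqr ?nnegrE ?vnorm_ge0 ?mulr_ge0//; last by lra.
  have E := tensor_emb_energy_cut y sD.
  have h1 : dot (Cd y) (time_cut s (tfun y)) <= dot (Cd y + A (tfun y)) (time_cut s (tfun y)).
    by rewrite dotDl lerDl AE.
  have h2 := dot_le (Cd y + A (tfun y)) (time_cut s (tfun y)).
  have h3 : vnorm (Cd y + A (tfun y)) * vnorm (time_cut s (tfun y)) <= vnorm (K y) * (C * vnorm (K y)).
    by apply: ler_pM; rewrite ?vnorm_ge0// (le_trans (vnorm_cut _ _)).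
  have h5 : dot (j (y.1 0)) (j (y.1 0)) <= vnorm (K y) ^+ 2.
    by rewrite -sqr_vnorm ler_sqr ?nnegrE ?vnorm_ge0.
  rewrite CdE in h1; rewrite sqr_vnorm.
  have h6 : dot (j (y.1 s)) (j (y.1 s)) <= C2 * vnorm (K y) ^+ 2.
    move: E h1 h2 h3 h5; rewrite /C2 expr2.
    move: (dot (J _) _) (dot (j (y.1 s)) _) (dot (j (y.1 0)) _) (dot (Cd y + _) _) (vnorm _ * vnorm (time_cut _ _)) (vnorm (K y)).
    by move=> a1 a2 a3 a4 a5 a6; nra.
  apply: (le_trans h6); rewrite exprMn ler_wpM2r ?sqr_ge0// expr2 ler_peMl//; lra.
have cau e : 0 < e -> exists N, forall n m, (N <= n)%N -> (N <= m)%N ->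
    vnorm (K (sub (g n) (g m))) <= e.
  move=> /(vcvg_cauchy gFx)[N h]; exists N => n m Nn Nm.
  exact: le_trans (Ksub _ _) (h n m Nn Nm).
have C0 : 0 < C by lra.
have [u gu] : exists u : L2V, vcvg (fun n => tfun (g n) : L2V) u.
  apply: hcomplete => e e0; have [N h] := cau (e / C) (divr_gt0 e0 C0).
  exists N => n m Nn Nm.
  have -> : (tfun (g n) : L2V) - tfun (g m) = tfun (sub (g n) (g m)).
    by rewrite /sub tfunP scaleN1r addrC.
  apply: (le_trans (est1 _)); rewrite mulrC -ler_pdivlMr//; exact: h.
have C20 : 0 < C2 by rewrite /C2; lra.
have unif e : 0 < e -> exists N, forall n m t, (N <= n)%N -> (N <= m)%N -> t \in `[0, tau] ->
    vnorm (j ((g n).1 t) - j ((g m).1 t)) <= e.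
  move=> e0; have [N h] := cau (e / C2) (divr_gt0 e0 C20).
  exists N => n m t Nn Nm tD.
  have -> : j ((g n).1 t) - j ((g m).1 t) = j ((sub (g n) (g m)).1 t).
    have -> : (sub (g n) (g m)).1 t = -1 *: (g m).1 t + (g n).1 t by [].
    by rewrite scaleN1r -embB [in RHS]addrC.
  apply: (le_trans (est2 _ _ tD)); rewrite mulrC -ler_pdivlMr//; exact: h.
have [U gU] : {U : R -> H & forall t, t \in `[0, tau] -> vcvg (fun n => j ((g n).1 t)) (U t)}.
  apply: (@choice _ _ (fun t x => t \in `[0, tau] -> vcvg (fun n => j ((g n).1 t)) x)) => t.
  have [tD|/negP tD] := boolP (t \in `[0, tau]); last by exists 0.
  have [|v hv] := @hcomplete _ H (fun n => j ((g n).1 t)); last by exists v.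
  by move=> e /unif[N h]; exists N => n m Nn Nm; exact: h.
have unifU e : 0 < e -> exists N, forall n t, (N <= n)%N -> t \in `[0, tau] ->
    vnorm (j ((g n).1 t) - U t) <= e.
  move=> /unif[N h]; exists N => n t Nn tD.
  apply: (cvgr_to_le (cvg_vnorm (vcvgB (vcvg_cst _) (gU t tD)))).
  by exists N => // m Nm; exact: h.
have Bu w : dot (A (tfun (g n))) w @[n --> \oo] --> B u w.
  rewrite -A'E; under eq_fun do rewrite AE -A'E.
  exact: cvg_dot (vcvg_cst _) gu.
pose d := F - A u.
have dE w : dot (Cd (g n)) w @[n --> \oo] --> dot d w.
  rewrite /d dotBl AE.
  have h : dot (Cd (g n) + A (tfun (g n))) w @[n --> \oo] --> dot F w.
    apply: cvg_dot (vcvg_cst _); apply: (vcvg_le gFx) => n.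
    exact: (vnorm_fst (K (g n) - (F, x))).
  have -> : (fun n => dot (Cd (g n)) w) =
      (fun n => dot (Cd (g n) + A (tfun (g n))) w - dot (A (tfun (g n))) w).
    by apply/funext => n; rewrite dotDl addrK.
  exact: cvgB h (Bu w).
exists u, d, U; split.
- by move=> w; rewrite /d dotBl AE subrK.
- move=> phi tphi w; have [y yE] := tensor_mk (tensor1 w (C1_test tphi)).
  apply/(wder_tensorP u d yE).
  have [phi0 phit] := test_function_ends tphi.
  have h n : dot (J (tfun (g n))) (J (tdfun y)) + dot (Cd (g n)) (tfun y) = 0.
    rewrite CdE addrC tensor_by_parts yE /= phi0 phit !scale0r emb0.
    by rewrite !(dotC _ 0) !dot0l subrr.
  have lim : dot (J (tfun (g n))) (J (tdfun y)) + dot (Cd (g n)) (tfun y) @[n --> \oo] -->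
      dot (J u) (J (tdfun y)) + dot d (tfun y).
    exact: cvgD (cvg_dot (vcvg_J gu) (vcvg_cst _)) (dE (tfun y)).
  move: lim; under eq_fun do rewrite h.
  by move=> /(cvg_unique (@Rhausdorff R) (cvg_cst _)).
- move=> t tD e e0; have e3 : 0 < e / 3 by rewrite divr_gt0.
  have [N h] := unifU _ e3; have [del del0 hd] := tensor_emb_continuous (g N) tD e3.
  exists del => // s sD st; have h1 := hd s sD st.
  have h2 := h N s (leqnn _) sD; have h3 := h N t (leqnn _) tD.
  have h4 := vnorm_distD (j ((g N).1 s)) (U s) (U t).
  have h5 := vnorm_distD (j ((g N).1 t)) (j ((g N).1 s)) (U t).
  rewrite (vnormBC (U s) (j _)) in h4.
  move: h1 h2 h3 h4 h5; set a1 := vnorm _; set a2 := vnorm _; set a3 := vnorm _.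
  set a4 := vnorm _; set a5 := vnorm _; move: a1 a2 a3 a4 a5 => a1 a2 a3 a4 a5; lra.
- have sqgu n : sqi tau (fun t => j ((g n).1 t) - j (u t)).
    exact: (L2P (J (tfun (g n)) - J u)).
  have Jgu := vcvg_J gu.
  have fat e : 0 < e -> integ tau (fun t => dot (U t - j (u t)) (U t - j (u t))) /\
      intg tau (fun t => dot (U t - j (u t)) (U t - j (u t))) <= e.
    move=> e0; apply: (@intg_fatou _ _ (fun n t => dot (j ((g n).1 t) - j (u t)) (j ((g n).1 t) - j (u t)))).
    + by move=> n; exact: (sqgu n).2.
    + by move=> n t _; exact: dot_ge0.
    + by move=> t tD; apply: cvg_dot; apply: vcvgB; by [exact: gU|exact: vcvg_cst].
    + have /vcvgP/(_ (Num.sqrt e))[|N hN] := Jgu; first by rewrite sqrtr_gt0.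
      exists N => n Nn; have hn := hN n Nn.
      rewrite (_ : intg tau _ = vnorm (J (tfun (g n)) - J u) ^+ 2); last by rewrite sqr_vnorm.
      by rewrite -(sqr_sqrtr (ltW e0)) ler_sqr ?nnegrE ?vnorm_ge0 ?sqrtr_ge0.
  have [iU _] := fat 1 ltr01.
  have := intg_eq0 iU (fun t _ => dot_ge0 _) => h.
  apply: ae_onS (h _) => [t _ ht|].
    by apply/eqP; rewrite -sqrf_eq0 sqr_vnorm ht.
  apply/le_anti; rewrite intg_ge0 ?andbT => [|t _]; last exact: dot_ge0.
  by apply/ler_addgt0Pl => e e0; rewrite addr0; exact: (fat e e0).2.
- have D0 : 0 \in `[0, tau] by rewrite in_itv/= lexx ltW.
  apply: (vcvg_unique (gU 0 D0)); apply: (vcvg_le gFx) => n.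
  exact: (vnorm_snd (K (g n) - (F, x))).
Qed.

End lions.

Lemma intg_norm_le_ae (f g : R -> R) : integ tau f -> integ tau g ->
  (forall t, t \in `[0, tau] -> 0 <= g t) -> ae_on tau (fun t => `|f t| <= g t) ->
  `|intg tau f| <= intg tau g.
Proof.
move=> fi gi g0 fg; pose h t := Num.max (- g t) (Num.min (f t) (g t)).
have hg t : t \in `[0, tau] -> `|h t| <= g t.
  move=> /g0 gt0; rewrite /h ler_norml; apply/andP; split; first by rewrite le_max lexx.
  by rewrite ge_max ge_min lexx orbT andbT; lra.
have mh : measurable_fun D h.
  apply: measurable_maxr; first by apply: integ_measurable; exact: integN.
  by apply: measurable_minr; exact: integ_measurable.
rewrite (_ : intg tau f = intg tau h); last first.
  apply: intg_ae => //; first exact: integ_measurable.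
  apply: ae_onS fg => t _; rewrite ler_norml => /andP[h1 h2].
  by rewrite /h min_l// max_r.
by apply: intg_norm_le => //; exact: le_integ hg gi.
Qed.

Section cutoff.
Variable n : nat.
Let k : R := n.+1%:R.

Definition cutl (t : R) : R := sstep (k * t + -1).
Definition dcutl (t : R) : R := dsstep (k * t + -1) * k.
Definition cutr (t : R) : R := sstep (- k * t + (k * tau - 1)).
Definition dcutr (t : R) : R := dsstep (- k * t + (k * tau - 1)) * - k.
Definition cutoff (t : R) : R := cutl t * cutr t.
Definition dcutoff (t : R) : R := dcutl t * cutr t + cutl t * dcutr t.

Let k0 : 0 < k. Proof. by rewrite ltr0n. Qed.

Lemma dsstep_ge0 (x : R) : 0 <= dsstep x.
Proof. by rewrite !mulr_ge0// le_max lexx orbT. Qed.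

Lemma dsstep_eq0 (x : R) : x <= 0 \/ 1 <= x -> dsstep x = 0.
Proof.
rewrite /dsstep => -[x0|x1]; first by rewrite (max_r x0) !mulr0.
by rewrite max_r ?mulr0 ?mul0r// subr_le0 /ramp2 max_l ?expr_ge1// (le_trans _ x1).
Qed.

Let is_derive_cut (a b t : R) :
  is_derive t (1 : R) (fun t => sstep (a * t + b)) (dsstep (a * t + b) * a).
Proof.
exact: (@is_derive1_comp _ (@sstep R) (fun t => a * t + b) t _ _ (is_derive_sstep _) (is_derive_affine _ _ _)).
Qed.

Let continuous_cut (a b : R) : continuous (fun t : R => dsstep (a * t + b) * a).
Proof.
move=> t; apply: cvgM; last exact: cvg_cst.
apply: (@continuous_comp _ _ _ (fun t => a * t + b) (@dsstep R)); last exact: continuous_dsstep.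
by apply: cvgD; [apply: cvgM; [exact: cvg_cst|exact: cvg_id]|exact: cvg_cst].
Qed.

Lemma C1_cutl : C1 tau cutl dcutl.
Proof.
by exists 1 => // t _; split; [exact: is_derive_cut|exact: continuous_cut].
Qed.

Lemma C1_cutr : C1 tau cutr dcutr.
Proof.
by exists 1 => // t _; split; [exact: is_derive_cut|exact: continuous_cut].
Qed.

Lemma cutoff_eq0 t : t < k^-1 \/ tau - k^-1 < t -> cutoff t = 0 /\ dcutoff t = 0.
Proof.
rewrite /cutoff /dcutoff /cutl /cutr /dcutl /dcutr => -[tk|tk].
  have h : k * t + -1 <= 0 by rewrite subr_le0 -ler_pdivlMl// mulr1 ltW.
  by rewrite sstep0// dsstep_eq0 ?mul0r ?addr0//; left.
have h : - k * t + (k * tau - 1) <= 0.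
  have : k * (tau - t) <= k * k^-1 by rewrite ler_pM2l// ltW// ltrBlDr addrC -ltrBlDr.
  by rewrite mulfV ?gt_eqF//; move: (k) => k' h; lra.
by rewrite (sstep0 h) (dsstep_eq0 (or_introl h)) mul0r !mulr0 addr0.
Qed.

Lemma cutl_bound t : 0 <= cutl t <= 1. Proof. exact: sstep_bound. Qed.
Lemma cutr_bound t : 0 <= cutr t <= 1. Proof. exact: sstep_bound. Qed.

Lemma dcutl_ge0 t : 0 <= dcutl t.
Proof. by rewrite mulr_ge0 ?dsstep_ge0// ltW. Qed.

Lemma dcutr_le0 t : dcutr t <= 0.
Proof. by rewrite mulr_ge0_le0 ?dsstep_ge0// oppr_le0 ltW. Qed.

Lemma dcutl_eq0 t : 2 * k^-1 <= t -> dcutl t = 0.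
Proof.
move=> tk; rewrite /dcutl dsstep_eq0 ?mul0r//; right.
by rewrite lerBrDr -ler_pdivrMl// mulrC (_ : 1 + 1 = 2 :> R).
Qed.

Lemma dcutr_eq0 t : t <= tau - 2 * k^-1 -> dcutr t = 0.
Proof.
move=> tk; rewrite /dcutr dsstep_eq0 ?mul0r//; right.
have : k * (2 * k^-1) <= k * (tau - t) by rewrite ler_pM2l// lerBrDr addrC -lerBrDr.
by rewrite mulrCA mulfV ?gt_eqF// mulr1; move: (k) => k' h; lra.
Qed.

Lemma test_function_cutoff : test_function tau cutoff /\ derive1 cutoff = dcutoff.
Proof.
have d t : is_derive t (1 : R) cutoff (dcutoff t).
  apply: (is_derive_eq (is_deriveM (is_derive_cut k (-1) t) (is_derive_cut (- k) (k * tau - 1) t))).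
  rewrite [LHS]addrC; congr (_ + _); exact: mulrC.
have dE : derive1 cutoff = dcutoff by apply/funext => t; rewrite derive1E; have [_ ->] := d t.
split=> //; split.
- by move=> t; have [] := d t.
- rewrite dE => t; apply: cvgD; apply: cvgM.
  + exact: continuous_cut.
  + exact: is_derive_continuous (is_derive_cut _ _ _).
  + exact: is_derive_continuous (is_derive_cut _ _ _).
  + exact: continuous_cut.
exists k^-1, (tau - k^-1); split; rewrite ?invr_gt0// ?ltrBlDr ?ltrDl ?invr_gt0//.
move=> t; rewrite in_itv/= negb_and -!ltNge => h.
by rewrite (cutoff_eq0 _).1//; apply/orP.
Qed.

End cutoff.

Lemma cutoff_cvg t : t \in `[0, tau] ->
  cutoff n t @[n --> \oo] --> ((0 < t < tau)%R%:R : R).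
Proof.
rewrite in_itv/= /cutoff /cutl /cutr => /andP[]; rewrite le_eqVlt => /predU1P[<- _|t0].
  rewrite ltxx; apply: cvg_near_cst; apply: nearW => n.
  by rewrite sstep0 ?mul0r// mulr0 add0r oppr_le0.
rewrite le_eqVlt => /predU1P[->|tt].
  rewrite ltxx andbF; apply: cvg_near_cst; apply: nearW => n.
  by rewrite [X in _ * X]sstep0 ?mulr0// mulNr addKr oppr_le0.
have big (c e : R) : 0 < c -> \forall n \near \oo, e <= n.+1%:R * c.
  move=> c0; exists (Num.bound `|e / c|) => // n nb.
  rewrite -ler_pdivrMr//; apply: (le_trans (ler_norm _)).
  by apply: (le_trans (ltW (archi_boundP (normr_ge0 _)))); rewrite ler_nat (leq_trans nb)// leqnSn.
rewrite t0 tt; apply: cvg_near_cst; near=> n; rewrite !sstep1 ?mul1r//.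
- have : 2 <= n.+1%:R * (tau - t) by near: n; apply: big; rewrite subr_gt0.
  by move: (n.+1%:R) => k; lra.
- have : 2 <= n.+1%:R * t by near: n; exact: big.
  by move: (n.+1%:R) => k; lra.
Unshelve. all: by end_near. Qed.

Lemma cutoff_bound n t : `|cutoff n t| <= 1.
Proof.
have /andP[a0 a1] := cutl_bound n t; have /andP[b0 b1] := cutr_bound n t.
by rewrite ger0_norm ?mulr_ge0// mulr_ile1.
Qed.

Lemma C1_cutoff n : C1 tau (cutoff n) (dcutoff n).
Proof. exact: C1M (C1_cutl n) (C1_cutr n). Qed.

Lemma C1_integ f df rho : C1 tau f df -> integ tau rho ->
  integ tau (fun t => f t * rho t) /\ integ tau (fun t => df t * rho t).
Proof.
move=> cf ir; have [M hM] := within_continuous_bounded (C1_within cf).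
have [M' hM'] := within_continuous_bounded (C1_within' cf).
split.
  exact: integM_bounded (within_continuous_measurable (C1_within cf)) hM ir.
exact: integM_bounded (within_continuous_measurable (C1_within' cf)) hM' ir.
Qed.

Lemma wder_cutoff (u d : L2V) n g dg : wder u d -> tensor tau g dg ->
  intg tau (fun t => dcutoff n t * dot (j (u t)) (j (g t)) +
    cutoff n t * (dot (j (u t)) (j (dg t)) + dot (d t) (g t))) = 0.
Proof.
move=> wd; suff h : tensor tau g dg ->
  integ tau (fun t => dcutoff n t * dot (j (u t)) (j (g t)) +
    cutoff n t * (dot (j (u t)) (j (dg t)) + dot (d t) (g t))) /\
  intg tau (fun t => dcutoff n t * dot (j (u t)) (j (g t)) +
    cutoff n t * (dot (j (u t)) (j (dg t)) + dot (d t) (g t))) = 0 by case/h.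
elim => [|l dl m g0 dg0 cl _ [ih0 ih]].
  have E : (fun t => dcutoff n t * dot (j (u t)) (j 0) +
      cutoff n t * (dot (j (u t)) (j 0) + dot (d t) 0)) = fun=> 0.
    by apply/funext => t; rewrite emb0 !dot0r addr0 !mulr0 addr0.
  by rewrite E intg0; split => //; exact: integ_cst.
have [tc dc] := test_function_cutoff n; have [tl dtl] := test_functionM tc cl.
rewrite dc in dtl.
have im : integ tau (fun t => dot (j (u t)) (j m)).
  exact: integ_dot (L2P (J u)) (sqi_cst _ _).
have idm : integ tau (fun t => dot (d t) m).
  exact: integ_dot (L2P d) (sqi_cst _ _).
have [_ i1] := C1_integ (C1_test tl) im.
have [i2 _] := C1_integ (C1_test tl) idm.
have E : (fun t => dcutoff n t * dot (j (u t)) (j (l t *: m + g0 t)) +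
    cutoff n t * (dot (j (u t)) (j (dl t *: m + dg0 t)) + dot (d t) (l t *: m + g0 t))) =
  fun t => (derive1 (fun t => cutoff n t * l t) t * dot (j (u t)) (j m) +
    cutoff n t * l t * dot (d t) m) +
    (dcutoff n t * dot (j (u t)) (j (g0 t)) +
    cutoff n t * (dot (j (u t)) (j (dg0 t)) + dot (d t) (g0 t))).
  apply/funext => t; rewrite dtl !jP !dotDr !dotZr.
  by move: (dot _ _) (dot _ _) (dot _ _) (dot _ _) (dot _ _) => a1 a2 a3 a4 a5; ring.
rewrite E; split; first by apply: integD => //; exact: integD.
rewrite intgD//; last exact: integD.
by rewrite ih addr0 intgD// (wd _ tl m) addNr.
Qed.

(* The boundary terms of the integration by parts vanish since U(0) = 0 and y(tau) = 0. *)
Lemma wder_by_parts (u d : L2V) (U : R -> H) (y : tensorV) :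
  wder u d -> hcont U -> ae_on tau (fun t => vnorm (U t - j (u t)) = 0) ->
  vnorm (U 0) = 0 -> y.1 tau = 0 ->
  dot (J u) (J (tdfun y)) + dot d (tfun y) = 0.
Proof.
move=> wd cU Uu U0 yt.
have D0 : 0 \in `[0, tau] by rewrite in_itv/= lexx ltW.
have Dt : tau \in `[0, tau] by rewrite in_itv/= lexx ltW.
have sqy : sqi tau (fun t => j (y.1 t)) := L2P (J (tfun y)).
have sqdy : sqi tau (fun t => j (y.2 t)) := L2P (J (tdfun y)).
have iX : integ tau (fun t => dot (j (u t)) (j (y.1 t))) := integ_dot (L2P (J u)) sqy.
have iY : integ tau (fun t => dot (j (u t)) (j (y.2 t)) + dot (d t) (y.1 t)).
  apply: integD; first exact: integ_dot (L2P (J u)) sqdy.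
  exact: (integ_dot (L2P d) (L2P (tfun y))).
have ybound : exists2 Y, 0 <= Y & forall t, t \in `[0, tau] -> vnorm (j (y.1 t)) <= Y.
  have c := tensor_bilinear (f := fun v w => dot (j v) (j w)) _ _ (tensorP y) (tensorP y).
  have [|a v w x|M hM] := within_continuous_bounded (C1_within (c _ _)).
  - by move=> *; rewrite jP dotPl.
  - by rewrite jP !(dotC (j x)) dotPl.
  have M0 : 0 <= M by apply: le_trans (hM 0 D0).
  exists (Num.sqrt M) => [|t tD]; first exact: sqrtr_ge0.
  by rewrite ler_wsqrtr// (le_trans (ler_norm _))// hM.
have [Y Y0 hY] := ybound.
have small e : 0 < e -> exists2 del : R, 0 < del & forall t, t \in `[0, tau] ->
    t <= del \/ tau - del <= t -> `|dot (U t) (j (y.1 t))| <= e.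
  move=> e0; have [d1 d10 h1] := cU 0 D0 (e / (Y + 1)) ltac:(by rewrite divr_gt0// ltr_wpDl).
  have [d2 d20 h2] := cU tau Dt 1 ltr01.
  have q0 : 0 < vnorm (U tau) + 1 by rewrite ltr_wpDl ?vnorm_ge0.
  have [d3 d30 h3] := tensor_emb_continuous y Dt (divr_gt0 e0 q0).
  exists (Num.min d1 (Num.min d2 d3)); first by rewrite !lt_min d10 d20 d30.
  move=> t tD; have := tD; rewrite in_itv/= => /andP[t0 tt].
  rewrite le_min => -[/andP[td _]|td]; apply: (le_trans (dot_norm_le _ _)).
    have := h1 t tD; rewrite subr0 ger0_norm// => /(_ td) h.
    have hU : vnorm (U t) <= e / (Y + 1).
      by have := vnormD (U t - U 0) (U 0); rewrite subrK U0; lra.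
    apply: (le_trans (ler_pM (vnorm_ge0 _) (vnorm_ge0 _) hU (hY t tD))).
    by rewrite mulrAC ler_pdivrMr ?ltr_wpDl// ler_wpM2l ?(ltW e0)// lerDl.
  have tt' : `|t - tau| <= Num.min d1 (Num.min d2 d3).
    by rewrite distrC ger0_norm ?subr_ge0//; lra.
  move: tt'; rewrite !le_min => /and3P[_ td2 td3].
  have := h3 t tD td3; rewrite yt emb0 subr0 => hj.
  have hU : vnorm (U t) <= vnorm (U tau) + 1.
    by have := vnormD (U t - U tau) (U tau); rewrite subrK; have := h2 t tD td2; lra.
  apply: (le_trans (ler_pM (vnorm_ge0 _) (vnorm_ge0 _) hU hj)).
  by rewrite mulrCA mulfV ?mulr1// gt_eqF.
pose X n := intg tau (fun t => dcutoff n t * dot (j (u t)) (j (y.1 t))).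
pose Z n := intg tau (fun t => cutoff n t * (dot (j (u t)) (j (y.2 t)) + dot (d t) (y.1 t))).
have XZ n : X n + Z n = 0.
  have [i1 _] := C1_integ (C1_cutoff n) iY; have [_ i2] := C1_integ (C1_cutoff n) iX.
  by rewrite /X /Z -intgD//; exact: wder_cutoff wd (tensorP y).
have X0 : X n @[n --> \oo] --> (0 : R).
  apply/cvgrPdist_le => e e0.
  have [del del0 hdel] := small (e / 2) ltac:(by rewrite divr_gt0).
  exists (Num.bound `|2 / del|) => // n nb; rewrite sub0r normrN.
  have kn : 2 * n.+1%:R^-1 <= del.
    rewrite ler_pdivrMr ?ltr0n// mulrC -ler_pdivrMr//; apply: (le_trans (ler_norm _)).
    by apply: (le_trans (ltW (archi_boundP (normr_ge0 _)))); rewrite ler_nat (leq_trans nb)// leqnSn.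
  have [_ i2] := C1_integ (C1_cutoff n) iX.
  have c1 := continuous_within_integ (C1_within' (C1_cutl n)).
  have c2 := continuous_within_integ (C1_within' (C1_cutr n)).
  have le : `|X n| <= intg tau (fun t => e / 2 * (dcutl n t - dcutr n t)).
    apply: intg_norm_le_ae => //.
    - by apply: integZ; exact: integB.
    - move=> t _; rewrite mulr_ge0 ?(ltW (divr_gt0 e0 _))//.
      by rewrite subr_ge0 (le_trans (dcutr_le0 n t))// dcutl_ge0.
    apply: ae_onS Uu => t tD ut.
    have -> : dot (j (u t)) (j (y.1 t)) = dot (U t) (j (y.1 t)).
      by have := dot_null (j (y.1 t)) ut; rewrite dotBl; lra.
    have /andP[a0 a1] := cutl_bound n t; have /andP[b0 b1] := cutr_bound n t.
    have da := dcutl_ge0 n t; have db := dcutr_le0 n t.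
    have hl : dcutl n t * `|dot (U t) (j (y.1 t))| <= dcutl n t * (e / 2).
      have [tk|tk] := leP (2 * n.+1%:R^-1) t; first by rewrite dcutl_eq0// !mul0r.
      by rewrite ler_wpM2l// hdel//; left; rewrite (le_trans (ltW tk)).
    have hr : - dcutr n t * `|dot (U t) (j (y.1 t))| <= - dcutr n t * (e / 2).
      have [tk|tk] := leP t (tau - 2 * n.+1%:R^-1); first by rewrite dcutr_eq0// oppr0 !mul0r.
      rewrite ler_wpM2l ?oppr_ge0// hdel//; right; apply: le_trans (ltW tk).
      by rewrite lerD2l lerN2.
    have hd : `|dcutoff n t| <= dcutl n t - dcutr n t.
      rewrite (le_trans (ler_normD _ _))// (normrM (dcutl n t)) (normrM (cutl n t)).
      rewrite (ger0_norm a0) (ger0_norm b0).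
      by rewrite (ger0_norm da) (ler0_norm db) lerD// ?ler_piMr// ler_piMl// oppr_ge0.
    rewrite normrM; apply: (le_trans (ler_wpM2r (normr_ge0 _) hd)).
    by rewrite mulrBl; lra.
  apply: (le_trans le); rewrite intgZ ?intgB//; last exact: integB.
  rewrite (C1_FTC (C1_cutl n) Dt) (C1_FTC (C1_cutr n) Dt).
  have /andP[a0 a1] := cutl_bound n tau; have /andP[b0 b1] := cutr_bound n tau.
  have /andP[c0 c1'] := cutl_bound n 0; have /andP[e0' e1] := cutr_bound n 0.
  rewrite -[leRHS]mulr1 -mulrA ler_pM2l// ler_pdivrMl//; lra.
have Zc : Z n @[n --> \oo] --> intg tau (fun t => dot (j (u t)) (j (y.2 t)) + dot (d t) (y.1 t)).
  have [|||t tD|iZ lim] := @intg_dominated _ tau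
    (fun n t => cutoff n t * (dot (j (u t)) (j (y.2 t)) + dot (d t) (y.1 t)))
    (fun t => (0 < t < tau)%R%:R * (dot (j (u t)) (j (y.2 t)) + dot (d t) (y.1 t)))
    (fun t => `|dot (j (u t)) (j (y.2 t)) + dot (d t) (y.1 t)|).
  - by move=> n; apply: integ_measurable; have [] := C1_integ (C1_cutoff n) iY.
  - exact: integ_norm.
  - by move=> n t _; rewrite normrM ler_piMl// cutoff_bound.
  - by apply: cvgM; [exact: cutoff_cvg|exact: cvg_cst].
  have -> : intg tau (fun t => dot (j (u t)) (j (y.2 t)) + dot (d t) (y.1 t)) =
    intg tau (fun t => (0 < t < tau)%R%:R * (dot (j (u t)) (j (y.2 t)) + dot (d t) (y.1 t))).
    apply: intg_ae; first exact: integ_measurable.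
      exact: integ_measurable iZ.
    by apply: ae_onS (ae_interior tau) => t _ ->; rewrite mul1r.
  exact: lim.
have : X n + Z n @[n --> \oo] --> 0 + intg tau (fun t => dot (j (u t)) (j (y.2 t)) + dot (d t) (y.1 t)).
  exact: cvgD X0 Zc.
under eq_fun do rewrite XZ.
move=> /(cvg_unique (@Rhausdorff R) (cvg_cst _)); rewrite add0r => ->.
rewrite !L2dotE -intgD//; last exact: (integ_dot (L2P d) (L2P (tfun y))).
exact: (integ_dot (L2P (J u)) (L2P (J (tdfun y)))).
Qed.

Lemma lions_unique (B : L2V -> L2V -> R) (al : R) (u d : L2V) (U : R -> H) :
  0 < al -> (forall u, al * vnorm u ^+ 2 <= B u u) ->
  (forall w, dot d w + B u w = 0) -> wder u d -> hcont U ->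
  ae_on tau (fun t => vnorm (U t - j (u t)) = 0) -> vnorm (U 0) = 0 -> vnorm u = 0.
Proof.
move=> al0 Bc eqn wd cU Uu U0.
have : -1 * dot d u <= 0.
  apply: (@one_sided tau (-1)); first by right.
  move=> y yt; have := wder_by_parts wd cU Uu U0 yt.
  by move: (dot _ _) (dot _ _) => a1 a2; lra.
have := eqn u; have := Bc u; move: (dot d u) (B u u) => a1 a2 h1 h2 h3.
apply/eqP; rewrite -sqrf_eq0; apply/eqP/le_anti; rewrite sqr_ge0 andbT.
by rewrite -(pmulr_rle0 _ al0); lra.
Qed.


End gelfand.

(** * Non-autonomous forms *)

Section forms.
Context {R : realType} (tau : R) (V : hilbert R).
Local Notation mR := (measurableTypeR R).
Local Notation mu := (@lebesgue_measure R).
Local Notation D := ([set` `[0, tau]] : set mR).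
Local Notation L2V := (L2hilbert tau V).
Variables (b : R -> V -> V -> R) (M : R).
Hypothesis M0 : 0 <= M.
Hypothesis bPl : forall t, t \in `[0, tau] -> forall a u v w,
  b t (a *: u + v) w = a * b t u w + b t v w.
Hypothesis bPr : forall t, t \in `[0, tau] -> forall a u v w,
  b t u (a *: v + w) = a * b t u v + b t u w.
Hypothesis b_bounded : forall t, t \in `[0, tau] -> forall u v,
  `|b t u v| <= M * vnorm u * vnorm v.
Hypothesis b_measurable : forall u v, exists N : set mR,
  [/\ measurable N, mu N = 0 & measurable_fun (D `\` N) (fun t => b t u v)].

Lemma form_cvg t (u_ v_ : nat -> V) u v : t \in `[0, tau] -> vcvg u_ u -> vcvg v_ v ->
  b t (u_ n) (v_ n) @[n --> \oo] --> b t u v.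
Proof.
move=> tD uu vv.
have bB x y z : b t (x - y) z = b t x z - b t y z.
  by rewrite addrC -scaleN1r bPl// mulN1r addrC.
have bBr x y z : b t z (x - y) = b t z x - b t z y.
  by rewrite addrC -scaleN1r bPr// mulN1r addrC.
apply/subr_cvg0.
have lim : M * vnorm (u_ n - u) * vnorm (v_ n) + M * vnorm u * vnorm (v_ n - v) @[n --> \oo]
    --> M * 0 * vnorm v + M * vnorm u * 0.
  apply: cvgD; apply: cvgM; [|exact: cvg_vnorm|exact: cvg_cst|exact: vv].
  by apply: cvgM; [exact: cvg_cst|exact: uu].
rewrite !mulr0 mul0r addr0 in lim.
apply: (@squeeze_cvgr _ _ _ _
  (fun n => - (M * vnorm (u_ n - u) * vnorm (v_ n) + M * vnorm u * vnorm (v_ n - v))) _ _ _ _ _ lim).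
  apply: nearW => n; rewrite -ler_norml.
  have -> : b t (u_ n) (v_ n) - b t u v = b t (u_ n - u) (v_ n) + b t u (v_ n - v).
    by rewrite bB bBr; lra.
  by apply: (le_trans (ler_normD _ _)); rewrite lerD ?b_bounded.
by rewrite -oppr0; exact: cvgN.
Qed.

Lemma form_version (u v : L2V) : exists h, integ tau h /\
  ae_on tau (fun t => h t = b t (u t) (v t)).
Proof.
have [[s ss su] _] := L2P u; have [[r sr rv] _] := L2P v.
have [N_ hN] := choice (fun p : V * V => b_measurable p.1 p.2).
have [w ws] := simple_maps_enum ss; have [w' wr] := simple_maps_enum sr.
pose N := \bigcup_k \bigcup_l N_ (w k, w' l).
have mN : measurable N.
  apply: bigcupT_measurable => k; apply: bigcupT_measurable => l.
  by have [] := hN (w k, w' l).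
have nN : mu.-negligible N.
  apply: negligible_bigcup => k; apply: negligible_bigcup => l.
  by have [mN' N'0 _] := hN (w k, w' l); exact/negligibleP.
have mbn n : measurable_fun (D `\` N) (fun t => b t (s n t) (r n t)).
  move=> mD Y mY.
  have -> : (D `\` N) `&` (fun t => b t (s n t) (r n t)) @^-1` Y =
     \bigcup_(x in range (s n)) \bigcup_(y in range (r n))
       ((s n @^-1` [set x] `&` r n @^-1` [set y]) `&` ((D `\` N) `&` (fun t => b t x y) @^-1` Y)).
    apply/seteqP; split => [t [DN /= bY]|t [x _ [y _ [[/= <- <-] [DN bY]]]]]; last by split.
    exists (s n t); first by exists t.
    by exists (r n t); first by exists t.
  apply: fin_bigcup_measurable => [|x sx]; first exact: (ss n).1.
  apply: fin_bigcup_measurable => [|y ry]; first exact: (sr n).1.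
  apply: measurableI; first by apply: measurableI; [exact: (ss n).2|exact: (sr n).2].
  have [_ _ mb] := hN (x, y).
  apply: (measurable_funS _ _ mb) => //.
  - by apply: measurableD; [exact: measurable_dom|have [] := hN (x, y)].
  - move=> t [tD tN]; split => // tNxy; apply: tN.
    case: sx ry => [t1 _ t1x] [t2 _ t2y].
    have [k kE] := ws n t1; have [l lE] := wr n t2.
    by exists k => //; exists l => //; rewrite kE lE t1x t2y.
have mb : measurable_fun (D `\` N) (fun t => b t (u t) (v t)).
  apply: (measurable_fun_cvg mbn) => t [tD _]; apply: form_cvg => //.
  - exact: su.
  - exact: rv.
exists (fun t => if t \in N then 0 else b t (u t) (v t)); split; last first.
  have [N' [mN' N'0 NN']] := nN; exists N'; split=> // t /= /not_implyP[tD].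
  case: ifP => [/set_mem/NN'//|_ []]; by [].
apply: (@le_integ _ _ _ (fun t => M * (dot (u t) (u t) + dot (v t) (v t)))).
- apply: measurable_fun_if => //.
  + move=> _ Y _; apply: measurableI; first exact: measurable_dom.
    exact: simple_map_preimage (simple_map_indic mN).
  + apply: (measurable_funS _ _ mb).
      by apply: measurableD => //; exact: measurable_dom.
    by move=> t [tD /= tN]; split => // /mem_set; rewrite tN.
- move=> t tD; rewrite -!sqr_vnorm; have h0 := vnorm_ge0 (u t); have h1 := vnorm_ge0 (v t).
  have h2 : 0 <= M * (vnorm (u t) ^+ 2 + vnorm (v t) ^+ 2) by rewrite mulr_ge0// addr_ge0 ?sqr_ge0.
  case: ifP => _; first by rewrite normr0.
  apply: (le_trans (b_bounded tD _ _)); rewrite -mulrA ler_wpM2l//.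
  have := sqr_ge0 (vnorm (u t) - vnorm (v t)); move: h0 h1.
  by move: (vnorm _) (vnorm _) => x y; rewrite !expr2; nra.
- by apply: integZ; apply: integD; [exact: (L2P u).2|exact: (L2P v).2].
Qed.

End forms.

Lemma ae_on_exists (R : realType) (tau : R) (P : R -> Prop) (c e : R) :
  c < e -> 0 <= c -> e <= tau -> ae_on tau P -> exists2 t, c < t < e & P t.
Proof.
move=> ce c0 et [N [mN N0 PN]]; apply: contrapT => h.
have sN : `]c, e[%classic `<=` N.
  move=> t; rewrite /= in_itv/= => tce; apply: PN => /= Pt; apply: h; exists t => //.
  by apply: Pt; move: tce => /andP[ct te]; rewrite in_itv/=; apply/andP; split; lra.
have : (@lebesgue_measure R `]c, e[%classic <= @lebesgue_measure R N)%E.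
  by apply: le_measure => //; rewrite inE//; exact: measurable_itv.
rewrite N0 lebesgue_measure_itv/= lte_fin ce -EFinD lee_fin; lra.
Qed.

Section solutions.
Context {R : realType} (tau : R) (V H : hilbert R) (j : V -> H) (cj : R).
Hypothesis tau0 : 0 < tau.
Hypothesis jP : forall a x y, j (a *: x + y) = a *: j x + j y.
Hypothesis j_bounded : forall v, vnorm (j v) <= cj * vnorm v.
Hypothesis j_dense : forall y : H, (forall v, dot y (j v) = 0) -> vnorm y = 0.
Local Notation mR := (measurableTypeR R).
Local Notation mu := (@lebesgue_measure R).
Local Notation D := ([set` `[0, tau]] : set mR).
Local Notation L2V := (L2hilbert tau V).
Local Notation J := (@J R tau V H j cj jP j_bounded).
Implicit Types (b : R -> V -> V -> R) (F u d : L2V) (U : R -> H).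

(* u' + b(t, u) = F weakly in V', with F and d = u' represented by vectors of V
   as in [wder], and U the representative of u that is continuous in H. *)
Definition sol b F u d U := [/\ wder tau j u d,
  forall w, ae_on tau (fun t => dot (d t) w + b t (u t) w = dot (F t) w),
  hcont tau U & ae_on tau (fun t => vnorm (U t - j (u t)) = 0)].

Let subrACA (X : zmodType) (x y z w : X) : x - y - (z - w) = x - z - (y - w).
Proof. by rewrite !opprD !opprK addrACA. Qed.

Lemma weak_ae F (rho : R -> R) w : integ tau rho ->
  (forall phi, test_function tau phi ->
    intg tau (fun t => phi t * dot (F t) w) = intg tau (fun t => phi t * rho t)) ->
  ae_on tau (fun t => dot (F t) w = rho t).
Proof.
move=> ir h; have iF : integ tau (fun t => dot (F t) w) := integ_dot (L2P F) (sqi_cst _ _).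
have : ae_on tau (fun t => dot (F t) w - rho t = 0).
  apply: test_function_orth; first exact: integB.
  move=> phi tphi.
  have [i1 _] := C1_integ (C1_test tphi) iF; have [i2 _] := C1_integ (C1_test tphi) ir.
  rewrite -(subrr (intg tau (fun t => phi t * rho t))) -{1}(h _ tphi) -intgB//.
  by apply: eq_intg => t _; rewrite mulrBr.
by apply: ae_onS => t _ /eqP; rewrite subr_eq0 => /eqP.
Qed.

Lemma emb_operator : exists C : L2V -> L2V, forall u w,
  ae_on tau (fun t => dot (C u t) w = dot (j (u t)) (j w)).
Proof.
have [C CE] : exists C : L2V -> L2V, forall u w, dot (C u) w = dot (J u) (J w).
  apply: riesz_operator => [u a v w|u]; first by rewrite JP dotDr dotZr.
  exists (vnorm (J u) * `|cj|) => w; apply: (le_trans (dot_le _ _)).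
  by rewrite -mulrA ler_wpM2l ?vnorm_ge0// J_bounded.
exists C => u w; apply: weak_ae; first exact: integ_dot (L2P (J u)) (sqi_cst _ _).
move=> phi tphi; have [y yE] := tensor_mk (tensor1 w (C1_test tphi)).
have := CE u (tfun y); rewrite !L2dotE => h.
transitivity (intg tau (fun t => dot (C u t) (tfun y t))).
  by apply: eq_intg => t _; rewrite -[tfun y t]/(y.1 t) yE /= dotZr.
rewrite h; apply: eq_intg => t _.
by rewrite -[J (tfun y) t]/(j (y.1 t)) yE /= (embZ jP) dotZr.
Qed.

Lemma hcont_scale th dth U : C1 tau th dth -> hcont tau U -> hcont tau (fun t => th t *: U t).
Proof.
move=> cth cU t tD e e0.
have [M hM] := within_continuous_bounded (C1_within cth).
have q0 : 0 < 2 * (vnorm (U t) + 1) by rewrite mulr_gt0// ltr_wpDl ?vnorm_ge0.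
have p0 : 0 < 2 * (`|M| + 1) by rewrite mulr_gt0// ltr_wpDl.
have [/is_derive_continuous ct _] := C1_dom cth tD.
have /cvgrPdist_le/(_ _ (divr_gt0 e0 q0))/nbhs_ballP[d1 d10 h1] := ct.
have [d2 d20 h2] := cU t tD _ (divr_gt0 e0 p0).
exists (Num.min (d1 / 2) d2); first by rewrite lt_min d20 divr_gt0.
move=> s sD; rewrite le_min => /andP[st1 st2].
have hs : `|th s - th t| <= e / (2 * (vnorm (U t) + 1)).
  rewrite distrC; apply: h1; rewrite -ball_normE /= distrC.
  by apply: (le_lt_trans st1); rewrite ltr_pdivrMr// ltr_pMr// ltr1n.
have hU := h2 s sD st2.
have -> : th s *: U s - th t *: U t = th s *: (U s - U t) + (th s - th t) *: U t.
  by rewrite scalerBr scalerBl addrA subrK.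
apply: (le_trans (vnormD _ _)); rewrite !vnormZ.
have e1 : `|th s| * vnorm (U s - U t) <= e / 2.
  apply: (le_trans (ler_pM (normr_ge0 _) (vnorm_ge0 _) (le_trans (hM s sD) (ler_norm M)) hU)).
  have := divfK (lt0r_neq0 p0) e; have := divr_gt0 e0 p0.
  by move: (e / (2 * (`|M| + 1))) => x x0 xe; rewrite -xe; lra.
have e2 : `|th s - th t| * vnorm (U t) <= e / 2.
  apply: (le_trans (ler_wpM2r (vnorm_ge0 _) hs)).
  have := divfK (lt0r_neq0 q0) e; have := divr_gt0 e0 q0.
  by move: (e / (2 * (vnorm (U t) + 1))) => x x0 xe; rewrite -xe; lra.
by move: e1 e2; move: (_ * vnorm _) (_ * vnorm _) => x y; lra.
Qed.

Lemma hcont_ae0 U : hcont tau U -> ae_on tau (fun t => vnorm (U t) = 0) ->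
  forall t, t \in `[0, tau] -> vnorm (U t) = 0.
Proof.
move=> cU U0 t tD; apply/eqP/negPn/negP => Ut.
have e0 : 0 < vnorm (U t) / 2 by rewrite divr_gt0// lt_neqAle eq_sym Ut vnorm_ge0.
have [d d0 hd] := cU t tD _ e0.
have := tD; rewrite in_itv/= => /andP[t0 tt].
have [|||s /andP[s1 s2] Us] := @ae_on_exists R tau _ (Num.max 0 (t - d)) (Num.min tau (t + d)) _ _ _ U0.
- rewrite gt_max !lt_min; apply/andP; split; apply/andP; split; rewrite ?tau0//; lra.
- by rewrite le_max lexx.
- by rewrite ge_min lexx.
move: s1 s2; rewrite gt_max lt_min => /andP[s0 s1] /andP[s2 s3].
have sD : s \in `[0, tau] by rewrite in_itv/= (ltW s0) (ltW s2).
have st : `|s - t| < d by rewrite ltr_norml; apply/andP; split; lra.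
have h := hd s sD (ltW st); have := vnormD (U t - U s) (U s); rewrite subrK Us vnormBC.
by move: e0 h; move: (vnorm _) (vnorm _) => a c; lra.
Qed.

Lemma L2_scale u th dth : C1 tau th dth -> exists v : L2V, forall t, v t = th t *: u t.
Proof.
move=> cth; have [M hM] := within_continuous_bounded (C1_within cth).
have s1 := sqi_scale (within_continuous_measurable (C1_within cth)) hM (L2P u).
by have [v vE] := L2_mk s1; exists v => t; rewrite vE.
Qed.

Lemma sol_eq b b' F u d U :
  (forall t, t \in `[0, tau] -> forall x y, b t x y = b' t x y) ->
  sol b F u d U -> sol b' F u d U.
Proof.
by move=> bb [wd eqn cU Uu]; split=> // w; apply: ae_onS (eqn w) => t tD; rewrite bb.
Qed.

Lemma sol_mul b F F' u d U (v : L2V) th dth : C1 tau th dth ->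
  (forall t, t \in `[0, tau] -> forall a x y z, b t (a *: x + y) z = a * b t x z + b t y z) ->
  sol b F u d U ->
  (forall w, ae_on tau (fun t => dot (F' t) w = th t * dot (F t) w + dth t * dot (j (u t)) (j w))) ->
  (forall t, v t = th t *: u t) ->
  exists d', sol b F' v d' (fun t => th t *: U t).
Proof.
move=> cth bP [wd eqn cU Uu] F'E vE.
have [C CE] := emb_operator.
have [M hM] := within_continuous_bounded (C1_within cth).
have [M' hM'] := within_continuous_bounded (C1_within' cth).
have s1 : sqi tau (fun t => th t *: d t).
  exact: sqi_scale (within_continuous_measurable (C1_within cth)) hM (L2P d).
have s2 : sqi tau (fun t => dth t *: C u t).
  exact: sqi_scale (within_continuous_measurable (C1_within' cth)) hM' (L2P (C u)).
have [d' d'E] := L2_mk (sqiD s1 s2); exists d'; split.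
- move=> phi tphi w.
  have [tpt dpt] := test_functionM tphi cth.
  have im : integ tau (fun t => dot (j (u t)) (j w)) := integ_dot (L2P (J u)) (sqi_cst _ _).
  have id' : integ tau (fun t => dot (d t) w) := integ_dot (L2P d) (sqi_cst _ _).
  have [_ i1] := C1_integ (C1_test tpt) im.
  have [_ i2'] := C1_integ cth im; have [i2 _] := C1_integ (C1_test tphi) i2'.
  have [i3 _] := C1_integ (C1_test tpt) id'.
  transitivity (intg tau (fun t => derive1 (fun t => phi t * th t) t * dot (j (u t)) (j w)
      - phi t * (dth t * dot (j (u t)) (j w)))).
    apply: eq_intg => t _; rewrite vE (embZ jP) dotZl dpt; ring.
  rewrite intgB// (wd _ tpt w) -opprD -intgD//; congr (- _).
  apply: intg_ae.
  + by apply: integ_measurable; exact: integD.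
  + apply: integ_measurable; have [] := C1_integ (C1_test tphi) (integ_dot (L2P d') (sqi_cst tau w)).
    by [].
  by apply: ae_onS (CE u w) => t _ h; rewrite d'E dotDl !dotZl h; ring.
- move=> w; apply: ae_onS2 (F'E w) _ => [t tD -> h|].
    exact: h.
  apply: ae_onS2 (CE u w) (eqn w) => t tD h1 h2.
  have b0 z : b t 0 z = 0 by have := bP t tD 1 0 0 z; rewrite scaler0 addr0; lra.
  have bZ a x z : b t (a *: x) z = a * b t x z by rewrite -[a *: x]addr0 bP// b0 addr0.
  by rewrite d'E vE bZ dotDl !dotZl h1 -h2; ring.
- exact: hcont_scale cth cU.
- by apply: ae_onS Uu => t _ h; rewrite vE (embZ jP) -scalerBr vnormZ h mulr0.
Qed.

Lemma sol_shift b F F' u d U (om : R) : sol b F u d U ->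
  (forall w, ae_on tau (fun t => dot (F' t) w = dot (F t) w + om * dot (j (u t)) (j w))) ->
  sol (fun t v w => b t v w + om * dot (j v) (j w)) F' u d U.
Proof.
move=> [wd eqn cU Uu] h; split=> // w.
by apply: ae_onS2 (eqn w) (h w) => t _ h1 ->; rewrite addrA h1.
Qed.

Lemma sol_sub b F F' u u' d d' U U' :
  (forall t, t \in `[0, tau] -> forall a x y z, b t (a *: x + y) z = a * b t x z + b t y z) ->
  sol b F u d U -> sol b F' u' d' U' ->
  sol b (F - F') (u - u') (d - d') (fun t => U t - U' t).
Proof.
move=> bP [wd eqn cU Uu] [wd' eqn' cU' Uu']; split.
- move=> phi tphi w.
  have im (v : L2V) : integ tau (fun t => dot (j (v t)) (j w)) := integ_dot (L2P (J v)) (sqi_cst _ _).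
  have id' (v : L2V) : integ tau (fun t => dot (v t) w) := integ_dot (L2P v) (sqi_cst _ _).
  have [_ i1] := C1_integ (C1_test tphi) (im u); have [_ i2] := C1_integ (C1_test tphi) (im u').
  have [i3 _] := C1_integ (C1_test tphi) (id' d); have [i4 _] := C1_integ (C1_test tphi) (id' d').
  transitivity (intg tau (fun t => derive1 phi t * dot (j (u t)) (j w) - derive1 phi t * dot (j (u' t)) (j w))).
    by apply: eq_intg => t _; rewrite L2BE (embB jP) dotBl mulrBr.
  rewrite intgB// (wd _ tphi) (wd' _ tphi) -opprD; congr (- _).
  rewrite -intgB//; apply: eq_intg => t _; by rewrite L2BE dotBl mulrBr.
- move=> w; apply: ae_onS2 (eqn w) (eqn' w) => t tD h h'.
  have bB x y z : b t (x - y) z = b t x z - b t y z.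
    by rewrite addrC -scaleN1r bP// mulN1r addrC.
  by rewrite !L2BE !dotBl bB -h -h'; ring.
- move=> t tD e e0; have e2 : 0 < e / 2 by rewrite divr_gt0.
  have [d1 d10 h1] := cU t tD _ e2; have [d2 d20 h2] := cU' t tD _ e2.
  exists (Num.min d1 d2); first by rewrite lt_min d10 d20.
  move=> s sD; rewrite le_min => /andP[/(h1 s sD) h3 /(h2 s sD) h4].
  rewrite subrACA; have := vnormD (U s - U t) (- (U' s - U' t)).
  by rewrite vnormN; lra.
- apply: ae_onS2 Uu Uu' => t _ h h'; apply/le_anti; rewrite vnorm_ge0 andbT.
  rewrite L2BE (embB jP) subrACA.
  by apply: (le_trans (vnormD _ _)); rewrite vnormN h h' addr0.
Qed.

Lemma sol_ramp b u d U :
  (forall t, t \in `[0, tau] -> forall a x y z, b t (a *: x + y) z = a * b t x z + b t y z) ->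
  sol b 0 u d U -> exists F v d', sol b F v d' (fun t => (- tau^-1 * t + 1) *: U t).
Proof.
move=> bP s; have [C CE] := emb_operator.
have [v vE] := L2_scale u (C1_affine tau (- tau^-1) 1).
exists (- tau^-1 *: C u), v; apply: (sol_mul (C1_affine tau (- tau^-1) 1) bP s _ vE) => w.
apply: ae_onS (CE u w) => t _ h.
by rewrite L2ZE dotZl h -[(0 : L2V) t]/(0 : V) dot0l mulr0 add0r.
Qed.

Section bounded_form.
Variables (b : R -> V -> V -> R) (M al : R).
Hypothesis M0 : 0 <= M.
Hypothesis al0 : 0 < al.
Hypothesis bPl : forall t, t \in `[0, tau] -> forall a x y z,
  b t (a *: x + y) z = a * b t x z + b t y z.
Hypothesis bPr : forall t, t \in `[0, tau] -> forall a z x y,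
  b t z (a *: x + y) = a * b t z x + b t z y.
Hypothesis b_bounded : forall t, t \in `[0, tau] -> forall x y,
  `|b t x y| <= M * vnorm x * vnorm y.
Hypothesis b_measurable : forall x y, exists N : set mR,
  [/\ measurable N, mu N = 0 & measurable_fun (D `\` N) (fun t => b t x y)].

Section coercive.
Hypothesis b_coercive : forall t, t \in `[0, tau] -> forall x,
  al * vnorm x ^+ 2 <= b t x x.

Lemma form_operator : exists B : L2V -> L2V -> R,
  (forall u w : L2V, exists h, [/\ integ tau h,
     ae_on tau (fun t => h t = b t (u t) (w t)) & B u w = intg tau h]) /\
  (forall (u w : L2V) h, integ tau h -> ae_on tau (fun t => h t = b t (u t) (w t)) ->
    B u w = intg tau h).
Proof.
have h (p : L2V * L2V) := form_version M0 bPl bPr b_bounded b_measurable p.1 p.2.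
have [f fP] := choice h; exists (fun u w => intg tau (f (u, w))); split=> [u w|u w k ik kE].
  by exists (f (u, w)); have [] := fP (u, w).
have [i1 e1] := fP (u, w); apply: intg_ae; [exact: integ_measurable..|].
by apply: ae_onS2 e1 kE => t _ -> ->.
Qed.

Lemma coercive_solP : exists B : L2V -> L2V -> R,
  [/\ forall a (u v w : L2V), B (a *: u + v) w = a * B u w + B v w,
      forall a (u v w : L2V), B u (a *: v + w) = a * B u v + B u w,
      forall u v : L2V, B u v <= M * vnorm u * vnorm v,
      forall u, al * vnorm u ^+ 2 <= B u u &
      forall s u, 0 <= B u (time_cut s u)] /\
  forall F u d, (forall w, ae_on tau (fun t => dot (d t) w + b t (u t) w = dot (F t) w)) <->
    forall w, dot d w + B u w = dot F w.
Proof.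
have [B [Bex BE]] := form_operator; exists B.
have BPl a (u v w : L2V) : B (a *: u + v) w = a * B u w + B v w.
  have [f [fi fE ->]] := Bex u w; have [g [gi gE ->]] := Bex v w.
  rewrite -intgZ// -intgD//; last exact: integZ.
  apply: BE; first by apply: integD => //; exact: integZ.
  by apply: ae_onS2 fE gE => t tD -> ->; rewrite -bPl.
have BPr a (u v w : L2V) : B u (a *: v + w) = a * B u v + B u w.
  have [f [fi fE ->]] := Bex u v; have [g [gi gE ->]] := Bex u w.
  rewrite -intgZ// -intgD//; last exact: integZ.
  apply: BE; first by apply: integD => //; exact: integZ.
  by apply: ae_onS2 fE gE => t tD -> ->; rewrite -bPr.
have b0r t x : t \in `[0, tau] -> b t x 0 = 0.
  by move=> tD; have := bPr tD 1 x 0 0; rewrite scaler0 addr0; lra.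
have bZr t a x y : t \in `[0, tau] -> b t x (a *: y) = a * b t x y.
  by move=> tD; rewrite -[a *: y]addr0 bPr// b0r// addr0.
have Bb (u v : L2V) : B u v <= M * vnorm u * vnorm v.
  have [f [fi fE ->]] := Bex u v; have [iuv uv] := intg_vnormM u v.
  apply: (@le_trans _ _ (intg tau (fun t => M * (vnorm (u t) * vnorm (v t))))).
    apply: le_intg_ae => //; first exact: integZ.
    by apply: ae_onS fE => t tD ->; rewrite mulrA (le_trans (ler_norm _))// b_bounded.
  by rewrite intgZ// -mulrA ler_wpM2l.
have Bc u : al * vnorm u ^+ 2 <= B u u.
  have [f [fi fE ->]] := Bex u u.
  rewrite sqr_vnorm L2dotE -intgZ; last exact: (L2P u).2.
  apply: le_intg_ae => //; first by apply: integZ; exact: (L2P u).2.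
  by apply: ae_onS fE => t tD ->; rewrite -sqr_vnorm b_coercive.
have Bcut s u : 0 <= B u (time_cut s u).
  have [f [fi fE ->]] := Bex u (time_cut s u); rewrite -(intg0 tau).
  apply: le_intg_ae => //; first exact: integ_cst.
  apply: ae_onS fE => t tD ->; rewrite -[time_cut s u t]/((t <= s)%R%:R *: u t) bZr//.
  rewrite mulr_ge0// (le_trans _ (b_coercive tD _))// mulr_ge0 ?sqr_ge0// ltW//.
split=> // F u d; split=> eqn w.
  have [A AE] : exists A : L2V -> L2V, forall u w, dot (A u) w = B u w.
    apply: riesz_operator => [v a x y|v]; first exact: BPr.
    by exists (M * vnorm v) => x; exact: Bb.
  pose q := d + A u - F.
  have qE x : dot q x = dot d x + B u x - dot F x by rewrite /q dotBl dotDl AE.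
  have qy (y : tensorT tau V) : dot q (tfun y) = 0.
    rewrite qE; have [f [fi fE ->]] := Bex u (tfun y).
    have ae g dg : tensor tau g dg ->
        ae_on tau (fun t => dot (d t) (g t) + b t (u t) (g t) = dot (F t) (g t)).
      elim => [|l dl m g0 dg0 _ _ ih].
        by apply: ae_onW => t tD; rewrite !dot0r b0r// addr0.
      apply: ae_onS2 (eqn m) ih => t tD h1 h2.
      by rewrite bPr// !dotDr !dotZr -h1 -h2; ring.
    have i1 := integ_dot (L2P d) (L2P (tfun y)); have i2 := integ_dot (L2P F) (L2P (tfun y)).
    rewrite !L2dotE -intgD//; apply/eqP; rewrite subr_eq0; apply/eqP.
    apply: intg_ae; [by apply: integ_measurable; exact: integD|exact: integ_measurable|].
    by apply: ae_onS2 fE (ae _ _ (tensorP y)) => t _ ->.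
  have q0 : vnorm q = 0.
    have q00 := vnorm_ge0 q.
    apply/eqP; rewrite eq_le q00 andbT; apply/ler_addgt0Pl => e e0; rewrite addr0.
    have [y [_ _ hy]] := tensor_dense q e0.
    have := dot_le q (q - tfun y); rewrite dotBr qy subr0 -sqr_vnorm expr2.
    move: hy; move: (vnorm _) (vnorm _) q00 => x z z0 h1 h2.
    rewrite leNgt; apply/negP => h3; nra.
  by apply/eqP; rewrite -subr_eq0 -qE dot_null.
have [cw cwE] := L2_mk (sqi_cst tau w).
have [f [fi fE _]] := Bex u cw.
have h : ae_on tau (fun t => dot ((F - d) t) w = f t).
  apply: weak_ae => // phi tphi; have [y yE] := tensor_mk (tensor1 w (C1_test tphi)).
  have -> : intg tau (fun t => phi t * dot ((F - d) t) w) = dot (F - d) (tfun y).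
    rewrite L2dotE; apply: eq_intg => t _.
    by rewrite -[tfun y t]/(y.1 t) yE /= dotZr.
  rewrite dotBl -eqn addrAC subrr add0r; apply: BE.
    by have [] := C1_integ (C1_test tphi) fi.
  apply: ae_onS fE => t tD ->; rewrite -[tfun y t]/(y.1 t) yE /= bZr//.
  by rewrite cwE.
apply: ae_onS2 h fE => t tD; rewrite L2BE dotBl cwE => <- <-.
by rewrite addrC subrK.
Qed.

Lemma coercive_exists F (x : H) : exists u d U, sol b F u d U /\ vnorm (U 0 - x) = 0.
Proof.
have [B [[BPl BPr Bb Bc Bcut] BP]] := coercive_solP.
have [u [d [U [eqn wd cU Uu U0]]]] := lions_exists tau0 jP j_bounded al0 BPl BPr Bb Bc Bcut j_dense F x.
by exists u, d, U; split=> //; split=> //; apply/BP.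
Qed.

Lemma coercive_unique u d U : sol b 0 u d U -> vnorm (U 0) = 0 -> vnorm u = 0.
Proof.
have [B [[BPl BPr Bb Bc Bcut] BP]] := coercive_solP.
move=> [wd /BP eqn cU Uu] U0.
apply: (lions_unique (B := B) tau0 jP j_bounded al0 Bc _ wd cU Uu U0).
by move=> w; rewrite eqn dot0l.
Qed.

End coercive.

End bounded_form.

Section quasi_coercive.
Variables (b : R -> V -> V -> R) (M om al : R).
Hypothesis M0 : 0 <= M.
Hypothesis al0 : 0 < al.
Hypothesis bPl : forall t, t \in `[0, tau] -> forall a x y z,
  b t (a *: x + y) z = a * b t x z + b t y z.
Hypothesis bPr : forall t, t \in `[0, tau] -> forall a z x y,
  b t z (a *: x + y) = a * b t z x + b t z y.
Hypothesis b_bounded : forall t, t \in `[0, tau] -> forall x y,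
  `|b t x y| <= M * vnorm x * vnorm y.
Hypothesis b_measurable : forall x y, exists N : set mR,
  [/\ measurable N, mu N = 0 & measurable_fun (D `\` N) (fun t => b t x y)].
Hypothesis b_quasi_coercive : forall t, t \in `[0, tau] -> forall x,
  al * vnorm x ^+ 2 <= b t x x + om * vnorm (j x) ^+ 2.

Let b' t x y := b t x y + om * dot (j x) (j y).

Let b'Pl t : t \in `[0, tau] -> forall a x y z,
  b' t (a *: x + y) z = a * b' t x z + b' t y z.
Proof. by move=> tD a x y z; rewrite /b' bPl// jP dotPl; ring. Qed.

Let b'Pr t : t \in `[0, tau] -> forall a z x y,
  b' t z (a *: x + y) = a * b' t z x + b' t z y.
Proof. by move=> tD a z x y; rewrite /b' bPr// jP dotDr dotZr; ring. Qed.

Let M'0 : 0 <= M + `|om| * cj ^+ 2.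
Proof. by rewrite addr_ge0// mulr_ge0// sqr_ge0. Qed.

Let b'_bounded t : t \in `[0, tau] -> forall x y,
  `|b' t x y| <= (M + `|om| * cj ^+ 2) * vnorm x * vnorm y.
Proof.
move=> tD x y; apply: (le_trans (ler_normD _ _)); rewrite !mulrDl lerD ?b_bounded//.
rewrite normrM -!mulrA ler_wpM2l//; apply: (le_trans (dot_norm_le _ _)).
apply: (le_trans (ler_pM (vnorm_ge0 _) (vnorm_ge0 _) (j_bounded x) (j_bounded y))).
by rewrite le_eqVlt; apply/orP; left; apply/eqP; ring.
Qed.

Let b'_measurable x y : exists N : set mR,
  [/\ measurable N, mu N = 0 & measurable_fun (D `\` N) (fun t => b' t x y)].
Proof.
have [N [mN N0 mb]] := b_measurable x y; exists N; split=> //.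
by apply: measurable_funD => //; exact: measurable_cst.
Qed.

Let b'_coercive t : t \in `[0, tau] -> forall x, al * vnorm x ^+ 2 <= b' t x x.
Proof. by move=> tD x; rewrite /b' -sqr_vnorm; exact: b_quasi_coercive. Qed.

Lemma lions_wellposed F (x : H) : exists u d U, sol b F u d U /\ vnorm (U 0 - x) = 0.
Proof.
have [C CE] := emb_operator.
have [F1 F1E] := L2_scale F (C1_exp tau (- om)).
have [u1 [d1 [U1 [s1 U1x]]]] :=
  coercive_exists M'0 al0 b'Pl b'Pr b'_bounded b'_measurable b'_coercive F1 x.
have [v vE] := L2_scale u1 (C1_exp tau om).
have eE t : expR (om * t) * expR (- om * t) = 1 by rewrite -expRD mulNr subrr expR0.
have F2E w : ae_on tau (fun t => dot ((F + om *: C v) t) w =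
    expR (om * t) * dot (F1 t) w + om * expR (om * t) * dot (j (u1 t)) (j w)).
  apply: ae_onS (CE v w) => t _ h.
  rewrite L2DE L2ZE dotDl dotZl h F1E vE dotZl (embZ jP) dotZl.
  by rewrite (mulrA _ _ (dot (F t) w)) eE mul1r mulrA.
have [d s] := sol_mul (C1_exp tau om) b'Pl s1 F2E vE.
exists v, d, (fun t => expR (om * t) *: U1 t); split; last first.
  by rewrite mulr0 expR0 scale1r.
have h w : ae_on tau (fun t => dot (F t) w = dot ((F + om *: C v) t) w + - om * dot (j (v t)) (j w)).
  by apply: ae_onS (CE v w) => t _ h; rewrite L2DE L2ZE dotDl dotZl h; ring.
by apply: sol_eq (sol_shift s h) => t tD y z; rewrite /b'; ring.
Qed.

Lemma lions_null u d U : sol b 0 u d U -> vnorm (U 0) = 0 ->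
  ae_on tau (fun t => vnorm (u t) = 0).
Proof.
move=> s U0; have [C CE] := emb_operator.
have [v vE] := L2_scale u (C1_exp tau (- om)).
have FE w : ae_on tau (fun t => dot ((- om *: C v) t) w =
    expR (- om * t) * dot ((0 : L2V) t) w + - om * expR (- om * t) * dot (j (u t)) (j w)).
  apply: ae_onS (CE v w) => t _ h.
  rewrite L2ZE dotZl h vE (embZ jP) dotZl -[(0 : L2V) t]/(0 : V) dot0l; ring.
have [d' s'] := sol_mul (C1_exp tau (- om)) bPl s FE vE.
have h w : ae_on tau (fun t => dot ((0 : L2V) t) w = dot ((- om *: C v) t) w + om * dot (j (v t)) (j w)).
  by apply: ae_onS (CE v w) => t _ h; rewrite L2ZE dotZl h -[(0 : L2V) t]/(0 : V) dot0l; ring.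
have v0 : vnorm v = 0.
  apply: (coercive_unique M'0 al0 b'Pl b'Pr b'_bounded b'_measurable b'_coercive (sol_shift s' h)).
  by rewrite mulr0 expR0 scale1r.
apply: ae_onS (L2norm_eq0 v0) => t _; rewrite vE vnormZ => /eqP.
by rewrite mulf_eq0 normr_eq0 gt_eqF ?expR_gt0// => /eqP.
Qed.

Lemma sol_null_trace F u d U : sol b F u d U -> ae_on tau (fun t => vnorm (u t) = 0) ->
  forall t, t \in `[0, tau] -> vnorm (U t) = 0.
Proof.
move=> [_ _ cU Uu] u0; apply: hcont_ae0 cU _.
apply: ae_onS2 u0 Uu => t _ h1 h2; apply/le_anti; rewrite vnorm_ge0 andbT.
have := vnormD (U t - j (u t)) (j (u t)); rewrite subrK h2.
by have := j_bounded (u t); rewrite h1; lra.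
Qed.

Lemma sol_unique F u u' d d' U U' : sol b F u d U -> sol b F u' d' U' ->
  vnorm (U 0 - U' 0) = 0 ->
  ae_on tau (fun t => vnorm (u t - u' t) = 0) /\
  forall t, t \in `[0, tau] -> vnorm (U t - U' t) = 0.
Proof.
move=> s s' U0; have := sol_sub bPl s s'; rewrite subrr => s0.
have u0 := lions_null s0 U0; split=> //; exact: sol_null_trace s0 u0.
Qed.

Section propagator.
Variables (Phi T : H -> H).
Hypothesis H_definite : forall x : H, vnorm x = 0 -> x = 0.
Hypothesis PhiB : forall x y, Phi (x - y) = Phi x - Phi y.
Hypothesis TP : forall x, exists v d U, [/\ sol b 0 v d U, U 0 = x & U tau = T x].

Let zero_in : 0 \in `[0, tau]. Proof. by rewrite in_itv/= lexx ltW. Qed.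
Let tau_in : tau \in `[0, tau]. Proof. by rewrite in_itv/= lexx ltW. Qed.

Lemma propagator_sol u d U : sol b 0 u d U -> T (U 0) = U tau.
Proof.
move=> s; have [v [d' [U' [s' U'0 <-]]]] := TP (U 0).
have [|_ /(_ _ tau_in)] := sol_unique s' s; first by rewrite U'0 subrr vnorm0.
by move=> /H_definite/eqP; rewrite subr_eq0 => /eqP.
Qed.

Lemma propagatorB x y : T (x - y) = T x - T y.
Proof.
have [u [d [U [s U0 Ut]]]] := TP x; have [u' [d' [U' [s' U0' Ut']]]] := TP y.
have := sol_sub bPl s s'; rewrite subr0 => /propagator_sol.
by rewrite U0 U0' Ut Ut'.
Qed.

Lemma boundary_wellposed : bijective (fun x => x - Phi (T x)) <->
  forall F, (exists u d U, sol b F u d U /\ U 0 = Phi (U tau)) /\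
    forall u u' d d' U U', sol b F u d U -> U 0 = Phi (U tau) ->
      sol b F u' d' U' -> U' 0 = Phi (U' tau) ->
      ae_on tau (fun t => vnorm (u t - u' t) = 0).
Proof.
pose S x := x - Phi (T x).
have SB x y : S (x - y) = S x - S y by rewrite /S propagatorB PhiB subrACA.
have S0 : S 0 = 0 by have := SB 0 0; rewrite !subrr.
have Phi0 : Phi 0 = 0 by have := PhiB 0 0; rewrite !subrr.
split=> [[g gK Kg] F|wp].
  split; last first.
    move=> u u' d d' U U' s U0 s' U0'; apply: (sol_unique s s' _).1.
    have := sol_sub bPl s s'; rewrite subrr => /propagator_sol TU.
    suff -> : U 0 - U' 0 = 0 by rewrite vnorm0.
    by apply: (can_inj gK); rewrite -[LHS]/(S _) -[RHS]/(S 0) S0 /S TU PhiB -U0 -U0' subrr.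
  have [v [d [U [s /H_definite]]]] := lions_wellposed F 0; rewrite subr0 => U0.
  have [w [d' [W [s' W0 Wt]]]] := TP (g (- Phi (U tau))).
  exists (v - w), (d - d'), (fun t => U t - W t); split.
    by have := sol_sub bPl s s'; rewrite subr0.
  have := Kg (- Phi (U tau)); rewrite -Wt -W0 PhiB U0 sub0r => /eqP.
  by rewrite subr_eq => /eqP ->; rewrite opprD opprK.
have Sinj : injective S.
  move=> x y /eqP; rewrite -subr_eq0 -SB => /eqP; rewrite /S.
  have [u [d [U [s U0 <-]]]] := TP (x - y) => /eqP; rewrite subr_eq0 -U0 => /eqP U0'.
  have := sol_sub bPl s s; rewrite subrr => s0.
  have u0 := (wp 0).2 _ _ _ _ _ _ s U0' s0.
  rewrite !subrr in u0; have {u0} := u0 (esym Phi0).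
  under eq_fun do rewrite subr0.
  move=> /(sol_null_trace s)/(_ 0 zero_in)/H_definite; rewrite U0 => /eqP.
  by rewrite subr_eq0 => /eqP.
have Ssurj y : exists x, S x = y.
  have [w [d [W [s W0 _]]]] := TP y.
  have [F [v [d' sv]]] := sol_ramp bPl s.
  have [[u [du [U [su U0]]]] _] := wp F.
  have := sol_sub bPl sv su; rewrite subrr => /propagator_sol.
  rewrite mulr0 add0r scale1r mulNr mulVf ?gt_eqF// addNr scale0r W0 sub0r => TQ.
  exists (y - U 0); rewrite /S TQ -sub0r PhiB Phi0 sub0r opprK -U0.
  by rewrite subrK.
have [g gS] := choice Ssurj; exists g => // x; exact: Sinj.
Qed.

End propagator.

End quasi_coercive.

End solutions.

(** * Reduction to real Hilbert spaces *)

Section lebesgue_measurability.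
Context {R : realType}.
Local Notation mR := (measurableTypeR R).
Local Notation mu := (@lebesgue_measure R).

(* A function measurable for the completed sigma-algebra is Borel off the union
   of the null sets attached to the sublevel sets at rational levels. *)
Lemma lebesgue_measurable_borel (D : set mR) (g : R -> R) : measurable D ->
  lebesgue_measurable_fun D g ->
  exists N : set mR, [/\ measurable N, mu N = 0 & measurable_fun (D `\` N) g].
Proof.
move=> mD mg; pose L (y : R) : set mR := [set t | g t < y].
pose l (n : nat) : R := ratr (odflt 0 (unpickle n) : rat).
have lE (q : rat) : l (pickle q) = ratr q by rewrite /l pickleK.
have cE : (completed_algebra_gen mu).-sigma.-measurable = completed_algebra_gen mu.
  exact: g_sigma_completed_algebra_genE.
have h n : exists AN : set mR * set mR, [/\ measurable AN.1, measurable AN.2,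
    mu AN.2 = 0 & (D `&` L (l n)) `\` AN.2 = AN.1 `\` AN.2].
  have mDl : (completed_algebra_gen mu).-sigma.-measurable D.
    rewrite cE; exists D => //; exists set0; last by rewrite setU0.
    exact: negligible_set0.
  have : (completed_algebra_gen mu).-sigma.-measurable (D `&` g @^-1` `]-oo, l n[%classic).
    exact: mg mDl _ (measurable_itv _).
  rewrite cE => -[A mA [N [N' [mN' N'0 NN']] E]].
  exists (A, N'); split=> //=; rewrite (_ : D `&` L _ = A `|` N).
    by apply/seteqP; split=> t /= => [[[|/NN']]|[]] //; split=> //; left.
  by rewrite E; apply/seteqP; split=> t /=; rewrite in_itv.
have [f fP] := choice h; pose N := \bigcup_n (f n).2.
have mN : measurable N by apply: bigcupT_measurable => n; have [] := fP n.
have N0 : mu N = 0.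
  apply/negligibleP => //; apply: negligible_bigcup => n.
  by have [_ m2 n2 _] := fP n; exact/negligibleP.
exists N; split=> // mDN.
apply: (measurability _ (RGenInftyO.measurableE R)) => // _ /= -[_ [y ->] <-].
have -> : (D `\` N) `&` g @^-1` `]-oo, y[ =
    \bigcup_(n in [set n | l n < y]) ((f n).1 `\` N).
  apply/seteqP; split=> t /=.
    rewrite in_itv/= => -[[Dt Nt] gy]; have [q /[!in_itv]/= /andP[gq qy]] := rat_in_itvoo gy.
    exists (pickle q); rewrite /= ?lE//; split=> //; have [_ _ _ E] := fP (pickle q).
    have : ((D `&` L (l (pickle q))) `\` (f (pickle q)).2) t.
      by split; [rewrite lE|move=> fq; apply: Nt; exists (pickle q)].
    by rewrite E => -[].
  move=> [n /= ny [fn Nt]]; have [_ _ _ E] := fP n.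
  have : ((f n).1 `\` (f n).2) t by split=> // fn2; apply: Nt; exists n.
  rewrite -E => -[[Dt gn] _]; split=> //; rewrite in_itv/=.
  exact: lt_trans gn ny.
apply: bigcup_measurable => n _; apply: measurableD => //.
by have [] := fP n.
Qed.

End lebesgue_measurability.

Section scalar_parts.
Context {R : realType} {k : scalar_kind}.
Local Notation K := (scalar_field R k).

Lemma of_real_lt (x y : R) : (of_real x < of_real y :> K) = (x < y).
Proof. by rewrite !lt_neqAle of_real_le fmorph_eq. Qed.

Lemma of_real_gt0 (x : R) : (0 < of_real x :> K) = (0 < x).
Proof. by rewrite -(rmorph0 of_real) of_real_lt. Qed.

Lemma sRe_gt0 (x : K) : 0 < x -> 0 < sRe x.
Proof. by move=> x0; rewrite -of_real_gt0 (of_real_sRe (ltW x0)). Qed.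

Lemma sconj_of_real (x : R) : sconj (of_real x : K) = of_real x.
Proof. by case: k => //; exact: conjc_real. Qed.

Lemma sReD (x y : K) : sRe (x + y) = sRe x + sRe y.
Proof. by case: k x y => //= -[a b] [c d]. Qed.

Lemma sReN (x : K) : sRe (- x) = - sRe x.
Proof. by case: k x => //= -[a b]. Qed.

Lemma sImN (x : K) : sIm (- x) = - sIm x.
Proof. by case: k x => [_|[a b]] //=; rewrite oppr0. Qed.

Lemma sReZ (c : R) (x : K) : sRe (of_real c * x) = c * sRe x.
Proof. by case: k x => //= -[a b] /=; rewrite mul0r subr0. Qed.

Lemma sImZ (c : R) (x : K) : sIm (of_real c * x) = c * sIm x.
Proof. by case: k x => [_|[a b]] /=; rewrite ?mulr0// mul0r addr0. Qed.

Lemma sRe_conj (x : K) : sRe (sconj x) = sRe x.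
Proof. by case: k x => // -[a b]. Qed.

Lemma sIm_unit (x : K) : sRe (sconj (of_parts 0 1 : K) * x) = sIm x.
Proof. by case: k x => [x|[a b]] /=; rewrite mul0r// mulNr mul1r opprK add0r. Qed.

Lemma scalar_ext (x y : K) : sRe x = sRe y -> sIm x = sIm y -> x = y.
Proof. by case: k x y => //= -[a b] [c d] /= -> ->. Qed.

Lemma normr_sRe (x : K) : `|sRe x| <= rnorm x.
Proof.
case: k x => [x|[a b]]; first by rewrite /rnorm /=.
by rewrite /rnorm /= -[leRHS]/(Num.sqrt (a ^+ 2 + b ^+ 2)) -sqrtr_sqr ler_wsqrtr// lerDl sqr_ge0.
Qed.

Lemma sRe_scalar_integral tau (g : R -> K) :
  sRe (scalar_integral tau g) = intg tau (fun t => sRe (g t)).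
Proof. by case: k g. Qed.

Lemma sIm_scalar_integral tau (g : R -> K) :
  sIm (scalar_integral tau g) = intg tau (fun t => sIm (g t)).
Proof. by case: k g => //= g; rewrite intg0. Qed.

End scalar_parts.

Section realification.
Context {R : realType} {k : scalar_kind} (W : lmodType (scalar_field R k)).

Definition realify : Type := W.

HB.instance Definition _ := GRing.Zmodule.copy realify W.

Definition real_scale (c : R) (x : realify) : realify := (of_real c : scalar_field R k) *: (x : W).

Fact real_scaleA c d x : real_scale c (real_scale d x) = real_scale (c * d) x.
Proof. by rewrite /real_scale scalerA rmorphM. Qed.

Fact real_scale1 : left_id 1 real_scale.
Proof. by move=> x; rewrite /real_scale rmorph1 scale1r. Qed.

Fact real_scaleDr : right_distributive real_scale +%R.
Proof. by move=> c x y; exact: scalerDr. Qed.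

Fact real_scaleDl x : {morph real_scale^~ x : c d / c + d}.
Proof. by move=> c d; rewrite /real_scale rmorphD; exact: scalerDl. Qed.

HB.instance Definition _ := GRing.Zmodule_isLmodule.Build R realify
  real_scaleA real_scale1 real_scaleDr real_scaleDl.

Lemma real_scaleE c (x : realify) : c *: x = (of_real c : scalar_field R k) *: (x : W).
Proof. by []. Qed.

End realification.

Section real_hilbert.
Context {R : realType} {k : scalar_kind}.
Local Notation K := (scalar_field R k).
Context {W : completeNormedModType K} (ip : {dot W for @sconj R k}).
Hypothesis ipE : hilbert_norm ip.

Lemma ipC x y : ip x y = sconj (ip y x).
Proof. by rewrite hermC expr0 mul1r. Qed.

Let rdot (x y : realify W) : R := sRe (ip x y).

Let rdotC x y : rdot x y = rdot y x.
Proof. by rewrite /rdot ipC sRe_conj. Qed.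

Let rdotPl a x y z : rdot (a *: x + y) z = a * rdot x z + rdot y z.
Proof.
rewrite /rdot real_scaleE [ip _ z](_ : _ = of_real a * ip x z + ip y z); last first.
  by rewrite linearDl linearZl_LR.
by rewrite sReD sReZ.
Qed.

Let sRe_sqr (x : W) : sRe (ip x x) = rnorm x ^+ 2.
Proof. by rewrite -ipE -of_real_rnorm -rmorphXn sRe_of_real. Qed.

Let rdot_ge0 x : 0 <= rdot x x.
Proof. by rewrite /rdot sRe_sqr sqr_ge0. Qed.

Definition real_prehilbert := PreHilbert rdotC rdotPl rdot_ge0.

Lemma vnormE (x : real_prehilbert) : vnorm x = rnorm (x : W).
Proof. by rewrite /vnorm -[dot x x]/(sRe (ip x x)) sRe_sqr sqrtr_sqr ger0_norm ?rnorm_ge0. Qed.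

Lemma cvg_vcvg (u : nat -> W) (x : W) :
  u n @[n --> \oo] --> x <-> @vcvg R real_prehilbert u x.
Proof.
split=> [/cvgrPdist_le h|/vcvgP h].
  apply/vcvgP => e e0; have [|N _ hN] := h (of_real e).
    by rewrite lt_neqAle -(rmorph0 of_real) of_real_le ltW// andbT fmorph_eq lt_eqF.
  exists N => n /hN; rewrite vnormE -[_ - x]/(u n - x : W) distrC.
  by rewrite -of_real_rnorm of_real_le.
apply/cvgrPdist_le => e e0; have ee := of_real_sRe (ltW e0).
have [N hN] := h (sRe e) (sRe_gt0 e0).
exists N => // n /hN; rewrite vnormE -[_ - x]/(u n - x : W) -(@of_real_le R k).
by rewrite of_real_rnorm ee distrC.
Qed.

Let real_complete (u : nat -> real_prehilbert) :
  (forall e : R, 0 < e -> exists N, forall n m, (N <= n)%N -> (N <= m)%N ->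
    vnorm (u n - u m) <= e) -> exists x, vcvg u x.
Proof.
move=> h; pose v : nat -> W := u.
suff /cauchy_cvg/cvg_ex[x vx] : cauchy (v @ \oo) by exists x; apply/cvg_vcvg.
apply: cauchy_exP => e e0; have ee := of_real_sRe (ltW e0).
have e1 := sRe_gt0 e0.
have [N hN] := h (sRe e / 2) ltac:(by rewrite divr_gt0).
exists (v N); exists N => // n Nn; rewrite -ball_normE /=.
have := hN N n (leqnn N) Nn; rewrite vnormE -[_ - u n]/(v N - v n).
rewrite -of_real_rnorm -[X in _ < X]ee of_real_lt.
move=> h'; apply: (le_lt_trans h'); move: (sRe e) e1 => s s0; lra.
Qed.

Definition real_hilbert := Hilbert real_complete.

(* The imaginary part of f w is the real part of f (i w). *)
Lemma ip_ext (x : W) (f : W -> K) : antilinear f ->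
  (forall w, sRe (ip x w) = sRe (f w)) -> forall w, ip x w = f w.
Proof.
move=> fl h w; apply: scalar_ext => //.
have fZ c : f (c *: w) = sconj c * f w.
  have f0 : f 0 = 0.
    have := fl 1 0 0; rewrite scaler0 addr0 rmorph1 mul1r => /eqP.
    by rewrite -subr_eq0 opprD addNKr oppr_eq0 => /eqP.
  by have := fl c w 0; rewrite !addr0 f0 addr0.
by have := h (of_parts 0 1 *: w); rewrite fZ linearZr_LR !sIm_unit.
Qed.

End real_hilbert.

Arguments vnormE {R k W ip} ipE x.
Arguments cvg_vcvg {R k W ip} ipE u x.
Arguments ip_ext {R k W ip x f}.

Section square_integrability.
Context {R : realType} {k : scalar_kind} (tau : R).
Local Notation K := (scalar_field R k).
Local Notation mu := (@lebesgue_measure R).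

Lemma square_integrableP (W : completeNormedModType K) (ip : {dot W for @sconj R k})
    (ipE : hilbert_norm ip) (u : R -> W) :
  square_integrable tau u <-> @sqi R tau (real_prehilbert ipE) u.
Proof.
pose X := real_prehilbert ipE; pose f t := @dot R X (u t) (u t).
have E : (\int[mu]_(t in `[0%R, tau]) (rnorm (u t) ^+ 2)%:E =
    \int[mu]_(t in `[0%R, tau]) `|(EFin \o f) t|)%E.
  by apply: eq_integral => t _; rewrite /= ger0_norm ?dot_ge0// -(vnormE ipE) sqr_vnorm.
have mE : strongly_measurable tau u <-> @smeas R tau X u.
  by split=> -[s ss su]; exists s => // t tD; apply/(cvg_vcvg ipE); exact: su.
rewrite /square_integrable E; split=> -[/mE mu' iu]; split=> //.
- by apply/integrableP; split=> //; apply/measurable_EFinP; exact: measurable_dot.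
- by have /integrableP[] := iu.
Qed.

Lemma square_integrable_isometry (W W' : normedModType K) (g : W -> W') (u : R -> W) :
  (forall x y, rnorm (g x - g y) = rnorm (x - y)) -> (forall x, rnorm (g x) = rnorm x) ->
  square_integrable tau u -> square_integrable tau (g \o u).
Proof.
move=> gB gn [[s ss su] iu]; split; last by under eq_integral do rewrite /= gn.
exists (fun n => g \o s n) => [n|t tD]; first exact: (simple_map1 g (ss n)).
apply/cvgrPdist_le => e e0; have /cvgrPdist_le/(_ e e0) := su t tD.
by apply: filterS => n; rewrite -!of_real_rnorm /= gB.
Qed.

End square_integrability.

Section antidual_representation.
Context {R : realType} {k : scalar_kind}.
Local Notation K := (scalar_field R k).
Context {V : completeNormedModType K} (ip : {dot V for @sconj R k}).
Hypothesis ipE : hilbert_norm ip.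

Fact ip_antidual v : (ip v : V -> K^o) \in @antidual_pred R k V.
Proof.
rewrite inE; split; first by move=> c x y; rewrite linearDr linearZr_LR.
by exists (rnorm v) => w; exact: dot_cauchy_schwarz.
Qed.

Definition ip_dual v : antidual V := Antidual (ip_antidual v).

Lemma ip_inj x y : (forall w, ip x w = ip y w) -> x = y.
Proof.
move=> h; apply/eqP; rewrite -subr_eq0; apply/eqP/normr0_eq0/eqP.
rewrite -sqrf_eq0 ipE linearBl subr_eq0; apply/eqP; exact: h.
Qed.

Lemma riesz_antidual (F : antidual V) : exists v, ip_dual v = F.
Proof.
have [fl [M fM]] := antidualP F.
have [|w|v vF] := @riesz R (real_hilbert ipE) (fun w => sRe (F w)) `|M|.
- move=> a x y; rewrite real_scaleE -sReZ -sReD; congr sRe.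
  by rewrite fl sconj_of_real.
- apply: (le_trans (ler_norm _)); apply: (le_trans (normr_sRe _)).
  apply: (le_trans (fM w)); rewrite vnormE ler_wpM2r ?rnorm_ge0//.
  exact: ler_norm.
exists v; apply/antidual_eqP => w.
by rewrite -(ip_ext fl vF).
Qed.

Definition dual_ip (F : antidual V) : V := sval (cid (riesz_antidual F)).

Lemma dual_ipK : cancel dual_ip ip_dual.
Proof. by move=> F; rewrite /dual_ip; case: cid. Qed.

Lemma ip_dualK : cancel ip_dual dual_ip.
Proof.
move=> v; apply: ip_inj => w.
by have /antidual_eqP/(_ w) := dual_ipK (ip_dual v).
Qed.

Lemma dual_ipE (F : antidual V) w : F w = ip (dual_ip F) w.
Proof. by rewrite -{1}(dual_ipK F). Qed.

Lemma rnorm_ip_dual v : rnorm (ip_dual v) = rnorm v.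
Proof.
rewrite rnorm_antidual; apply/le_anti/andP; split.
  by apply: antidual_norm_le => [|w]; rewrite ?rnorm_ge0// dot_cauchy_schwarz.
have [->|v0] := eqVneq (rnorm v) 0; first exact: antidual_norm_ge0.
have vgt0 : 0 < rnorm v by rewrite lt_neqAle eq_sym v0 rnorm_ge0.
rewrite -(ler_pM2r vgt0); apply: le_trans (le_antidual_norm _ v).
by rewrite -[leRHS]/(rnorm (ip v v)) -ipE expr2 rnormM /rnorm normr_id.
Qed.

Lemma ip_dualB x y : ip_dual (x - y) = ip_dual x - ip_dual y.
Proof. by apply/antidual_eqP => w; rewrite -[LHS]/(ip (x - y) w) linearBl. Qed.

Lemma dual_ipB F G : dual_ip (F - G) = dual_ip F - dual_ip G.
Proof. by apply: (can_inj ip_dualK); rewrite ip_dualB !dual_ipK. Qed.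

Lemma rnorm_dual_ip F : rnorm (dual_ip F) = rnorm F.
Proof. by rewrite -rnorm_ip_dual dual_ipK. Qed.

Lemma square_integrable_dual tau (f : R -> antidual V) :
  square_integrable tau f <-> square_integrable tau (dual_ip \o f).
Proof.
split=> h; last rewrite (_ : f = ip_dual \o (dual_ip \o f)); last 2 first.
- apply: square_integrable_isometry h => [x y|x]; last exact: rnorm_ip_dual.
  by rewrite -ip_dualB rnorm_ip_dual.
- by apply/funext => t /=; rewrite dual_ipK.
apply: square_integrable_isometry h => [x y|x]; last exact: rnorm_dual_ip.
by rewrite -dual_ipB rnorm_dual_ip.
Qed.

End antidual_representation.

Section traces.
Context {R : realType} {k : scalar_kind} (tau : R).
Local Notation K := (scalar_field R k).
Context {H : completeNormedModType K} (ip : {dot H for @sconj R k}).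
Hypothesis ipE : hilbert_norm ip.

Lemma within_continuousP (U : R -> H) :
  {within `[0, tau], continuous U} <-> @hcont R tau (real_hilbert ipE) U.
Proof.
split=> [/subspace_continuousP h t tD e e0|h].
  have /cvgrPdist_le/(_ (of_real e)) := h t tD; rewrite of_real_gt0 => /(_ e0).
  move=> /nbhs_ballP[d /= d0 hd]; exists (d / 2); first by rewrite divr_gt0.
  move=> s sD sd; rewrite vnormE -[_ - U t]/(U s - U t) -(@of_real_le R k) of_real_rnorm.
  rewrite distrC; apply: hd => //; rewrite -ball_normE /= distrC.
  by apply: (le_lt_trans sd); rewrite ltr_pdivrMr// ltr_pMr// ltr1n.
apply/subspace_continuousP => t tD; apply/cvgrPdist_le => e e0.
have [d d0 hd] := h t tD _ (sRe_gt0 e0).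
apply/nbhs_ballP; exists d => // s; rewrite -ball_normE /= => /ltW sd sD.
rewrite distrC -(of_real_sRe (ltW e0)) -of_real_rnorm of_real_le.
by have := hd s sD; rewrite distrC sd => /(_ isT); rewrite vnormE.
Qed.

End traces.

Section problem_translation.
Context {R : realType} {k : scalar_kind}.
Local Notation K := (scalar_field R k).
Context {V H : completeNormedModType K}.
Variables (ipV : {dot V for @sconj R k}) (ipH : {dot H for @sconj R k}).
Hypotheses (hV : hilbert_norm ipV) (hH : hilbert_norm ipH).
Variables (j : {linear V -> H}) (hj : continuous_dense_embedding j).
Variables (tau : R) (a : R -> V -> V -> K) (ha : quasi_coercive_form j tau a).
Local Notation X := (real_hilbert hV).
Local Notation Y := (real_hilbert hH).
Local Notation L2X := (L2hilbert tau X).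
Local Notation mR := (measurableTypeR R).
Local Notation mu := (@lebesgue_measure R).
Local Notation D := ([set` `[0, tau]] : set mR).

Definition real_emb (x : X) : Y := j x.

Definition real_form (t : R) (x y : X) : R := sRe (a t x y).

Lemma real_embP c x y : real_emb (c *: x + y) = c *: real_emb x + real_emb y.
Proof. exact: linearP. Qed.

Lemma real_emb_bounded : exists cj, forall v : X, vnorm (real_emb v) <= cj * vnorm v.
Proof.
have [_ j_cont _] := hj.
have /linear_boundedP/pinfty_ex_gt0[M M0 jM] := continuous_linear_bounded 0 (j_cont 0).
exists (sRe M) => v; rewrite !vnormE -(@of_real_le R k) rmorphM/= !of_real_rnorm.
by rewrite (of_real_sRe (ltW M0)).
Qed.

Lemma real_emb_dense (y : Y) : (forall v, dot y (real_emb v) = 0) -> vnorm y = 0.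
Proof.
move=> orth; have [_ _ dj] := hj; have y0 := vnorm_ge0 y.
apply/eqP; rewrite eq_le y0 andbT; apply/ler_addgt0Pl => e e0; rewrite addr0.
have [||z [yz [v _ vz]]] := dj (ball (y : H) (of_real e : K)) _ _.
- by exists (y : H); apply: ballxx; rewrite of_real_gt0.
- by apply: ball_open; rewrite of_real_gt0.
have yv : vnorm (y - real_emb v) <= e.
  move: yz; rewrite -vz -ball_normE /= -of_real_rnorm of_real_lt => /ltW.
  by rewrite (vnormE hH).
have := dot_le y (y - real_emb v); rewrite dotBr orth subr0 -sqr_vnorm expr2.
move: yv y0; move: (vnorm y) (vnorm _) => p q h1 h2 h3.
rewrite leNgt; apply/negP => h4; nra.
Qed.

Lemma real_formPl t : t \in `[0, tau] -> forall c x y z,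
  real_form t (c *: x + y) z = c * real_form t x z + real_form t y z.
Proof.
move=> tD c x y z; have [al _] := form_sesquilinear ha tD.
by rewrite /real_form -sReZ -sReD; congr sRe; exact: al.
Qed.

Lemma real_formPr t : t \in `[0, tau] -> forall c z x y,
  real_form t z (c *: x + y) = c * real_form t z x + real_form t z y.
Proof.
move=> tD c z x y; have [_ ar] := form_sesquilinear ha tD.
rewrite /real_form -sReZ -sReD -(sconj_of_real c); congr sRe; exact: ar.
Qed.

Lemma real_form_measurable x y : exists N : set mR,
  [/\ measurable N, mu N = 0 & measurable_fun (D `\` N) (fun t => real_form t x y)].
Proof.
apply: lebesgue_measurable_borel; first exact: measurable_dom.
exact: (form_measurable ha x y).1.
Qed.

Lemma dual_embB x y : emb ipH j (x - y) = emb ipH j x - emb ipH j y.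
Proof.
apply/antidual_eqP => w; rewrite -[RHS]/(emb ipH j x w - emb ipH j y w).
rewrite !(embE _ _ hH hj); exact: linearBl.
Qed.

Lemma square_integrable_emb (u : R -> V) : square_integrable tau u ->
  square_integrable tau (fun t => emb ipH j (j (u t))).
Proof.
move=> /(square_integrableP tau hV) su; apply/(square_integrable_dual hV)/(square_integrableP tau hV).
have [cj jc] := real_emb_bounded.
pose g (x : X) : X := dual_ip hV (emb ipH j (j x)).
have gB x y : g (x - y) = g x - g y by rewrite /g -dual_ipB -dual_embB linearB.
have gle x : vnorm (g x) <= cj ^+ 2 * vnorm x.
  rewrite vnormE rnorm_dual_ip rnorm_antidual.
  apply: antidual_norm_le => [|w].
    by rewrite mulr_ge0 ?sqr_ge0 ?vnorm_ge0.
  rewrite (embE _ _ hH hj); apply: (le_trans (dot_cauchy_schwarz _ _ hH)).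
  have := ler_pM (vnorm_ge0 _) (vnorm_ge0 _) (jc x) (jc w); rewrite !vnormE mulrACA.
  by rewrite -expr2 mulrA.
pose v : R -> X := u; change (@sqi R tau X (fun t => g (v t))).
apply: (@sqi_dom _ _ _ _ (fun t => (cj ^+ 2) ^+ 2 * dot (v t) (v t))).
- apply: smeas1 su.1 => x_ x xx; apply: (@vcvg_le _ _ _ _ (fun n => cj ^+ 2 * vnorm (x_ n - x))).
    by rewrite -[X in _ --> X](mulr0 (cj ^+ 2)); apply: cvgM => //; exact: cvg_cst.
  by move=> n; rewrite -gB.
- exact: integZ su.2.
move=> t _; rewrite -!sqr_vnorm -exprMn.
by rewrite ler_sqr ?nnegrE ?vnorm_ge0// mulr_ge0 ?sqr_ge0 ?vnorm_ge0.
Qed.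

Lemma antidual_sIm (G : antidual V) w : sIm (G w) = sRe (G (of_parts 0 1 *: w)).
Proof. by rewrite antidual_ofZ sIm_unit. Qed.

Lemma sol_solution (F : L2X) (f : R -> antidual V) (u : R -> V) (U : R -> H) :
  (forall t, F t = dual_ip hV (f t)) ->
  [/\ MR ipH j tau u, evolution_equation ipH j tau a f u &
      continuous_representative j tau u U] <->
  exists (v d : L2X), v = u :> (R -> V) /\ sol real_emb real_form F v d U.
Proof.
move=> FE; split.
  move=> [[su _] [du [sdu wd eqn]] [cU Uu]].
  have [v vE] := L2_mk ((square_integrableP tau hV u).1 su).
  have [d dE] := L2_mk ((square_integrableP tau hV _).1 ((square_integrable_dual hV tau _).1 sdu)).
  exists v, d; split=> //; split.
  - move=> phi tphi w; have := congr1 sRe (wd phi tphi w).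
    rewrite sReN !sRe_scalar_integral => h.
    transitivity (intg tau (fun t => sRe (of_real (derive1 phi t) * emb ipH j (j (u t)) w))).
      by apply: eq_intg => t _; rewrite sReZ (embE _ _ hH hj) vE.
    rewrite h; congr (- _); apply: eq_intg => t _.
    by rewrite sReZ dE (dual_ipE hV).
  - move=> w; apply: ae_onS (eqn w) => t tD /(congr1 sRe).
    rewrite antidualDE (opAE _ _ ha tD) sReD (dual_ipE hV) (dual_ipE hV (f t)).
    by rewrite dE vE FE.
  - exact/within_continuousP.
  - by apply: ae_onS Uu => t tD; rewrite vE => ->; rewrite subrr vnorm0.
move=> [v [d [<- [wd eqn cU Uu]]]].
have sv : square_integrable tau (v : R -> V) by apply/(square_integrableP tau hV); exact: L2P.
pose du t := ip_dual hV (d t).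
have sdu : square_integrable tau du.
  apply/(square_integrable_dual hV)/(square_integrableP tau hV).
  by apply: sqi_eq (L2P d) => t _; rewrite /du /= ip_dualK.
have wdu : weak_derivative tau (fun t => emb ipH j (j (v t))) du.
  move=> phi tphi w.
  have h z : intg tau (fun t => sRe (of_real (derive1 phi t) * emb ipH j (j (v t)) z)) =
      - intg tau (fun t => sRe (of_real (phi t) * du t z)).
    transitivity (intg tau (fun t => derive1 phi t * @dot R Y (j (v t)) (j z))).
      by apply: eq_intg => t _; rewrite sReZ (embE _ _ hH hj).
    by rewrite (wd phi tphi z); congr (- _); apply: eq_intg => t _; rewrite sReZ.
  apply: scalar_ext; rewrite ?sReN ?sImN ?sRe_scalar_integral ?sIm_scalar_integral; first exact: h.
  have hI (c : R -> R) (G : R -> antidual V) :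
      intg tau (fun t => sIm (of_real (c t) * G t w : K)) =
      intg tau (fun t => sRe (of_real (c t) * G t (of_parts 0 1 *: w))).
    by apply: eq_intg => t _; rewrite sImZ sReZ antidual_sIm.
  by rewrite !hI h.
have se : square_integrable tau (fun t => emb ipH j (j (v t))) := square_integrable_emb sv.
split; last 2 first.
- exists du; split=> // w.
  apply: ae_onS2 (eqn w) (eqn (of_parts 0 1 *: w)) => t tD.
  have h z : dot (d t) z + real_form t (v t) z = dot (F t) z ->
      sRe ((du t + opA a t (v t)) z) = sRe (f t z).
    by rewrite antidualDE (opAE _ _ ha tD) sReD (dual_ipE hV (f t)) FE.
  move=> /h h1 /h h2; apply: scalar_ext => //.
  by rewrite antidual_sIm h2 -antidual_sIm.
- split; first exact/(within_continuousP _ hH).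
  apply: ae_onS Uu => t _; rewrite vnormE => /rnorm_eq0/eqP.
  by rewrite subr_eq0 => /eqP.
by split=> //; split=> //; exists du.
Qed.

End problem_translation.

Theorem theorem5p5 (R : realType) (k : scalar_kind)
    (V H : completeNormedModType (scalar_field R k))
    (ipV : {dot V for @sconj R k}) (ipH : {dot H for @sconj R k})
    (hV : hilbert_norm ipV) (hH : hilbert_norm ipH)
    (j : {linear V -> H}) (hj : continuous_dense_embedding j)
    (tau : R) (htau : 0 < tau)
    (a : R -> V -> V -> scalar_field R k) (ha : quasi_coercive_form j tau a)
    (Phi : {linear H -> H}) :
  well_posed ipH j tau a Phi <->
  bijective (fun x : H => x - Phi (propagator ipH j tau a x)).
Proof.
have [M M0 aM] := form_bounded ha.
have [om [al [al0 coer]]] := form_quasi_coercive ha.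
have [cj jc] := @real_emb_bounded R k V H ipV ipH hV hH j hj.
pose X := real_hilbert hV; pose Y := real_hilbert hH.
pose b : R -> X -> X -> R := real_form a; pose e : X -> Y := real_emb hH j.
have Y_definite (x : Y) : vnorm x = 0 -> x = 0 by rewrite vnormE; exact: rnorm_eq0.
have b_bounded t : t \in `[0, tau] -> forall x y : X, `|b t x y| <= M * vnorm x * vnorm y.
  by move=> tD x y; rewrite !vnormE; apply: (le_trans (normr_sRe _)); exact: aM.
have b_coercive t : t \in `[0, tau] -> forall x : X,
    al * vnorm x ^+ 2 <= b t x x + om * vnorm (e x) ^+ 2.
  by move=> tD x; rewrite !vnormE; exact: coer.
have lions := @lions_wellposed R tau X Y e cj htau (real_embP hH j) jc (real_emb_dense hj)
  b M om al M0 al0 (real_formPl ha) (real_formPr ha) b_bounded (real_form_measurable ha) b_coercive.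
have bwp := @boundary_wellposed R tau X Y e cj htau (real_embP hH j) jc (real_emb_dense hj)
  b M om al M0 al0 (real_formPl ha) (real_formPr ha) b_bounded (real_form_measurable ha) b_coercive.
have solP := @sol_solution R k V H ipV ipH hV hH j hj tau a ha.
have F0 (t : R) : (0 : L2hilbert tau X) t = dual_ip hV 0.
  by have := dual_ipB hV 0 0; rewrite !subrr => ->.
have TP x : exists v d U,
    [/\ @sol R tau X Y e b 0 v d U, U 0 = x & U tau = propagator ipH j tau a x].
  rewrite /propagator; set P := [set y | _].
  suff [v [U [mv ev cU U0 ->]]] : P (xget 0 P).
    have [w [d [_ s]]] := (solP _ _ _ _ F0).1 (And3 mv ev cU).
    by exists w, d, U.
  have [v [d [U [s /Y_definite/eqP]]]] := lions 0 x; rewrite subr_eq0 => /eqP U0.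
  apply: xgetPex; exists (U tau), v, U.
  by have [|? ? ?] := (solP _ _ v U F0).2 _; [exists v, d|split].
rewrite (bwp Phi _ Y_definite _ TP); last by move=> x y; exact: linearB.
split=> [wp F|wp f sf].
  pose f t := ip_dual hV (F t).
  have FE t : F t = dual_ip hV (f t) by rewrite ip_dualK.
  have sf : square_integrable tau f.
    apply/(square_integrable_dual hV)/(square_integrableP tau hV).
    by apply: sqi_eq (L2P F) => t _; rewrite /= -FE.
  have solve u d U : sol e b F u d U -> U 0 = Phi (U tau) ->
      solves_problem ipH j tau a Phi f u.
    move=> s U0; have [|mu ev cU] := (solP F f u U FE).2 _; first by exists u, d.
    by split=> //; exists U.
  have [[u [mu ev [U cU U0]]] uniq] := wp f sf; split.
    by have [v [d [_ s]]] := (solP F f u U FE).1 (And3 mu ev cU); exists v, d, U.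
  move=> u1 u2 d1 d2 U1 U2 s1 e1 s2 e2.
  apply: ae_onS (uniq _ _ (solve _ _ _ s1 e1) (solve _ _ _ s2 e2)) => t _ ->.
  by rewrite subrr vnorm0.
have [F FE'] := L2_mk ((square_integrableP tau hV _).1 ((square_integrable_dual hV tau _).1 sf)).
have FE t : F t = dual_ip hV (f t) by rewrite FE'.
have [[u [d [U [s U0]]]] uniq] := wp F; split.
  exists u; have [|mu ev cU] := (solP F f u U FE).2 _; first by exists u, d.
  by split=> //; exists U.
move=> u1 u2 [m1 e1 [U1 c1 p1]] [m2 e2 [U2 c2 p2]].
have [v1 [d1 [v1E s1]]] := (solP F f u1 U1 FE).1 (And3 m1 e1 c1).
have [v2 [d2 [v2E s2]]] := (solP F f u2 U2 FE).1 (And3 m2 e2 c2).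
apply: ae_onS (uniq _ _ _ _ _ _ s1 p1 s2 p2) => t _; rewrite vnormE v1E v2E.
by move=> /rnorm_eq0/eqP; rewrite subr_eq0 => /eqP.
Qed.
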